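(* The intermittency expansion $$F(\bar\varphi)+\sum_{n=1}^\infty\frac{\mu^n}{n!}\Bigl[\sum_{k=2}^{2n}F^{(k)}(\bar\varphi)H_{n,k}(\varphi)\Bigr]$$ of ${\bf E}\bigl[F\bigl(\int_{\mathcal D}\varphi(x)M_\mu(dx)\bigr)\bigr]$ is an exactly renormalized expansion in the centered moments of $\int_{\mathcal D}\varphi(x)\,M_\mu(dx)$: for sufficiently smooth $F$, as formal power series in $\mu$, $$ {\bf E}\Bigl[F\Bigl(\int_{\mathcal D}\varphi(x)\,M_\mu(dx)\Bigr)\Bigr]=F(\bar\varphi)+\sum_{n=1}^\infty\frac{\mu^n}{n!}\Bigl[\sum_{k=0}^\infty\frac{F^{(k)}(\bar\varphi)}{k!}\,\frac{\partial^n}{\partial\mu^n}\Big|_{\mu=0}{\bf E}\Bigl[\Bigl(\int_{\mathcal D}\varphi(x)\,M_\mu(dx)-\bar\varphi\Bigr)^k\Bigr]\Bigr]. $$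
   Context: Setting. $X(y)$ is a centered (regularized) Gaussian process on $\mathbb{R}^d$ with covariance $g(x,y)={\bf Cov}(X(x),X(y))$, where $g$ may depend on a regularization parameter $\varepsilon>0$ that is suppressed from the notation. For $\mu>0$ (the intermittency), $$\omega_\mu(y)=\sqrt{\mu}\,X(y)-\frac{\mu}{2}{\bf Var}\,X(y),$$ and $M_\mu(dy)=e^{\omega_\mu(y)}\,dy$; integration with respect to $M_\mu$ is understood in the sense of the $\varepsilon\to0$ limit. $\mathcal D\subset\mathbb{R}^d$ is a fixed compact region, $\varphi>0$ a fixed function on $\mathcal D$, and $\bar\varphi=\int_{\mathcal D}\varphi(x)\,dx$. $F^{(k)}$ is the $k$th derivative of $F$. The positive integer moments ${\bf E}\bigl[(\int_{\mathcal D}\varphi\,dM_\mu)^l\bigr]$ are given formally by $$S_l[\varphi](\mu)=\int_{\mathcal D^l}\prod_{i=1}^l\varphi(x_i)\,\exp\Bigl(\mu\sum_{1\le i<j\le l}g(x_i,x_j)\Bigr)dx_1\cdots dx_l,$$ and the centered moments are their corresponding binomial combinations. The expansion coefficients are, for $n\ge 1$, $k\ge 2$, $$H_{n,k}(\varphi)=\frac{(-1)^k}{k!}\sum_{l=2}^k(-1)^l\binom{k}{l}\,\bar\varphi^{\,k-l}\,\frac{\partial^nS_l[\varphi]}{\partial\mu^n}\Big|_{\mu=0}.$$ The intermittency expansion of ${\bf E}[F(\int_{\mathcal D}\varphi\,dM_\mu)]$ is the formal power series in $\mu$ obtained from its $\mu$-derivatives at $\mu=0$; convergence is not part of the claim.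 *)

(* Defs.v *)
From HB Require Import structures.
From mathcomp Require Import all_boot all_order all_algebra.
From mathcomp Require Import all_classical all_reals all_analysis.
Set Implicit Arguments.
Unset Strict Implicit.
Unset Printing Implicit Defensive.
Import Order.TTheory GRing.Theory Num.Theory.
Import numFieldNormedType.Exports.
Local Open Scope classical_set_scope.
Local Open Scope ring_scope.

(* Product powers of a sigma-finite measure, on the product sigma-algebra of
   n.-tuple T; they provide both Lebesgue measure on R^d and integration over
   D^l. *)
Section pow_measure.
Context d (T : measurableType d) (R : realType).
Variable m : {sigma_finite_measure set T -> \bar R}.

Definition tuple_cons n (p : T * n.-tuple T) : n.+1.-tuple T :=
  [the n.+1.-tuple T of p.1 :: p.2].

Lemma measurable_tuple_cons n :
  measurable_fun [set: T * n.-tuple T] (@tuple_cons n).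
Proof. exact: measurable_cons. Qed.

Section step.
Variables (n : nat) (p : {sigma_finite_measure set (n.-tuple T) -> \bar R}).

Definition pow_measure_step : set (n.+1.-tuple T) -> \bar R :=
  pushforward (m \x p)%E (@tuple_cons n).

Let measurable_preim (A : set (n.+1.-tuple T)) :
  measurable A -> measurable (@tuple_cons n @^-1` A).
Proof.
by move=> mA; rewrite -[X in measurable X]setTI; exact: measurable_tuple_cons.
Qed.

Let step0 : pow_measure_step set0 = 0%E.
Proof. by rewrite /pow_measure_step /pushforward preimage_set0 measure0. Qed.

Let step_ge0 A : (0 <= pow_measure_step A)%E.
Proof. exact: (@measure_ge0 _ _ _ (m \x p)%E). Qed.

Let step_sigma_additive : semi_sigma_additive pow_measure_step.
Proof.
move=> F mF tF mUF; rewrite /pow_measure_step /pushforward preimage_bigcup.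
apply: measure_semi_sigma_additive.
- by move=> k; exact: measurable_preim.
- apply/trivIsetP => /= i j _ _ ij; rewrite -preimage_setI.
  by move/trivIsetP : tF => /(_ _ _ _ _ ij) ->//; rewrite preimage_set0.
- by rewrite -preimage_bigcup; exact: measurable_preim.
Qed.

HB.instance Definition _ := isMeasure.Build _ _ _ pow_measure_step
  step0 step_ge0 step_sigma_additive.

Let step_sigma_finite : sigma_finite setT pow_measure_step.
Proof.
have [F TF Foo] := sigma_finiteT m.
have [G TG Goo] := sigma_finiteT p.
pose e (k : nat) : nat * nat := odflt (0%N, 0%N) (unpickle k).
pose H k : set (n.+1.-tuple T) :=
  [set t | F (e k).1 (thead t) /\ G (e k).2 [tuple of behead t]].
have mH k : measurable (H k).
  have -> : H k = (fun t : n.+1.-tuple T => tnth t ord0) @^-1` F (e k).1 `&`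
      (fun t : n.+1.-tuple T => [tuple of behead t]) @^-1` G (e k).2 by [].
  apply: measurableI.
  - rewrite -[X in measurable X]setTI; apply: measurable_tnth => //.
    exact: (Foo _).1.
  - rewrite -[X in measurable X]setTI; apply: measurable_behead => //.
    exact: (Goo _).1.
exists H.
  apply/seteqP; split=> [t _|//].
  have : [set: T] (thead t) by [].
  rewrite TF => -[i _ Fi].
  have : [set: n.-tuple T] [tuple of behead t] by [].
  rewrite TG => -[j _ Gj].
  by exists (pickle (i, j)) => //; rewrite /H /e pickleK.
move=> k; split; first exact: mH.
have -> : pow_measure_step (H k) = (m \x p)%E (F (e k).1 `*` G (e k).2).
  rewrite /pow_measure_step /pushforward; congr ((m \x p)%E _).
  apply/funext => -[x t]; rewrite /H /preimage /=.
  by congr (F _ _ /\ G _ _); exact: val_inj.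
have [mF Flt] := Foo (e k).1; have [mG Glt] := Goo (e k).2.
by rewrite product_measure1E// lte_mul_pinfty// ge0_fin_numE.
Qed.

HB.instance Definition _ := Measure_isSigmaFinite.Build _ _ _ pow_measure_step
  step_sigma_finite.

End step.

Fixpoint pow_measure n : {sigma_finite_measure set (n.-tuple T) -> \bar R} :=
  match n with
  | 0%N => dirac [tuple]
  | n'.+1 => pow_measure_step (pow_measure n')
  end.

End pow_measure.

(* R^d, with the product of the Borel sigma-algebras. *)
Notation euclid R d := (d.-tuple (measurableTypeR R)).

Definition lebesgue_euclid (R : realType) (d : nat) :
    {sigma_finite_measure set (euclid R d) -> \bar R} :=
  pow_measure (@lebesgue_measure R) d.

(* d.-tuple R carries no topology in the library: compactness is read in
   'rV[R]_d. *)
Definition euclid_compact (R : realType) (d : nat) (D : set (euclid R d)) :=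
  compact [set (\row_(i < d) (tnth x i : R)) | x in D].

(* Differentiation of functions of the intermittency mu >= 0: limits are taken
   inside [0, +oo[, hence one-sided at mu = 0. *)
Section mu_derivative.
Context (R : realType).
Implicit Types (G : R -> R) (mu : R) (n : nat).

Definition mu_quotient G mu : R -> R := fun nu => (G nu - G mu) / (nu - mu).

Definition mu_derive G mu : R :=
  lim (mu_quotient G mu nu @[nu --> within `[0, +oo[ mu^']).

Definition mu_deriven n G : R -> R := iter n mu_derive G.

Fixpoint mu_derivablen n G mu : Prop :=
  match n with
  | 0%N => True
  | n'.+1 =>
      (\forall nu \near within `[0, +oo[ (nbhs mu), mu_derivablen n' G nu) /\
      cvg (mu_quotient (mu_deriven n' G) mu nu
             @[nu --> within `[0, +oo[ mu^'])
  end.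

(* A formal power series in mu is the sequence of its coefficients. *)
Definition taylor_fps G : nat -> R := fun n => mu_deriven n G 0 / n`!%:R.

Definition asymptotic_to G (a : nat -> R) :=
  forall N, (G mu - \sum_(n < N.+1) a n * mu ^+ n) / mu ^+ N @[mu --> 0^'+]
    --> (0 : R).

End mu_derivative.

Section gaussian.
Context (R : realType) dO (Omega : measurableType dO) (P : probability Omega R).

Definition expect (Y : Omega -> R) : R := fine 'E_P[Y]%E.

(* The library's normal_prob m 0 is not the point mass at m. *)
Definition gaussian_rv (Y : Omega -> R) := exists m s : R,
  forall A : set (measurableTypeR R), measurable A ->
    P (Y @^-1` A) = if s == 0 then \d_m A else normal_prob m s A.

Definition gaussian_process (T : Type) (X : T -> Omega -> R) :=
  forall (n : nat) (x : 'I_n -> T) (a : 'I_n -> R),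
    gaussian_rv (fun w => \sum_(i < n) a i * X (x i) w).

Definition centered_gaussian_process (T : Type) (X : T -> Omega -> R)
    (g : T -> T -> R) :=
  [/\ gaussian_process X,
      forall x, 'E_P[X x]%E = 0%E &
      forall x y, covariance P (X x) (X y) = (g x y)%:E].

Definition cvg_in_law (Y : R -> Omega -> R) (Y0 : Omega -> R) :=
  forall f : R -> R, continuous f -> (exists M, forall x, `|f x| <= M) ->
    expect (f \o Y eps) @[eps --> 0^'+] --> expect (f \o Y0).

Definition centered_moment (m : R) (Y : R -> Omega -> R) (k : nat) : R -> R :=
  fun mu => expect (fun w => (Y mu w - m) ^+ k).

End gaussian.

Section chaos.
Context (R : realType) (d : nat) (D : set (euclid R d)) (phi : euclid R d -> R).

Definition phibar : R := (\int[lebesgue_euclid R d]_(x in D) phi x)%R.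

(* The integral over D of phi against M_mu, with
   omega_mu(x) = sqrt mu * X x - mu / 2 * Var (X x). *)
Definition chaos dO (Omega : measurableType dO) (P : probability Omega R)
    (X : euclid R d -> Omega -> R) (mu : R) (w : Omega) : R :=
  (\int[lebesgue_euclid R d]_(x in D)
     (phi x * expR (Num.sqrt mu * X x w - mu / 2 * fine 'V_P[X x]%E)))%R.

(* S_l[phi](mu) for the kernel g. *)
Definition formal_moment (g : euclid R d -> euclid R d -> R) (l : nat)
    (mu : R) : R :=
  (\int[pow_measure (lebesgue_euclid R d) l]_(x in
       [set x | forall i, D (tnth x i)])
     ((\prod_(i < l) phi (tnth x i)) *
      expR (mu * \sum_(i < l) \sum_(j < l | (i < j)%N)
                   g (tnth x i) (tnth x j))))%R.

Definition Hcoef g (n k : nat) : R :=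
  (-1) ^+ k / k`!%:R *
  \sum_(2 <= l < k.+1)
    (-1) ^+ l * 'C(k, l)%:R * phibar ^+ (k - l) *
    derive1n n (formal_moment g l) 0.

Definition intermittency_fps (F : R -> R) g (n : nat) : R :=
  if n is 0%N then F phibar
  else (n`!%:R)^-1 * \sum_(2 <= k < (2 * n).+1) derive1n k F phibar * Hcoef g n k.

Definition renormalized_term (F : R -> R) (m : nat -> R -> R) (n k : nat) : R :=
  derive1n k F phibar / k`!%:R * mu_deriven n (m k) 0.

Definition renormalized_fps (F : R -> R) (m : nat -> R -> R) (n : nat) : R :=
  if n is 0%N then F phibar
  else (n`!%:R)^-1 * limn (series (renormalized_term F m n)).

End chaos.

Definition smooth_poly_growth (R : realType) (F : R -> R) :=
  (forall k x, derivable (derive1n k F) x 1) /\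
  (forall k, exists (C : R) (p : nat),
     forall x, 0 <= x -> `|derive1n k F x| <= C * (1 + x) ^+ p).

(* Main.v *)
(* Write a = phibar and Y_s for the chaos at mu = s^2. Tonelli and the Gaussian
   moment generating function give E[Y_s^l] = S_l(s^2), so the n-th derivative at
   mu = 0 of the centered moment E[(Y - a)^k] is the binomial combination d(k, n)
   of the n-th derivatives of the S_l. Since |Y_s - a| <= s Z for some Z with
   moments of all orders, E[(Y - a)^k] = O(mu^(k/2)), and d(k, n) = 0 when
   2n < k: this truncates the renormalized series at k = 2n, where it is the
   intermittency series. A Taylor expansion of F at a then yields the asymptotic
   expansion of E[F(Y)] in powers of mu.
   For a fixed regularization, s |-> E[F(Y_s)] is smooth, and its expansion in
   s^2 has no odd terms, so E[F(Y)] is smooth in mu (Whitney) and its Taylor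
   coefficients are those of the expansion.
   As eps -> 0, the exponential moments of g bound the second moments uniformly,
   so the S_l, their derivatives and the moments of the chaos converge; the
   vanishing of d(k, n) passes to the limit, and so does the argument above. *)
Require Import Defs.
From HB Require Import structures.
From mathcomp Require Import all_boot all_order all_algebra.
From mathcomp Require Import ring lra zify.
From mathcomp Require Import all_classical all_reals all_analysis.
From mathcomp Require Import measurable_realfun.
Set Implicit Arguments.
Unset Strict Implicit.
Unset Printing Implicit Defensive.
Import Order.TTheory GRing.Theory Num.Theory.
Import numFieldNormedType.Exports.
Local Open Scope classical_set_scope.
Local Open Scope ring_scope.

(** * Calculus in the intermittency *)

(** The intermittency enters a path of the chaos through sqrt mu, so at mu = 0 the expectation of
    F(Y) cannot be differentiated in mu path by path: paths are smooth in s only. Smoothness in mu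
    needs the cancellation of the odd powers of s, and the source of this cancellation is the
    moments, which are integrals of exp(mu * pair sum of g) and so are smooth in mu itself.

    In the limit, [I mu] is known only through its law, one mu at a time. There is no path to
    differentiate, so the expansion of E[F(I)] is proved as an asymptotic one, and Taylor
    coefficients are identified as far as derivatives exist. Uniform exponential integrability of
    the pair sum over l points holds at a rate that shrinks as l grows; hence moments of order l are
    controlled only for mu below a bound depending on l. This is harmless because each coefficient
    of the expansion involves finitely many orders, but it is why so many hypotheses are stated near
    0+ and separately for each k. *)

Section right_derivative.
Context (R : realType).
Implicit Types (G H : R -> R) (mu l : R).

(** Relational form: it names the value of the derivative, whereas [mu_derive] is a [lim], which
    says nothing until convergence is known. *)
Definition right_deriv G mu l :=
  mu_quotient G mu nu @[nu --> within `[0, +oo[ mu^'] --> l.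

Lemma near_withinP (P : R -> Prop) mu :
  (\forall nu \near within `[0, +oo[ mu^', P nu) <->
  exists2 d, 0 < d & forall nu, 0 <= nu -> nu != mu -> `|nu - mu| < d -> P nu.
Proof.
split=> [[d /= d0 h]|[d d0 h]]; exists d => //=.
  move=> nu nu0 nm dnu; apply: (h nu) => //=; first by rewrite distrC.
  by rewrite in_itv/= andbT.
by move=> nu /= dnu nm; rewrite in_itv/= andbT => nu0; apply: h => //; rewrite distrC.
Qed.

Lemma near_within0P (P : R -> Prop) mu :
  (\forall nu \near within `[0, +oo[ (nbhs mu), P nu) <->
  exists2 d, 0 < d & forall nu, 0 <= nu -> `|nu - mu| < d -> P nu.
Proof.
split=> [[d /= d0 h]|[d d0 h]]; exists d => //=.
  move=> nu nu0 dnu; apply: (h nu) => //=; first by rewrite distrC.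
  by rewrite in_itv/= andbT.
by move=> nu /= dnu; rewrite in_itv/= andbT => nu0; apply: h => //; rewrite distrC.
Qed.

Lemma near_at_right0P (P : R -> Prop) :
  (\forall mu \near 0^'+, P mu) <->
  exists2 d, 0 < d & forall mu, 0 < mu -> mu < d -> P mu.
Proof.
split=> [[d /= d0 h]|[d d0 h]]; exists d => //=.
  by move=> mu mu0 md; apply: h => //=; rewrite sub0r normrN gtr0_norm.
by move=> mu /=; rewrite sub0r normrN => md mu0; apply: h => //; rewrite -(gtr0_norm mu0).
Qed.

(** Uniqueness of limits requires a proper filter; for mu >= 0 the points just to the right of mu
    always lie in the half-line. *)
Global Instance within_dnbhs_proper mu :
  0 <= mu -> ProperFilter (within `[0, +oo[%classic mu^').
Proof.
move=> mu0; apply: Build_ProperFilter_ex => P /near_withinP[d d0 h].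
exists (mu + d / 2); apply: h.
- by rewrite addr_ge0// divr_ge0// ltW.
- by rewrite -subr_eq0 addrAC subrr add0r gt_eqF// divr_gt0.
- by rewrite addrAC subrr add0r gtr0_norm ?divr_gt0// ltr_pdivrMr// ltr_pMr// ltr1n.
Qed.

Lemma right_derivP G mu l : right_deriv G mu l <->
  forall e, 0 < e -> exists2 d, 0 < d & forall nu, 0 <= nu -> nu != mu ->
    `|nu - mu| < d -> `|(G nu - G mu) / (nu - mu) - l| < e.
Proof.
split.
  move=> /cvgrPdist_lt h e e0; have /near_withinP[d d0 hd] := h _ e0.
  by exists d => // nu nu0 nm dnu; rewrite distrC; exact: hd.
move=> h; apply/cvgrPdist_lt => e e0; apply/near_withinP.
have [d d0 hd] := h _ e0.
by exists d => // nu nu0 nm dnu; rewrite distrC; exact: hd.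
Qed.

Lemma mu_deriveE G mu l : 0 <= mu -> right_deriv G mu l -> mu_derive G mu = l.
Proof. by move=> mu0 h; apply: cvg_lim => //; exact: within_dnbhs_proper. Qed.

Lemma eq_right_deriv G H mu l d : 0 <= mu < d ->
  (forall nu, 0 <= nu < d -> G nu = H nu) ->
  right_deriv G mu l -> right_deriv H mu l.
Proof.
move=> /andP[mu0 mud] GH /right_derivP h; apply/right_derivP => e e0.
have [r r0 hr] := h _ e0; exists (Num.min r (d - mu)).
  by rewrite lt_min r0 subr_gt0.
move=> nu nu0 nm; rewrite lt_min => /andP[dr dm].
rewrite -!GH ?mu0 ?mud ?nu0//=; first exact: hr.
by move: dm; rewrite ltr_norml => /andP[_]; rewrite ltrD2r.
Qed.

Lemma right_derivD G H mu l k : right_deriv G mu l -> right_deriv H mu k ->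
  right_deriv (fun x => G x + H x) mu (l + k).
Proof.
move=> hG hH; rewrite /right_deriv.
rewrite [X in X @ _ --> _](_ : _ = mu_quotient G mu \+ mu_quotient H mu).
  exact: cvgD.
by apply/funext => nu /=; rewrite /mu_quotient -mulrDl; congr (_ / _); ring.
Qed.

Lemma right_derivZ c G mu l : right_deriv G mu l ->
  right_deriv (fun x => c * G x) mu (c * l).
Proof.
move=> hG; rewrite /right_deriv.
rewrite [X in X @ _ --> _](_ : _ = (fun nu => c * mu_quotient G mu nu)).
  exact: cvgMl_tmp.
by apply/funext => nu /=; rewrite /mu_quotient mulrA mulrBr.
Qed.

(** Puts the two-sided derivative in the epsilon-delta form of [right_derivP], so that the two
    notions differ only in the points allowed near mu. *)
Lemma is_deriveP G mu l : is_derive mu 1 G l <->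
  forall e, 0 < e -> exists2 d, 0 < d & forall nu, nu != mu ->
    `|nu - mu| < d -> `|(G nu - G mu) / (nu - mu) - l| < e.
Proof.
split.
  move=> [/cvg_ex[/= l' hl] Gl].
  have {}Gl : l' = l by rewrite -Gl; apply/esym/cvg_lim.
  move: hl; rewrite {}Gl => /cvgrPdist_lt h e e0.
  have [d /= d0 hd] := h _ e0; exists d => // nu nm dnu.
  have := hd (nu - mu); rewrite /= sub0r normrN => /(_ dnu).
  rewrite subr_eq0 => /(_ nm); rewrite distrC.
  by rewrite scaler1 subrK mulrC.
move=> h.
have H : h^-1 *: ((G \o shift mu) (h *: (1:R)) - G mu) @[h --> 0^'] --> l.
  apply/cvgrPdist_lt => e e0; have [d d0 hd] := h _ e0.
  exists d => //= k; rewrite /= sub0r normrN => kd k0.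
  have := hd (k + mu); rewrite addrK => /(_ _ kd).
  rewrite -subr_eq0 addrK => /(_ k0); rewrite distrC.
  by rewrite scaler1 mulrC.
split; first by apply/cvg_ex; exists l.
by apply: cvg_lim.
Qed.

Lemma is_derive_right_deriv G mu l : is_derive mu 1 G l -> right_deriv G mu l.
Proof.
move=> /is_deriveP h; apply/right_derivP => e /h[d d0 hd].
by exists d => // nu _; exact: hd.
Qed.

Lemma right_deriv_is_derive G mu l : 0 < mu -> right_deriv G mu l -> is_derive mu 1 G l.
Proof.
move=> mu0 /right_derivP h; apply/is_deriveP => e /h[d d0 hd].
(* At distance less than mu from mu every point is nonnegative, so the restriction to the half-line
   is void. *)
exists (Num.min d mu); first by rewrite lt_min d0.
move=> nu nm; rewrite lt_min => /andP[dd dm]; apply: hd => //.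
by move: dm; rewrite ltr_norml => /andP[+ _]; rewrite ltrBrDl subrr => /ltW.
Qed.

Lemma right_deriv_cvg0 G l : right_deriv G 0 l -> G mu @[mu --> 0^'+] --> G 0.
Proof.
move=> /right_derivP h; apply/cvgrPdist_lt => e e0; apply/near_at_right0P.
have [d d0 hd] := h _ ltr01.
(* Once the quotient is within 1 of l, the increment of G is less than |l| + 1 times mu. *)
exists (Num.min d (e / (`|l| + 1))).
  by rewrite lt_min d0/= divr_gt0// ltr_wpDl.
move=> mu mu0; rewrite lt_min => /andP[md me].
have := hd mu (ltW mu0); rewrite gt_eqF// subr0 gtr0_norm// => /(_ isT md) q1.
have l1 : 0 < `|l| + 1 by rewrite ltr_wpDl.
rewrite distrC -(@ltr_pM2r _ mu^-1) ?invr_gt0//.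
rewrite -[X in _ * X < _](@gtr0_norm _ mu^-1) ?invr_gt0// -normrM.
apply: (@lt_trans _ _ (`|l| + 1)); last first.
  by rewrite ltr_pdivlMr// mulrC -ltr_pdivlMr.
rewrite -[X in `|X|](subrK l) addrC.
by apply: (le_lt_trans (ler_normD _ _)); rewrite ltrD2l.
Qed.
End right_derivative.

(** * Taylor expansion at 0 and uniqueness of asymptotic expansions *)

Section peano.
Context (R : realType).
Implicit Types (G H : R -> R) (mu l : R).

Lemma is_derive_psum n (c : nat -> R) (x : R) :
  is_derive x 1 (fun y => \sum_(k < n.+1) c k * y ^+ k)
    (\sum_(k < n) c k.+1 * k.+1%:R * x ^+ k).
Proof.
elim: n => [|n IH].
  rewrite big_ord0 [X in is_derive _ _ X _](_ : _ = cst (c 0)); first exact: is_derive_cst.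
  by apply/funext => y; rewrite big_ord_recl big_ord0 addr0 expr0 mulr1.
rewrite big_ord_recr [X in is_derive _ _ X _](_ : _ =
   (fun y => \sum_(k < n.+1) c k * y ^+ k) + (c n.+1 \*: (id ^+ n.+1))); last first.
  by apply/funext => y; rewrite big_ord_recr/= !fctE.
apply: is_deriveD; apply: is_derive_eq.
by rewrite /= /GRing.scale /= mulr1 mulrA.
Qed.

Lemma mu_derivableW n G mu : 0 <= mu -> mu_derivablen n.+1 G mu -> mu_derivablen n G mu.
Proof.
by move=> mu0 [/near_within0P[d d0 h] _]; apply: h => //; rewrite subrr normr0.
Qed.

Lemma mu_derivable1 n G mu : 0 <= mu -> mu_derivablen n.+1 G mu ->
  right_deriv G mu (mu_derive G mu).
Proof.
move=> mu0; elim: n => [|n IH] h; last by apply: IH; exact: mu_derivableW.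
by case: h => _ /= h; exact: h.
Qed.

(** [mu_derivablen] peels off the outermost derivative; induction on the order of a Taylor expansion
    needs to peel off the innermost one. *)
Lemma mu_derivable_derive n G mu : mu_derivablen n.+1 G mu ->
  mu_derivablen n (mu_derive G) mu.
Proof.
elim: n mu => [//|n IH] mu [/near_within0P[d d0 h1] h2]; split.
  by apply/near_within0P; exists d => // nu nu0 dnu; apply: IH; exact: h1.
by move: h2; rewrite /mu_deriven iterSr.
Qed.

(* Taylor-Young at the endpoint 0, by the mean value theorem applied to the
   remainder, whose derivative is the remainder of the derivative. *)
Lemma peano n H : mu_derivablen n.+1 H 0 ->
  (H mu - \sum_(k < n.+2) taylor_fps H k * mu ^+ k) / mu ^+ n.+1
    @[mu --> 0^'+] --> (0 : R).
Proof.
elim: n H => [|n IH] H dH.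
  have /right_derivP h := mu_derivable1 (lexx 0) dH.
  apply/cvgrPdist_lt => e /h[d d0 hd]; apply/near_at_right0P; exists d => // mu mu0 mud.
  have := hd mu (ltW mu0); rewrite gt_eqF// => /(_ isT).
  rewrite subr0 gtr0_norm// => /(_ mud).
  rewrite !big_ord_recl big_ord0 /= /taylor_fps /= expr0 !expr1 !mulr1 fact0 divr1 addr0.
  rewrite sub0r normrN; congr (`|_| < e).
  by rewrite (_ : 1`! = 1)%N// divr1; field; rewrite gt_eqF.
have IH' := IH _ (mu_derivable_derive dH).
apply/cvgrPdist_le => e e0.
have /cvgrPdist_le/(_ _ e0)/near_at_right0P[d1 d10 h1] := IH'.
case: (dH) => /near_within0P[d2 d20 h2] _.
apply/near_at_right0P; exists (Num.min d1 d2); first by rewrite lt_min d10.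
move=> mu mu0; rewrite lt_min => /andP[mud1 mud2].
pose r x := H x - \sum_(k < n.+3) taylor_fps H k * x ^+ k.
pose dr x := mu_derive H x - \sum_(k < n.+2) taylor_fps H k.+1 * k.+1%:R * x ^+ k.
have dH1 x : 0 <= x -> x < d2 -> right_deriv H x (mu_derive H x).
  move=> x0 xd; apply: (@mu_derivable1 n _ _ x0); apply: h2 => //.
  by rewrite subr0 ger0_norm.
have rdr x : 0 < x -> x < d2 -> is_derive x 1 r (dr x).
  move=> x0 xd; apply: is_deriveB; last exact: is_derive_psum.
  by apply: right_deriv_is_derive => //; apply: dH1 => //; exact: ltW.
have rdr0 : right_deriv r 0 (dr 0).
  rewrite /dr -mulN1r.
  have -> : r = (fun x => H x + -1 * \sum_(k < n.+3) taylor_fps H k * x ^+ k).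
    by apply/funext => x; rewrite mulN1r.
  apply: right_derivD; first exact: dH1.
  by apply: right_derivZ; apply: is_derive_right_deriv; exact: is_derive_psum.
have r0 : r 0 = 0.
  rewrite /r big_ord_recl big1 ?addr0; last by move=> i _; rewrite exprS mul0r mulr0.
  by rewrite expr0 /taylor_fps/= fact0 divr1 mulr1 subrr.
(* At 0 only the right derivative is available, and right continuity is all that the closed interval
   asks for. *)
have cr : {within `[0, mu], continuous r}.
  apply/continuous_within_itvP => //; split.
  - move=> x; rewrite in_itv/= => /andP[x0 xm].
    have [+ _] := rdr x x0 (lt_trans xm mud2).
    by move/derivable1_diffP/differentiable_continuous.
  - exact: right_deriv_cvg0 rdr0.
  - have [+ _] := rdr mu mu0 mud2.
    move=> /derivable1_diffP/differentiable_continuous.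
    exact: cvg_at_left_filter.
have [|c + ] := @MVT _ r dr 0 mu mu0 _ cr.
  by move=> x; rewrite in_itv/= => /andP[x0 xm]; apply: rdr => //; exact: lt_trans xm mud2.
rewrite in_itv/= => /andP[c0 cm]; rewrite r0 !subr0 -/(r mu) => ->.
rewrite sub0r normrN.
have := h1 c c0 (lt_trans cm mud1); rewrite sub0r normrN.
(* The derivative of the Taylor polynomial of H is the Taylor polynomial of its derivative, because
   (k + 1) / (k + 1)! = 1 / k!. *)
have -> : (mu_derive H c - \sum_(k < n.+2) taylor_fps (mu_derive H) k * c ^+ k) = dr c.
  rewrite /dr; congr (_ - _); apply: eq_bigr => k _; congr (_ * _).
  rewrite /taylor_fps /mu_deriven iterSr factS natrM; field.
  by rewrite pnatr_eq0 -lt0n fact_gt0 nat1r pnatr_eq0.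
rewrite normrM normfV [`|c ^+ _|]gtr0_norm ?exprn_gt0// => hc.
rewrite normrM normrM normfV (gtr0_norm mu0) (gtr0_norm (exprn_gt0 _ mu0)).
rewrite ler_pdivrMr ?exprn_gt0// exprSr mulrA ler_pM2r//.
rewrite ler_pdivrMr ?exprn_gt0// in hc; apply: (le_trans hc).
by rewrite ler_pM2l// lerXn2r ?nnegrE ?ltW.
Qed.

Lemma asymptotic_taylor H : (forall n, mu_derivablen n H 0) ->
  asymptotic_to H (taylor_fps H).
Proof.
move=> dH [|n]; last exact: peano.
have := right_deriv_cvg0 (mu_derivable1 (lexx 0) (dH 1)).
under [fun x => (_ - _) / _]eq_fun do
  rewrite big_ord_recl big_ord0 addr0 !expr0 mulr1 divr1 /taylor_fps/= fact0 divr1.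
by move=> /subr_cvg0; exact.
Qed.

(** Taking the top term off the quotient and multiplying by mu lowers the order, so the lower
    coefficients vanish by induction; what remains of the quotient is the constant [a n]. *)
Lemma psum_small_eq0 n (a : nat -> R) :
  (\sum_(k < n.+1) a k * mu ^+ k) / mu ^+ n @[mu --> 0^'+] --> (0 : R) ->
  forall k, (k <= n)%N -> a k = 0.
Proof.
have cst_eq0 (c : R) : c @[_ --> (0:R)^'+] --> (0 : R) -> c = 0.
  by move=> hc; rewrite -(cvg_lim (@Rhausdorff R) hc); apply/esym/cvg_lim => //; exact: cvg_cst.
elim: n => [|n IH] h.
  move=> k; rewrite leqn0 => /eqP->; apply: cst_eq0.
  move: h; apply: cvg_trans; apply: near_eq_cvg; near=> mu.
  by rewrite big_ord_recl big_ord0 addr0 !expr0 mulr1 divr1.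
have an k : (k <= n)%N -> a k = 0.
  apply: IH.
  have : mu * ((\sum_(k < n.+2) a k * mu ^+ k) / mu ^+ n.+1 - a n.+1)
      @[mu --> 0^'+] --> (0 * (0 - a n.+1) : R).
    apply: cvgM; first exact/cvg_at_right_filter/cvg_id.
    by apply: cvgB => //; exact: cvg_cst.
  rewrite mul0r; apply: cvg_trans; apply: near_eq_cvg; near=> mu.
  have mu0 : mu != 0 by rewrite gt_eqF.
  by rewrite big_ord_recr/= !exprS; field; rewrite expf_neq0//= mu0.
move=> k; rewrite leq_eqVlt => /predU1P[->|]; last by rewrite ltnS; exact: an.
apply: cst_eq0.
move: h; apply: cvg_trans; apply: near_eq_cvg; near=> mu.
have mu0 : mu != 0 by rewrite gt_eqF.
rewrite big_ord_recr/= big1 => [|i _]; last by rewrite an ?mul0r// -ltnS.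
by rewrite add0r mulfK// expf_neq0.
Unshelve. all: end_near. Qed.

(** The difference of two expansions is a polynomial that is o(mu^n). The finite order serves the
    places where expansions are compared only up to n. *)
Lemma asymptotic_unique_upto n G (a b : nat -> R) :
  (G mu - \sum_(k < n.+1) a k * mu ^+ k) / mu ^+ n @[mu --> 0^'+] --> (0 : R) ->
  (G mu - \sum_(k < n.+1) b k * mu ^+ k) / mu ^+ n @[mu --> 0^'+] --> (0 : R) ->
  forall k, (k <= n)%N -> a k = b k.
Proof.
move=> ha hb k kn; apply/eqP; rewrite -subr_eq0; apply/eqP; move: k kn.
apply: (@psum_small_eq0 n (fun k => a k - b k)).
have := cvgB hb ha; rewrite subr0 => h.
under eq_fun => mu.
  rewrite (_ : _ / _ = (G mu - \sum_(k < n.+1) b k * mu ^+ k) / mu ^+ n -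
                       (G mu - \sum_(k < n.+1) a k * mu ^+ k) / mu ^+ n); first over.
  rewrite -mulrBl; congr (_ / _).
  rewrite opprB addrC addrA subrK -sumrB; apply: eq_bigr => i _.
  by rewrite mulrBl.
exact: h.
Qed.

Lemma asymptotic_step G (a : nat -> R) n :
  (G mu - \sum_(k < n.+2) a k * mu ^+ k) / mu ^+ n.+1 @[mu --> 0^'+] --> (0 : R) ->
  (G mu - \sum_(k < n.+1) a k * mu ^+ k) / mu ^+ n @[mu --> 0^'+] --> (0 : R).
Proof.
move=> h.
have : mu * ((G mu - \sum_(k < n.+2) a k * mu ^+ k) / mu ^+ n.+1 + a n.+1)
    @[mu --> 0^'+] --> (0 * (0 + a n.+1) : R).
  apply: cvgM; first exact/cvg_at_right_filter/cvg_id.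
  by apply: cvgD => //; exact: cvg_cst.
rewrite mul0r; apply: cvg_trans; apply: near_eq_cvg; near=> mu.
have mu0 : mu != 0 by rewrite gt_eqF.
by rewrite [\sum_(k < n.+2) _]big_ord_recr/= !exprS; field; rewrite expf_neq0//= mu0.
Unshelve. all: end_near. Qed.

Lemma asymptotic_unique G (a b : nat -> R) :
  asymptotic_to G a -> asymptotic_to G b -> a = b.
Proof.
move=> ha hb; apply/funext => n.
exact: (asymptotic_unique_upto (ha n) (hb n)).
Qed.

(** [G] lists the successive derivatives explicitly; exhibiting such a list is how iterated
    differentiability is established. *)
Definition right_smooth N d (G : nat -> R -> R) := forall n mu, (n < N)%N ->
  0 <= mu < d -> right_deriv (G n) mu (G n.+1 mu).

(** A derivative at mu < d sees only points near mu, so agreement of H with the list on [0, d[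
    propagates from each order to the next. *)
Lemma right_smooth_deriven N d H (G : nat -> R -> R) : right_smooth N d G ->
  (forall mu, 0 <= mu < d -> H mu = G 0%N mu) ->
  forall n mu, (n <= N)%N -> 0 <= mu < d ->
    mu_derivablen n H mu /\ mu_deriven n H mu = G n mu.
Proof.
move=> sG HG; elim=> [|n IH] mu nN /andP[mu0 mud].
  by split => //; rewrite /mu_deriven/= HG// mu0.
have IH' nu (h : 0 <= nu < d) := IH nu (ltnW nN) h.
have dn : right_deriv (mu_deriven n H) mu (G n.+1 mu).
  apply: (@eq_right_deriv _ (G n) _ _ _ d); first by rewrite mu0.
    by move=> nu /IH'[].
  by apply: sG => //; rewrite mu0.
split; last by rewrite /mu_deriven iterS; exact: mu_deriveE.
split; last by apply/cvg_ex; exists (G n.+1 mu).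
apply/near_within0P; exists (d - mu); first by rewrite subr_gt0.
move=> nu nu0 dnu; have [] // := IH' nu.
by rewrite nu0/=; move: dnu; rewrite ltr_norml => /andP[_]; rewrite ltrD2r.
Qed.

End peano.

(** * Smoothness in mu from smoothness in sqrt mu *)

Section whitney.
Context (R : realType).
Implicit Types (G H : R -> R) (mu l : R).

Definition smooth_on N d H := exists2 G : nat -> R -> R, right_smooth N d G &
  forall mu, 0 <= mu < d -> H mu = G 0%N mu.

Lemma smooth_on0 d H : smooth_on 0 d H.
Proof. by exists (fun=> H). Qed.

Lemma smooth_onS N d H H' :
  (forall mu, 0 <= mu < d -> right_deriv H mu (H' mu)) ->
  smooth_on N d H' -> smooth_on N.+1 d H.
Proof.
move=> dH [G sG HG]; exists (fun n => if n is m.+1 then G m else H) => //.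
move=> [|n] mu nN mud; last exact: sG.
by rewrite -HG//; exact: dH.
Qed.

Lemma smooth_onD N d H1 H2 : smooth_on N d H1 -> smooth_on N d H2 ->
  smooth_on N d (fun x => H1 x + H2 x).
Proof.
move=> [G1 s1 e1] [G2 s2 e2]; exists (fun n x => G1 n x + G2 n x).
  by move=> n mu nN mud; apply: right_derivD; [exact: s1|exact: s2].
by move=> mu mud; rewrite e1// e2.
Qed.

Lemma smooth_onZ N d c H : smooth_on N d H -> smooth_on N d (fun x => c * H x).
Proof.
move=> [G s e]; exists (fun n x => c * G n x).
  by move=> n mu nN mud; apply: right_derivZ; exact: s.
by move=> mu mud; rewrite e.
Qed.

Lemma smooth_on_psum N d n (c : nat -> R) :
  smooth_on N d (fun x => \sum_(k < n) c k * x ^+ k).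
Proof.
elim: N n c => [|N IH] n c; first exact: smooth_on0.
apply: (@smooth_onS _ _ _ (fun x => \sum_(k < n.-1) c k.+1 * k.+1%:R * x ^+ k)); last first.
  exact: (IH n.-1 (fun k => c k.+1 * k.+1%:R)).
move=> mu _; apply: is_derive_right_deriv; case: n => [|n]; last exact: is_derive_psum.
rewrite big_ord0 (_ : (fun x => _) = cst 0); first exact: is_derive_cst.
by apply/funext => x; rewrite big_ord0.
Qed.

(** Both terms keep the original shape, with [dr] over the power a + 1 and [r] over the power a + 2.
    Counting [dr] as one order further, each term costs exactly two, which makes the family in
    [smooth_on_remainder] closed under differentiation. *)
Lemma is_derive_div_sqrt (r : R -> R) (dr : R) a mu : 0 < mu ->
  is_derive (Num.sqrt mu) 1 r dr ->
  is_derive mu 1 (fun x => r (Num.sqrt x) / Num.sqrt x ^+ a)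
    (2^-1 * (dr / Num.sqrt mu ^+ a.+1) +
     (- (a%:R / 2)) * (r (Num.sqrt mu) / Num.sqrt mu ^+ a.+2)).
Proof.
move=> mu0 dr_; have s0 : 0 < Num.sqrt mu by rewrite sqrtr_gt0.
pose s : R := Num.sqrt mu.
have dinv : is_derive s 1 (fun y : R => y^-1) (- s ^- 2).
  have := @is_deriveV R id s 1 1 (lt0r_neq0 s0) (is_derive_id s 1).
  by rewrite /GRing.scale/= mulr1.
have du : is_derive s 1 (r * (fun y : R => y^-1) ^+ a)
    (r s * (a%:R * s ^- 1 ^+ a.-1 * - s ^- 2) + s^-1 ^+ a * dr).
  by apply: is_derive_eq; rewrite /GRing.scale/= fctE expr1.
have := @is_derive1_comp R _ Num.sqrt mu _ _ du (is_derive1_sqrt mu0).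
rewrite (_ : _ \o _ = (fun x => r (Num.sqrt x) / Num.sqrt x ^+ a)); last first.
  by apply/funext => x /=; rewrite !fctE exprVn.
move=> h; apply: is_derive_eq.
rewrite -/s; case: a {h du} => [|a]; rewrite /= ?exprVn ?expr1 ?expr0 ?exprS; field.
  by rewrite /= gt_eqF.
have s_neq0 : s != 0 by rewrite gt_eqF.
by rewrite s_neq0 expf_neq0.
Qed.

Section remainder.
Variables (K : nat) (r : nat -> R -> R).
Hypothesis r_deriv : forall j (s : R), (j < K)%N -> 0 < s < 1 -> is_derive s 1 (r j) (r j.+1 s).
Hypothesis r0 : forall j, (j <= K)%N -> r j 0 = 0.
Hypothesis r_small : forall j, (j <= K)%N -> r j s / s ^+ (K - j) @[s --> 0^'+] --> (0 : R).

(* Each derivative in mu costs two powers of sqrt mu. *)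
Lemma smooth_on_remainder n j a : (j + a + n.*2 <= K)%N ->
  smooth_on n 1 (fun mu => r j (Num.sqrt mu) / Num.sqrt mu ^+ a).
Proof.
elim: n j a => [|n IH] j a jaK; first exact: smooth_on0.
have jK : (j < K)%N by lia.
apply: (@smooth_onS _ _ _ (fun mu =>
    2^-1 * (r j.+1 (Num.sqrt mu) / Num.sqrt mu ^+ a.+1) +
    (- (a%:R / 2)) * (r j (Num.sqrt mu) / Num.sqrt mu ^+ a.+2))); last first.
  by apply: smooth_onD; apply: smooth_onZ; apply: IH; lia.
move=> mu /andP[]; rewrite le_eqVlt => /predU1P[<- _|mu0 mu1]; last first.
  apply: is_derive_right_deriv; apply: is_derive_div_sqrt => //.
  by apply: r_deriv => //; rewrite sqrtr_gt0 mu0 -sqrtr1 ltr_sqrt.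
(* At mu = 0 the candidate derivative evaluates to 0, by the convention that the inverse of 0 is 0;
   this is also the true value. *)
rewrite sqrtr0 !exprS !mul0r invr0 !mulr0 addr0.
apply/right_derivP => e e0.
have /cvgrPdist_lt/(_ _ e0)/near_at_right0P[d d0 hd] := r_small (ltnW jK).
(* The bound [d] applies to s = sqrt nu, hence its square to nu. *)
exists (Num.min 1 (d ^+ 2)); first by rewrite lt_min ltr01/= exprn_gt0.
move=> nu nu0 nu_neq0; rewrite !subr0 sqrtr0 ger0_norm// lt_min => /andP[nu1 nud].
rewrite r0 1?ltnW// mul0r subr0.
have {}nu0 : 0 < nu by rewrite lt_neqAle eq_sym nu_neq0.
set s := Num.sqrt nu; have s0 : 0 < s by rewrite sqrtr_gt0.
have s1 : s < 1 by rewrite -sqrtr1 ltr_sqrt.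
have sd : s < d by rewrite -(gtr0_norm d0) -sqrtr_sqr ltr_sqrt// exprn_gt0.
have -> : nu = s ^+ 2 by rewrite sqr_sqrtr// ltW.
have := hd s s0 sd; rewrite sub0r normrN; apply: le_lt_trans.
(* The quotient by nu is r / s^(a + 2); since a + 2 <= K - j and s < 1, it is dominated by r / s^(K
   - j), which tends to 0. *)
rewrite -mulrA -invfM -exprD !normrM !normfV ler_wpM2l//.
rewrite !gtr0_norm ?exprn_gt0// lef_pV2 ?posrE ?exprn_gt0//.
by apply: ler_wiXn2l; [exact: ltW|exact: ltW|lia].
Qed.
End remainder.

Lemma sum_even (b : nat -> R) (x : R) M : (forall k, odd k -> b k = 0) ->
  \sum_(k < M.*2.+1) b k * x ^+ k = \sum_(n < M.+1) b n.*2 * (x ^+ 2) ^+ n.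
Proof.
move=> b0; elim: M => [|M IH]; first by rewrite !big_ord_recl !big_ord0 !expr0.
rewrite doubleS big_ord_recr big_ord_recr/= IH [in RHS]big_ord_recr/=.
by rewrite b0 /= ?odd_double// mul0r addr0 -exprM mulnC muln2 doubleS.
Qed.

(* Whitney: h is smooth in s = sqrt mu; the expansion of h (sqrt mu) in powers
   of mu kills the odd derivatives of h at 0, so h (sqrt mu) is smooth in mu. *)
Lemma whitney (h : nat -> R -> R) (a : nat -> R) :
  (forall n s, 0 <= s < 1 -> right_deriv (h n) s (h n.+1 s)) ->
  asymptotic_to (fun mu => h 0%N (Num.sqrt mu)) a ->
  forall N, smooth_on N 1 (fun mu => h 0%N (Num.sqrt mu)).
Proof.
move=> dh ah N.
have hder j n s : 0 <= s < 1 -> mu_derivablen n (h j) s /\ mu_deriven n (h j) s = h (j + n)%N s.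
  move=> s01; apply: (@right_smooth_deriven _ n 1 (h j) (fun i => h (j + i)%N)) => //.
    by move=> i t _ t01; rewrite addnS; exact: dh.
  by move=> t _; rewrite addn0.
have h00 : 0 <= (0:R) < 1 by rewrite lexx ltr01.
have ht j : asymptotic_to (h j) (fun k => h (j + k)%N 0 / k`!%:R).
  have := @asymptotic_taylor _ (h j) (fun n => (hder j n 0 h00).1).
  congr asymptotic_to; apply/funext => k.
  by rewrite /taylor_fps (hder j k 0 h00).2.
(* An expansion in mu = s^2 read as an expansion in s. *)
pose b k : R := if odd k then 0 else a k./2.
have hb : asymptotic_to (h 0%N) b.
  suff even M : (h 0%N s - \sum_(k < M.*2.+1) b k * s ^+ k) / s ^+ M.*2
      @[s --> 0^'+] --> (0:R).
    (* An expansion to order 2n contains the one to order n, so even orders suffice. *)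
    have down k n : (h 0%N s - \sum_(i < (k + n).+1) b i * s ^+ i) / s ^+ (k + n)
        @[s --> 0^'+] --> (0:R) ->
        (h 0%N s - \sum_(i < n.+1) b i * s ^+ i) / s ^+ n @[s --> 0^'+] --> (0:R).
      by elim: k => [|k IH]; rewrite ?add0n// addSn => /asymptotic_step/IH.
    by move=> n; apply: (down n); rewrite addnn; exact: even.
  apply/cvgrPdist_lt => e e0.
  have /cvgrPdist_lt/(_ _ e0)/near_at_right0P[d d0 hd] := ah M.
  apply/near_at_right0P; exists (Num.sqrt d); first by rewrite sqrtr_gt0.
  move=> s s0 sd; have := hd (s ^+ 2).
  rewrite exprn_gt0// => /(_ isT).
  have -> : s ^+ 2 < d by rewrite -(sqr_sqrtr (ltW d0)) ltrXn2r// ?nnegrE// ltW.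
  move=> /(_ isT); rewrite sqrtr_sqr (gtr0_norm s0) -exprM mulnC muln2.
  rewrite (@sum_even b) => [|k]; last by rewrite /b => ->.
  have -> // : \sum_(n < M.+1) b n.*2 * (s ^+ 2) ^+ n = \sum_(n < M.+1) a n * (s ^+ 2) ^+ n.
  by apply: eq_bigr => i _; rewrite /b odd_double doubleK.
(* Uniqueness of the expansion in s: this is where the odd derivatives of [h] at 0 are seen to
   vanish. *)
have b_h k : h k 0 = b k * k`!%:R.
  by rewrite -(asymptotic_unique (ht 0%N) hb) add0n divfK// pnatr_eq0 -lt0n fact_gt0.
pose K := N.*2.
pose c j k := h (j + k)%N 0 / k`!%:R.
pose r j s := h j s - \sum_(k < (K - j).+1) c j k * s ^+ k.
have rder j (s : R) : (j < K)%N -> 0 < s < 1 -> is_derive s 1 (r j) (r j.+1 s).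
  move=> jK /andP[s0 s1]; apply: is_deriveB.
    by apply: right_deriv_is_derive => //; apply: dh; rewrite s1 ltW.
  have -> : \sum_(k < (K - j.+1).+1) c j.+1 k * s ^+ k =
            \sum_(k < (K - j)) c j k.+1 * k.+1%:R * s ^+ k.
    rewrite subnSK//; apply: eq_bigr => k _; congr (_ * _).
    rewrite /c addSnnS factS natrM; field.
    by rewrite pnatr_eq0 -lt0n fact_gt0 nat1r pnatr_eq0.
  exact: is_derive_psum.
have r_0 j : r j 0 = 0.
  rewrite /r big_ord_recl big1 ?addr0; last by move=> i _; rewrite exprS mul0r mulr0.
  by rewrite /c addn0 fact0 divr1 mulr1 subrr.
have rs : smooth_on N 1 (fun mu => r 0%N (Num.sqrt mu)).
  have := @smooth_on_remainder K r rder (fun j _ => r_0 j) (fun j _ => ht j (K - j)%N) N 0 0.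
  by rewrite !add0n => /(_ (leqnn _)); congr smooth_on; apply/funext => x; rewrite expr0 divr1.
(* The Taylor polynomial that was taken off has degree 2N and only even terms, so it is a polynomial
   in mu and can be added back. *)
have := smooth_onD rs (smooth_on_psum N 1 N.+1 (fun k => c 0%N k.*2)).
move=> [G sG HG]; exists G => // mu mu01; rewrite -HG// /r /K subn0.
rewrite (@sum_even (c 0%N)) => [|k ok]; last by rewrite /c add0n b_h /b ok !mul0r.
by rewrite sqr_sqrtr ?subrK//; case/andP: mu01.
Qed.
End whitney.

(** * Expectations of smooth functions *)

Section taylor_growth.
Context (R : realType).
Implicit Types (F : R -> R) (a y : R).

(** The lower bound on x keeps it nonnegative when a and y are: growth of the derivatives is
    controlled on the half-line only. *)
Lemma MVT_between (f df : R -> R) a y : (forall x : R, is_derive x 1 f (df x)) ->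
  exists x, [/\ Num.min a y <= x, `|x - a| <= `|y - a| & f y - f a = df x * (y - a)].
Proof.
move=> dfx.
have cf (b c : R) : {within `[b, c], continuous f}.
  by apply: derivable_within_continuous => x _; have [] := dfx x.
have [ay|ya|<-] := ltgtP a y; last first.
- by exists a; rewrite !subrr mulr0 lexx.
- have [c cay E] := MVT ya (fun x _ => dfx x) (cf y a).
  move: cay; rewrite in_itv/= => /andP[yc ca]; exists c; split; first exact: ltW.
    by rewrite !ltr0_norm ?subr_lt0// lerN2 lerD2r ltW.
  by rewrite -opprB E -mulrN opprB.
- have [c cay E] := MVT ay (fun x _ => dfx x) (cf a y).
  move: cay; rewrite in_itv/= => /andP[ac cy]; exists c; split => //; first exact: ltW.
  by rewrite !gtr0_norm ?subr_gt0// lerD2r ltW.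
Qed.

Lemma smooth_is_derive F : smooth_poly_growth F ->
  forall k (x : R), is_derive x 1 (derive1n k F) (derive1n k.+1 F x).
Proof. by move=> [dF _] k x; apply: DeriveDef; [exact: dF|rewrite /= derive1E]. Qed.

Lemma smooth_poly_growth_derive F : smooth_poly_growth F -> smooth_poly_growth (derive1 F).
Proof.
have E k : derive1n k (derive1 F) = derive1n k.+1 F by rewrite /derive1n iterSr.
by move=> [dF gF]; split=> [k x|k]; rewrite E; [exact: dF|exact: gF].
Qed.

Definition taylor_sum F a K y :=
  \sum_(k < K) derive1n k F a / k`!%:R * (y - a) ^+ k.

Lemma is_derive_taylor_sum F a K (x : R) :
  is_derive x 1 (taylor_sum F a K.+1) (taylor_sum (derive1 F) a K x).
Proof.
have h := @is_derive_psum R K (fun k => derive1n k F a / k`!%:R) (x - a).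
have d1 : is_derive x 1 (fun y : R => y - a) 1.
  by apply: is_derive_eq; rewrite oppr0 addr0.
have := @is_derive1_comp R _ (fun y => y - a) x _ _ h d1.
rewrite mulr1 (_ : _ \o _ = taylor_sum F a K.+1)//.
congr is_derive; apply: eq_bigr => k _; congr (_ * _).
rewrite /derive1n iterSr factS natrM; field.
by rewrite pnatr_eq0 -lt0n fact_gt0 nat1r pnatr_eq0.
Qed.

(** The remainder vanishes at a and its derivative is the remainder of order K - 1 of F', so the
    mean value theorem gains one factor |y - a| per order. *)
Lemma taylor_growth F K a : smooth_poly_growth F -> 0 <= a ->
  exists C p, 0 <= C /\ forall y, 0 <= y ->
    `|F y - taylor_sum F a K y| <= C * `|y - a| ^+ K * (1 + `|y - a|) ^+ p.
Proof.
move=> + a0; elim: K F => [|K IH] F sF.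
  (* The constant comes from 1 + y <= (1 + a) (1 + |y - a|). *)
  have [C [p h]] := sF.2 0%N; exists (`|C| * (1 + a) ^+ p), p; split.
    by rewrite mulr_ge0// exprn_ge0// addr_ge0.
  move=> y y0; rewrite /taylor_sum big_ord0 subr0 expr0 mulr1.
  apply: (le_trans (h y y0)); rewrite -mulrA -exprMn.
  apply: (@le_trans _ _ (`|C| * (1 + y) ^+ p)).
    by rewrite ler_wpM2r ?ler_norm// exprn_ge0// addr_ge0.
  rewrite ler_wpM2l//; apply: lerXn2r; rewrite ?nnegrE ?mulr_ge0 ?addr_ge0//.
  by have := ler_norm (y - a); have := normr_ge0 (y - a); nra.
have [C [p [C0 h]]] := IH _ (smooth_poly_growth_derive sF).
exists C, p; split => // y y0.
pose r x := F x - taylor_sum F a K.+1 x.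
have dr (x : R) : is_derive x 1 r (derive1 F x - taylor_sum (derive1 F) a K x).
  apply: is_deriveB; last exact: is_derive_taylor_sum.
  exact: (smooth_is_derive sF 0 x).
have [x [mx xa]] := MVT_between a y dr.
have ra : r a = 0.
  rewrite /r /taylor_sum big_ord_recl big1 ?addr0 => [|i _].
    by rewrite fact0 divr1 expr0 mulr1 subrr.
  by rewrite subrr exprS mul0r mulr0.
rewrite ra subr0 -/(r y) => ->; rewrite normrM exprSr mulrA mulrAC ler_wpM2r//.
have x0 : 0 <= x by apply: le_trans mx; rewrite le_min a0.
apply: (le_trans (h x x0)); apply: ler_pM; rewrite ?mulr_ge0 ?exprn_ge0 ?addr_ge0//.
  by rewrite ler_wpM2l// lerXn2r.
by rewrite lerXn2r ?nnegrE ?addr_ge0// lerD2l.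
Qed.

End taylor_growth.

(** * Expansion of E[F(Y)] from the expansions of the centered moments *)

Section expectation_expansion.
Context (R : realType) dO (Omega : measurableType dO) (P : probability Omega R).

Lemma expectE (Z : Omega -> R) : expect P Z = (\int[P]_w Z w)%R.
Proof. by rewrite /expect unlock. Qed.

Lemma integrable_bound d (T : measurableType d) (mu : {measure set T -> \bar R})
    (D : set T) (f h : T -> R) : measurable D -> measurable_fun D f ->
  mu.-integrable D (EFin \o h) -> (forall x, D x -> `|f x| <= h x) ->
  mu.-integrable D (EFin \o f).
Proof.
move=> mD mf ih fh; apply: le_integrable ih => //; first exact/measurable_EFinP.
by move=> x Dx /=; rewrite lee_fin (le_trans (fh x Dx))// ler_norm.
Qed.

Section real_integrable.
Context d (T : measurableType d) (mu : {measure set T -> \bar R}) (D : set T).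
Hypothesis mD : measurable D.

Lemma integrableD_EFin (f h : T -> R) : mu.-integrable D (EFin \o f) ->
  mu.-integrable D (EFin \o h) -> mu.-integrable D (EFin \o (fun x => f x + h x)).
Proof. by move=> fi hi; have := integrableD mD fi hi. Qed.

Lemma integrableZ_EFin k (f : T -> R) : mu.-integrable D (EFin \o f) ->
  mu.-integrable D (EFin \o (fun x => k * f x)).
Proof. by move=> fi; have := integrableZl mD k fi. Qed.

Lemma integrableB_EFin (f h : T -> R) : mu.-integrable D (EFin \o f) ->
  mu.-integrable D (EFin \o h) -> mu.-integrable D (EFin \o (fun x => f x - h x)).
Proof. by move=> fi hi; have := integrableB mD fi hi. Qed.
End real_integrable.

Lemma integrable_sumr d (T : measurableType d) (mu : {measure set T -> \bar R})
    (D : set T) (I : Type) (s : seq I) (f : I -> T -> R) : measurable D ->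
  (forall i, mu.-integrable D (EFin \o f i)) ->
  mu.-integrable D (EFin \o (fun x => \sum_(i <- s) f i x)).
Proof.
move=> mD fi.
rewrite (_ : _ \o _ = fun x => (\sum_(i <- s) (f i x)%:E)%E).
  by apply: integrable_sum => // i _; exact: fi.
by apply/funext => x /=; rewrite sumEFin.
Qed.

Lemma Rintegral_sum d (T : measurableType d) (mu : {measure set T -> \bar R})
    (D : set T) (I : Type) (s : seq I) (f : I -> T -> R) : measurable D ->
  (forall i, mu.-integrable D (EFin \o f i)) ->
  (\int[mu]_(x in D) (\sum_(i <- s) f i x))%R = \sum_(i <- s) (\int[mu]_(x in D) f i x)%R.
Proof.
move=> mD fi; elim: s => [|i s IH].
  by rewrite big_nil; under eq_Rintegral do rewrite big_nil; rewrite /Rintegral integral0.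
rewrite big_cons -IH -RintegralD//; last exact: integrable_sumr.
by apply: eq_Rintegral => x _; rewrite big_cons.
Qed.

Lemma cvg_sumr (T : Type) (A : set_system T) {FA : Filter A} n (f : nat -> T -> R) (l : nat -> R)
  :
  (forall i, f i x @[x --> A] --> l i) ->
  \sum_(i < n) f i x @[x --> A] --> \sum_(i < n) l i.
Proof.
move=> h; elim: n => [|n IH].
  by rewrite big_ord0; under eq_fun do rewrite big_ord0; exact: cvg_cst.
by rewrite big_ord_recr; under eq_fun do rewrite big_ord_recr; exact: cvgD.
Qed.

Lemma near_forall_leq (T : Type) (A : set_system T) {FA : Filter A} n (Q : nat -> T -> Prop) :
  (forall k, \forall x \near A, Q k x) ->
  \forall x \near A, forall k, (k <= n)%N -> Q k x.
Proof.
move=> h; elim: n => [|n IH].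
  by near=> x => k; rewrite leqn0 => /eqP->; near: x; exact: h.
near=> x => k; rewrite leq_eqVlt => /predU1P[->|]; first by near: x; exact: h.
by rewrite ltnS; move: k; near: x.
Unshelve. all: end_near. Qed.

Lemma smooth_measurable (F : R -> R) k : smooth_poly_growth F ->
  measurable_fun setT (derive1n k F).
Proof.
move=> sF; apply: continuous_measurable_fun => x.
exact/differentiable_continuous/derivable1_diffP/sF.1.
Qed.

(** Even exponents make absolute values disappear, so that the bound integrates to moments. *)
Lemma pow_growth_even (x : R) p : 0 <= x ->
  (1 + x) ^+ p <= 2 ^+ p.*2 * (1 + x ^+ p.*2).
Proof.
move=> x0; apply: (@le_trans _ _ ((1 + x) ^+ p.*2)).
  by rewrite ler_weXn2l ?lerDl//; lia.
have [x1|x1] := leP x 1.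
  apply: (@le_trans _ _ (2 ^+ p.*2)).
    by rewrite lerXn2r ?nnegrE ?addr_ge0// -[2]/(1 + 1) lerD2l.
  by rewrite ler_peMr ?exprn_ge0// lerDl exprn_ge0.
apply: (@le_trans _ _ ((2 * x) ^+ p.*2)).
  by rewrite lerXn2r ?nnegrE ?addr_ge0 ?mulr_ge0//; lra.
by rewrite exprMn ler_wpM2l ?exprn_ge0// lerDr.
Qed.

(** Both powers are even and at least 2K: the expectation of the remainder is bounded by two
    centered moments of order at least 2K. *)
Lemma taylor_even_bound (F : R -> R) K a : smooth_poly_growth F -> 0 <= a ->
  exists C q, 0 <= C /\ forall y, 0 <= y ->
    `|F y - taylor_sum F a K.*2 y| <= C * ((y - a) ^+ K.*2 + (y - a) ^+ (K + q).*2).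
Proof.
move=> sF a0; have [C [q [C0 h]]] := taylor_growth K.*2 sF a0.
exists (C * 2 ^+ q.*2), q; split; first by rewrite mulr_ge0// exprn_ge0.
have evn (z : R) n : `|z| ^+ n.*2 = z ^+ n.*2.
  by rewrite -muln2 mulnC !exprM real_normK// num_real.
move=> y y0; apply: (le_trans (h y y0)).
rewrite -!mulrA ler_wpM2l//.
have := pow_growth_even q (normr_ge0 (y - a)).
move=> /(ler_wpM2l (exprn_ge0 K.*2 (normr_ge0 (y - a)))) /le_trans; apply.
rewrite mulrCA ler_wpM2l ?exprn_ge0//.
by rewrite mulrDr mulr1 doubleD exprD !evn.
Qed.

Variables (Y : R -> Omega -> R) (m : R) (F : R -> R) (c : nat -> nat -> R).
Hypothesis m_ge0 : 0 <= m.
Hypothesis sF : smooth_poly_growth F.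
Hypothesis Y_ge0 : forall mu w, 0 <= Y mu w.
Hypothesis Y_meas : \forall mu \near 0^'+, measurable_fun setT (Y mu).
Hypothesis Y_int : forall k, \forall mu \near 0^'+,
  P.-integrable setT (EFin \o (fun w => (Y mu w - m) ^+ k)).

Lemma integrable_smooth mu : measurable_fun setT (Y mu) ->
  (forall k, P.-integrable setT (EFin \o (fun w => (Y mu w - m) ^+ k))) ->
  P.-integrable setT (EFin \o (F \o Y mu)).
Proof.
move=> mY iY; have [C [q [C0 h]]] := taylor_even_bound 0 sF m_ge0.
apply: (@integrable_bound _ _ _ _ _ (fun w => C * ((Y mu w - m) ^+ 0 + (Y mu w - m) ^+ q.*2))).
- by [].
- by apply: measurableT_comp => //; exact: (smooth_measurable 0 sF).
- by apply: integrableZ_EFin => //; apply: integrableD_EFin => //; exact: iY.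
- by move=> w _; have := h _ (Y_ge0 mu w); rewrite /taylor_sum big_ord0 subr0.
Qed.

(** For precision o(mu^N), F is expanded at m up to degree 2N + 1. The remainder is controlled by
    centered moments of order at least 2N + 2, whose coefficients up to mu^N all vanish by the
    truncation hypothesis. *)
Lemma expect_asymptotic :
  (forall k, asymptotic_to (centered_moment P m Y k) (c k)) ->
  (forall k n, (2 * n < k)%N -> c k n = 0) ->
  asymptotic_to (fun mu => expect P (F \o Y mu))
    (fun n => \sum_(k < (2 * n).+1) derive1n k F m / k`!%:R * c k n).
Proof.
move=> hc c0 N.
have [C [q [C0 h]]] := taylor_even_bound N.+1 sF m_ge0.
pose Fk k := derive1n k F m / k`!%:R.
pose M k mu := centered_moment P m Y k mu.
have small j : (N < j)%N -> M j.*2 mu / mu ^+ N @[mu --> 0^'+] --> (0:R).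
  move=> Nj; have := hc j.*2 N.
  have E (x : R) : \sum_(n < N.+1) c j.*2 n * x ^+ n = 0.
    by apply: big1 => i _; rewrite c0 ?mul0r//; have := ltn_ord i; lia.
  by under eq_fun do rewrite E subr0.
have main : \sum_(k < N.+1.*2) Fk k * ((M k mu - \sum_(n < N.+1) c k n * mu ^+ n) / mu ^+ N)
    @[mu --> 0^'+] --> (0:R).
  rewrite [X in _ --> X](_ : _ = \sum_(k < N.+1.*2) Fk k * 0); last first.
    by rewrite big1// => i _; rewrite mulr0.
  by apply: (@cvg_sumr _ _ _ _
    (fun k mu => Fk k * ((M k mu - \sum_(n < N.+1) c k n * mu ^+ n) / mu ^+ N))
    (fun k => Fk k * 0)) => k; apply: cvgMl_tmp; exact: hc.
have bound : C * (M N.+1.*2 mu / mu ^+ N + M (N.+1 + q).*2 mu / mu ^+ N)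
    @[mu --> 0^'+] --> (0:R).
  rewrite [X in _ --> X](_ : _ = C * (0 + 0)); last by rewrite addr0 mulr0.
  by apply: cvgMl_tmp; apply: cvgD; apply: small; lia.
have rest : \forall mu \near 0^'+, `|(expect P (F \o Y mu) - \sum_(k < N.+1.*2) Fk k * M k mu) /
  mu ^+ N|
    <= C * (M N.+1.*2 mu / mu ^+ N + M (N.+1 + q).*2 mu / mu ^+ N).
  (* The neighbourhood on which a moment is integrable depends on its order; only finitely many
     orders occur here. *)
  have ik : \forall mu \near 0^'+, forall k, (k <= (N.+1 + q).*2)%N ->
      P.-integrable setT (EFin \o (fun w => (Y mu w - m) ^+ k)).
    by apply: near_forall_leq; exact: Y_int.
  near=> mu.
  have mu0 : 0 < mu by [].
  have mY : measurable_fun setT (Y mu) by near: mu.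
  have iY k : (k <= (N.+1 + q).*2)%N ->
      P.-integrable setT (EFin \o (fun w => (Y mu w - m) ^+ k)).
    by move: k; near: mu.
  have iT k : (k < N.+1.*2)%N ->
      P.-integrable setT (EFin \o (fun w => Fk k * (Y mu w - m) ^+ k)).
    by move=> kN; apply: integrableZ_EFin => //; apply: iY; lia.
  have iTS : P.-integrable setT (EFin \o (fun w => taylor_sum F m N.+1.*2 (Y mu w))).
    by apply: integrable_sumr => // i; exact: iT.
  have iB : P.-integrable setT (EFin \o (fun w => C * ((Y mu w - m) ^+ N.+1.*2 +
      (Y mu w - m) ^+ (N.+1 + q).*2))).
    apply: integrableZ_EFin => //; apply: integrableD_EFin => //; apply: iY; lia.
  have iR : P.-integrable setT (EFin \o (fun w => F (Y mu w) - taylor_sum F m N.+1.*2 (Y mu w))).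
    apply: (fun mf => integrable_bound measurableT mf iB); last by move=> w _; exact: h.
    apply: measurable_funB; first exact: measurableT_comp (smooth_measurable 0 sF) mY.
    by have /integrableP[/measurable_EFinP] := iTS.
  have iF : P.-integrable setT (EFin \o (F \o Y mu)).
    have := integrableD_EFin measurableT iR iTS.
    by apply: eq_integrable => // w _ /=; rewrite subrK.
  have -> : expect P (F \o Y mu) - \sum_(k < N.+1.*2) Fk k * M k mu =
      (\int[P]_w (F (Y mu w) - taylor_sum F m N.+1.*2 (Y mu w)))%R.
    rewrite RintegralB// expectE; congr (_ - _).
    rewrite Rintegral_sum// => [|i]; last exact: iT.
    apply: eq_bigr => k _; rewrite RintegralZl//; first by rewrite /M /centered_moment expectE.
    by apply: iY; have := ltn_ord k; lia.
  rewrite normrM normfV (gtr0_norm (exprn_gt0 _ mu0)) -mulrDl mulrA ler_pM2r ?invr_gt0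
    ?exprn_gt0//.
  apply: (le_trans (le_normr_Rintegral _ iR)) => //.
  have -> : C * (M N.+1.*2 mu + M (N.+1 + q).*2 mu) = (\int[P]_w (C * ((Y mu w - m) ^+ N.+1.*2 +
      (Y mu w - m) ^+ (N.+1 + q).*2)))%R.
    rewrite RintegralZl//; last by apply: integrableD_EFin => //; apply: iY; lia.
    by rewrite RintegralD// /M /centered_moment ?expectE//; apply: iY; lia.
  apply: le_Rintegral => //; last by move=> w _; exact: h.
  exact: integrable_norm.
have : (expect P (F \o Y mu) - \sum_(k < N.+1.*2) Fk k * M k mu) / mu ^+ N +
   \sum_(k < N.+1.*2) Fk k * ((M k mu - \sum_(n < N.+1) c k n * mu ^+ n) / mu ^+ N)
   @[mu --> 0^'+] --> (0 + 0 : R).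
  apply: cvgD => //; apply/norm_cvg0P.
  apply: (@squeeze_cvgr _ _ _ _ (cst 0) _ _ _ _ _ bound); last exact: cvg_cst.
  by near=> mu; rewrite normr_ge0/=; near: mu.
rewrite addr0; apply: cvg_trans; apply: near_eq_cvg; near=> mu.
have -> : \sum_(k < N.+1.*2) Fk k * ((M k mu - \sum_(n < N.+1) c k n * mu ^+ n) / mu ^+ N) =
   (\sum_(k < N.+1.*2) Fk k * M k mu -
    \sum_(k < N.+1.*2) Fk k * \sum_(n < N.+1) c k n * mu ^+ n) / mu ^+ N.
  rewrite -sumrB mulr_suml; apply: eq_bigr => k _; rewrite mulrA; congr (_ / _).
  exact: mulrBr.
(* After exchanging the sums, k runs up to 2N + 1 for every n; the terms with k > 2n are zero. *)
have -> : \sum_(k < N.+1.*2) Fk k * (\sum_(n < N.+1) c k n * mu ^+ n) =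
    \sum_(n < N.+1) (\sum_(k < (2 * n).+1) Fk k * c k n) * mu ^+ n.
  under eq_bigr do rewrite mulr_sumr.
  rewrite exchange_big/=; apply: eq_bigr => n _.
  rewrite mulr_suml (big_ord_widen N.+1.*2 (fun k => Fk k * c k n * mu ^+ n)); last first.
    by have := ltn_ord n; lia.
  rewrite [RHS]big_mkcond/=; apply: eq_bigr => k _; rewrite mulrA.
  by case: ifPn => //; rewrite ltnS -ltnNge => /c0->; rewrite mulr0 mul0r.
by rewrite -mulrDl addrA subrK.
Unshelve. all: end_near. Qed.
End expectation_expansion.

(** * Integration on product powers *)

Section pow_integral.
Context d (T : measurableType d) (R : realType) (m : {sigma_finite_measure set T -> \bar R}).
Local Open Scope ereal_scope.

Lemma integral_powS n (f : n.+1.-tuple T -> \bar R) :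
  measurable_fun setT f -> (forall t, 0 <= f t) ->
  \int[pow_measure m n.+1]_t f t =
  \int[m]_x \int[pow_measure m n]_t f (tuple_cons (x, t)).
Proof.
move=> mf f0.
have mg : measurable_fun setT (f \o @tuple_cons _ T n).
  by apply: measurableT_comp => //; exact: measurable_tuple_cons.
rewrite -(@fubini_tonelli1 _ _ _ _ _ m (pow_measure m n) _ mg); last by move=> x; exact: f0.
by rewrite /= ge0_integral_pushforward//; exact: measurable_tuple_cons.
Qed.

Lemma integral_pow0 (f : 0.-tuple T -> \bar R) : measurable_fun setT f ->
  \int[pow_measure m 0]_t f t = f [tuple].
Proof. by move=> mf; rewrite /= integral_dirac// diracT mul1e. Qed.

Lemma tnth_cons0 n (x : T) (t : n.-tuple T) : tnth (tuple_cons (x, t)) ord0 = x.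
Proof. by []. Qed.

Lemma tnth_consS n (x : T) (t : n.-tuple T) i :
  tnth (tuple_cons (x, t)) (lift ord0 i) = tnth t i.
Proof. exact: tnthS. Qed.

Lemma measurable_prod_tnth n (q : T -> R) : measurable_fun setT q ->
  measurable_fun setT (fun t : n.-tuple T => (\prod_(i < n) q (tnth t i))%R).
Proof.
move=> mq; apply: (@measurable_prod _ _ _ _ _ _ (fun i (t : n.-tuple T) => q (tnth t i))) => i _;
  apply: measurableT_comp => //.
exact: measurable_tnth.
Qed.

Lemma prod_tuple_cons (q : T -> R) n (x : T) (t : n.-tuple T) :
  (\prod_(i < n.+1) q (tnth (tuple_cons (x, t)) i) = q x * \prod_(i < n) q (tnth t i))%R.
Proof.
by rewrite big_ord_recl tnth_cons0; under eq_bigr do rewrite tnth_consS.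
Qed.

Section weight.
Variables (q : T -> R).
Hypothesis q_meas : measurable_fun setT q.
Hypothesis q_ge0 : forall x, (0 <= q x)%R.
Let A := \int[m]_x (q x)%:E.

Let A_ge0 : 0 <= A. Proof. by apply: integral_ge0 => x _; rewrite lee_fin. Qed.

Let prod_ge0 n (t : n.-tuple T) : 0 <= (\prod_(i < n) q (tnth t i))%:E.
Proof. by rewrite lee_fin prodr_ge0. Qed.

Let mprod n : measurable_fun setT (fun t : n.-tuple T => (\prod_(i < n) q (tnth t i))%:E).
Proof. by apply/measurable_EFinP; apply: measurable_prod_tnth. Qed.

Let int_qZr k : 0 <= k -> \int[m]_x ((q x)%:E * k) = A * k.
Proof.
move=> k0; rewrite ge0_integralZr//; first exact/measurable_EFinP.
by move=> x _; rewrite lee_fin.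
Qed.

Lemma integral_pow_prod n :
  \int[pow_measure m n]_t (\prod_(i < n) q (tnth t i))%:E = A ^+ n.
Proof.
elim: n => [|n IH]; first by rewrite integral_pow0// big_ord0.
rewrite integral_powS//.
under eq_integral => x _.
  under eq_integral do rewrite prod_tuple_cons EFinM.
  rewrite ge0_integralZl// ?lee_fin//; last exact: mprod.
  rewrite IH; over.
by rewrite expeS int_qZr ?expe_ge0.
Qed.

(** Every coordinate other than j integrates out to a factor [A]. Induction peels off the head,
    which either is j or contributes such a factor. *)
Lemma integral_pow_marginal1 n (j : 'I_n.+1) (h : T -> \bar R) :
  measurable_fun setT h -> (forall x, 0 <= h x) ->
  \int[pow_measure m n.+1]_t ((\prod_(i < n.+1) q (tnth t i))%:E * h (tnth t j)) =
  A ^+ n * \int[m]_x ((q x)%:E * h x).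
Proof.
move=> mh h0.
have mqh : measurable_fun setT (fun x => (q x)%:E * h x).
  by apply: emeasurable_funM => //; exact/measurable_EFinP.
have qh0 x : 0 <= (q x)%:E * h x by rewrite mule_ge0// lee_fin.
have mint k (i : 'I_k) : measurable_fun setT
    (fun t : k.-tuple T => (\prod_(i < k) q (tnth t i))%:E * h (tnth t i)).
  apply: emeasurable_funM; first exact: mprod.
  by apply: measurableT_comp => //; exact: measurable_tnth.
elim: n j => [|n IH] j.
  have -> : j = ord0 by apply: val_inj; case: j => -[].
  rewrite integral_powS//; last by move=> t; rewrite mule_ge0.
  rewrite mul1e; apply: eq_integral => x _.
  under eq_integral do rewrite prod_tuple_cons big_ord0 mulr1 tnth_cons0.
  by rewrite integral_pow0.
rewrite integral_powS//; last by move=> t; rewrite mule_ge0.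
case: (unliftP ord0 j) => [i|] ->.
  under eq_integral => x _.
    under eq_integral do rewrite prod_tuple_cons tnth_consS EFinM -muleA.
    rewrite ge0_integralZl ?lee_fin//; last 2 first.
    - exact: mint.
    - by move=> t _; rewrite mule_ge0.
    rewrite IH; over.
  rewrite int_qZr; first by rewrite expeS muleA.
  by rewrite mule_ge0 ?expe_ge0// integral_ge0.
under eq_integral => x _.
  under eq_integral do rewrite prod_tuple_cons tnth_cons0 EFinM muleAC.
  rewrite ge0_integralZl//; last exact: mprod.
  rewrite integral_pow_prod; over.
by rewrite ge0_integralZr ?expe_ge0// muleC.
Qed.

(** The order i < j ensures that j is never the head coordinate: either i is the head, and the
    one-coordinate formula finishes, or both indices lie in the tail. *)
Lemma integral_pow_marginal2 n (i j : 'I_n.+2) (h : T * T -> \bar R) :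
  (i < j)%N -> measurable_fun setT h -> (forall x, 0 <= h x) ->
  \int[pow_measure m n.+2]_t ((\prod_(k < n.+2) q (tnth t k))%:E * h (tnth t i, tnth t j)) =
  A ^+ n * \int[m]_x ((q x)%:E * \int[m]_y ((q y)%:E * h (x, y))).
Proof.
move=> + mh h0.
have mqh : measurable_fun setT (fun z : T * T => (q z.2)%:E * h z).
  apply: emeasurable_funM => //; apply/measurable_EFinP.
  exact: measurableT_comp q_meas measurable_snd.
have qh0 (x y : T) : 0 <= (q y)%:E * h (x, y) by rewrite mule_ge0// lee_fin.
have mh1 x : measurable_fun setT (fun y => h (x, y)).
  by apply: measurableT_comp => //; exact: measurable_pair1.
have mG : measurable_fun setT (fun x => \int[m]_y ((q y)%:E * h (x, y))).
  have F0 (z : T * T) : 0 <= (q z.2)%:E * h z by case: z => x y; exact: qh0.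
  exact: (@measurable_fun_fubini_tonelli_F _ _ _ _ _ m _ mqh F0).
have mqG : measurable_fun setT (fun x => (q x)%:E * \int[m]_y ((q y)%:E * h (x, y))).
  by apply: emeasurable_funM => //; exact/measurable_EFinP.
have G0 x : 0 <= \int[m]_y ((q y)%:E * h (x, y)) by apply: integral_ge0.
have mint k (i' j' : 'I_k) : measurable_fun setT
    (fun t : k.-tuple T => (\prod_(a < k) q (tnth t a))%:E * h (tnth t i', tnth t j')).
  apply: emeasurable_funM; first exact: mprod.
  apply: measurableT_comp => //.
  by apply: measurable_fun_pair; exact: measurable_tnth.
(* The case where the head is a free coordinate. *)
have step k (i' j' : 'I_k) :
    \int[pow_measure m k.+1]_t ((\prod_(a < k.+1) q (tnth t a))%:E *
       h (tnth t (lift ord0 i'), tnth t (lift ord0 j'))) =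
    A * \int[pow_measure m k]_t ((\prod_(a < k) q (tnth t a))%:E * h (tnth t i', tnth t j')).
  rewrite integral_powS//; last by move=> t; rewrite mule_ge0.
  under eq_integral => x _.
    under eq_integral do rewrite prod_tuple_cons !tnth_consS EFinM -muleA.
    rewrite ge0_integralZl ?lee_fin//; last 2 first.
    - exact: mint.
    - by move=> t _; rewrite mule_ge0.
    over.
  by rewrite int_qZr// integral_ge0// => t _; rewrite mule_ge0.
elim: n i j => [|n IH] i j.
  case: (unliftP ord0 j) => [j'|] ->; last by move=> /=; rewrite ltn0.
  case: (unliftP ord0 i) => [i'|] ->; first by rewrite (ord1 i') (ord1 j') ltnn.
  move=> _; rewrite integral_powS//; last by move=> t; rewrite mule_ge0.
  rewrite mul1e; apply: eq_integral => x _.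
  under eq_integral do rewrite prod_tuple_cons tnth_consS tnth_cons0 EFinM -muleA.
  rewrite ge0_integralZl ?lee_fin//; last 2 first.
  - apply: emeasurable_funM; first exact: mprod.
    by apply: (measurableT_comp (mh1 x)); exact: measurable_tnth.
  - by move=> t _; rewrite mule_ge0.
  by rewrite (integral_pow_marginal1 j' (mh1 x))// mul1e.
case: (unliftP ord0 j) => [j'|] ->; last by move=> /=; rewrite ltn0.
case: (unliftP ord0 i) => [i'|] ->.
  by move=> ij; rewrite step IH ?expeS ?muleA//; move: ij; rewrite /= /bump !add1n ltnS.
move=> _; rewrite integral_powS//; last by move=> t; rewrite mule_ge0.
under eq_integral => x _.
  under eq_integral do rewrite prod_tuple_cons tnth_consS tnth_cons0 EFinM -muleA.
  rewrite ge0_integralZl ?lee_fin//; last 2 first.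
  - apply: emeasurable_funM; first exact: mprod.
    by apply: (measurableT_comp (mh1 x)); exact: measurable_tnth.
  - by move=> t _; rewrite mule_ge0.
  rewrite (integral_pow_marginal1 j' (mh1 x))// muleCA.
  over.
by rewrite ge0_integralZl ?expe_ge0// => x _; rewrite mule_ge0// lee_fin.
Qed.
End weight.
End pow_integral.

(** * Differentiation under the integral and exponential families *)

Section under_integral.
Context (R : realType) d (T : measurableType d) (m : {measure set T -> \bar R}).

Lemma is_derive_under_integral (D : set T) (f f' : R -> T -> R) (G : T -> R) (a u v : R) :
  measurable D -> u < a < v ->
  (forall x, u < x < v -> m.-integrable D (EFin \o f x)) ->
  (forall x y, u < x < v -> D y -> is_derive x 1 (f ^~ y) (f' x y)) ->
  m.-integrable D (EFin \o G) ->
  (forall x y, u < x < v -> D y -> `|f' x y| <= G y) ->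
  is_derive a 1 (fun x => \int[m]_(y in D) f x y)%R (\int[m]_(y in D) f' a y)%R.
Proof.
move=> mD ua fi df iG fG.
have d1E x y : u < x < v -> D y -> partial1of2 f x y = f' x y.
  by move=> xI Dy; rewrite partial1of2E; have [_ ->] := df x y xI Dy.
(* The absolute value makes the dominating function nonnegative everywhere, also off [D]. *)
have := @cvg_differentiation_under_integral R d T m f D mD a u v _ _ _ (fun y => `|G y|).
rewrite /= !in_itv/= => /(_ ua) H.
have {H} H : h^-1 *: ((\int[m]_(y in D) f (h + a) y)%R - (\int[m]_(y in D) f a y)%R)
    @[h --> 0^'] --> (\int[m]_(y in D) f' a y)%R.
  rewrite [X in _ --> X](_ : _ = (\int[m]_(y in D) partial1of2 f a y)%R); last first.
    by apply: eq_Rintegral => y; rewrite inE => Dy; rewrite d1E.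
  apply: H.
  - by move=> x; rewrite in_itv/=; exact: fi.
  - by move=> x y; rewrite in_itv/= => xI Dy; have [] := df x y xI Dy.
  - by [].
  - exact: integrable_norm.
  - move=> x y; rewrite in_itv/= => xI Dy; rewrite d1E//.
    by apply: (le_trans (fG x y xI Dy)); exact: ler_norm.
have H' : h^-1 *: (((fun x => \int[m]_(y in D) f x y)%R \o shift a) (h *: (1:R)) -
    (\int[m]_(y in D) f a y)%R) @[h --> 0^'] --> (\int[m]_(y in D) f' a y)%R.
  by under eq_fun do rewrite /= scaler1.
split; first by apply/cvg_ex; eexists; exact: H'.
exact: cvg_lim H'.
Qed.

Lemma pow_le_exp n (e : R) : 0 < e -> exists C : R, 0 <= C /\ forall x, 0 <= x ->
  x ^+ n <= C * expR (e * x).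
Proof.
move=> e0; case: n => [|n].
  by exists 1; split => // x x0; rewrite expr0 mul1r -[leLHS]expR0 ler_expR mulr_ge0// ltW.
(* From t <= exp t at t = e x / (n + 1), raised to the power n + 1. *)
exists ((n.+1%:R / e) ^+ n.+1); split; first by rewrite exprn_ge0// divr_ge0// ltW.
move=> x x0.
have -> : x = (n.+1%:R / e) * (e * x / n.+1%:R).
  by field; rewrite nat1r pnatr_eq0/= (gt_eqF e0).
rewrite exprMn ler_wpM2l// ?exprn_ge0 ?divr_ge0 ?(ltW e0)//.
have -> : expR (e * (n.+1%:R / e * (e * x / n.+1%:R))) = expR (e * x / n.+1%:R) ^+ n.+1.
  rewrite -expRM_natl; congr expR; field.
  by rewrite nat1r pnatr_eq0/= (gt_eqF e0).
have h0 : 0 <= e * x / n.+1%:R by rewrite divr_ge0// mulr_ge0// ltW.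
rewrite lerXn2r ?nnegrE ?expR_ge0//.
by apply: le_trans (expR_ge1Dx _); rewrite lerDr.
Qed.

Section exp_family.
Variables (W k : T -> R) (c : R).
Hypothesis W_meas : measurable_fun setT W.
Hypothesis W_ge0 : forall x, 0 <= W x.
Hypothesis k_meas : measurable_fun setT k.
Hypothesis c_gt0 : 0 < c.
Hypothesis kint : m.-integrable setT (EFin \o (fun x => W x * expR (c * `|k x|))).

(** The gap c - b in the exponential rate absorbs the factor [k x ^+ n]. *)
Lemma exp_family_bound n b : 0 <= b < c -> exists2 C, 0 <= C &
  forall mu x, `|mu| <= b -> `|W x * (k x ^+ n * expR (mu * k x))|
    <= C * (W x * expR (c * `|k x|)).
Proof.
move=> /andP[b0 bc]; have [C [C0 h]] := @pow_le_exp n (c - b) ltac:(by rewrite subr_gt0).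
exists C => // mu x mub; rewrite !normrM (ger0_norm (W_ge0 x)) (mulrCA C) ler_wpM2l//.
rewrite normrX (ger0_norm (expR_ge0 _)).
apply: (@le_trans _ _ (C * expR ((c - b) * `|k x|) * expR (b * `|k x|))).
  apply: ler_pM => //; rewrite ?exprn_ge0 ?expR_ge0//; first exact: h.
  rewrite ler_expR (le_trans (ler_norm _))// normrM ler_wpM2r//.
by rewrite -mulrA -expRD -mulrDl subrK.
Qed.

Lemma exp_family_integrable n mu : `|mu| < c ->
  m.-integrable setT (EFin \o (fun x => W x * (k x ^+ n * expR (mu * k x)))).
Proof.
move=> muc; have [C C0 h] := @exp_family_bound n `|mu| ltac:(by rewrite normr_ge0).
apply: (fun mf => integrable_bound measurableT mf (integrableZ_EFin measurableT C kint)).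
  apply: measurable_funM => //; apply: measurable_funM; first exact: measurable_funX.
  by apply: measurableT_comp => //; exact: measurable_funM.
by move=> x _; exact: h.
Qed.

Lemma is_derive_exp_family n (mu : R) : `|mu| < c ->
  is_derive mu 1 (fun nu => \int[m]_x (W x * (k x ^+ n * expR (nu * k x))))%R
    (\int[m]_x (W x * (k x ^+ n.+1 * expR (mu * k x))))%R.
Proof.
(* The midpoint leaves room on both sides: a neighbourhood of mu inside ]-b, b[, and a gap c - b for
   the polynomial factor. *)
move=> muc; pose b := (`|mu| + c) / 2.
have mub : `|mu| < b by rewrite /b; lra.
have bc : b < c by rewrite /b; lra.
have b0 : 0 <= b by rewrite (le_trans _ (ltW mub)).
have [C C0 h] := @exp_family_bound n.+1 b ltac:(by rewrite b0).
apply: (@is_derive_under_integral setT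
  (fun x y => W y * (k y ^+ n * expR (x * k y)))
  (fun x y => W y * (k y ^+ n.+1 * expR (x * k y))) (fun x => C * (W x * expR (c * `|k x|))) mu
    (- b) b) => //.
- by rewrite -ltr_norml.
- move=> x /andP[x1 x2]; apply: exp_family_integrable; rewrite ltr_norml; apply/andP; split; lra.
- move=> x y _ _.
  have -> : W y * (k y ^+ n.+1 * expR (x * k y)) = (W y * k y ^+ n) * (expR (x * k y) * k y).
    by rewrite exprS; ring.
  rewrite (_ : (fun nu => _) = (W y * k y ^+ n) \*: (expR \o (fun nu => nu * k y))); last first.
    by apply/funext => nu /=; rewrite /GRing.scale/= mulrA.
  apply: is_deriveZ; apply: is_derive1_comp.
  rewrite (_ : (fun nu => _) = k y \*: id); last by apply/funext => nu;
    rewrite /GRing.scale/= mulrC.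
  by apply: is_derive_eq; rewrite /GRing.scale/= mulr1.
- exact: integrableZ_EFin.
- move=> x y xb _; apply: h; rewrite ler_norml; move: xb => /andP[x1 x2]; apply/andP; split; lra.
Qed.

End exp_family.
End under_integral.

(** * Weak convergence with second moments *)

Section weak_convergence.
Context (R : realType) d (T : measurableType d) (m : {measure set T -> \bar R}).
Variable W : T -> R.
Hypothesis W_ge0 : forall x, 0 <= W x.
Hypothesis W_int : m.-integrable setT (EFin \o W).

Let W_meas : measurable_fun setT W.
Proof. by have /integrableP[/measurable_EFinP] := W_int. Qed.

Lemma integrable_weight_bounded (h : T -> R) B : measurable_fun setT h ->
  (forall x, `|h x| <= B) -> m.-integrable setT (EFin \o (fun x => W x * h x)).
Proof.
move=> mh hB; apply: (fun mf => integrable_bound measurableT mf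
  (integrableZ_EFin measurableT B W_int)).
  exact: measurable_funM.
by move=> x _; rewrite normrM (ger0_norm (W_ge0 x)) mulrC ler_wpM2r.
Qed.

(* Bounded continuous substitutes for y^2 and y. *)
Definition damp_sqr (n : nat) (y : R) := y ^+ 2 / (1 + y ^+ 2 / n.+1%:R).
Definition damp (M y : R) := y / (1 + (y / M) ^+ 2).

Lemma damp_sqr_bounds n y : 0 <= damp_sqr n y /\ damp_sqr n y <= n.+1%:R.
Proof.
have y2 : 0 <= y ^+ 2 by rewrite ?sqr_ge0.
have p : 0 < 1 + y ^+ 2 / n.+1%:R by rewrite ltr_pwDl// divr_ge0.
rewrite /damp_sqr; split; first by rewrite divr_ge0// ltW.
by rewrite ler_pdivrMr// mulrDr mulr1 mulrCA divff ?pnatr_eq0// mulr1 lerDr.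
Qed.

Lemma damp_bounds M y : 0 < M -> `|damp M y| <= M /\ `|y - damp M y| <= y ^+ 2 / M.
Proof.
move=> M0; set t := y / M; have yE : y = t * M by rewrite /t divfK// gt_eqF.
have p : 0 < 1 + t ^+ 2 by rewrite ltr_pwDl// ?sqr_ge0.
have t0 := normr_ge0 t.
have t2 : t ^+ 2 = `|t| ^+ 2 by rewrite real_normK// num_real.
split.
  rewrite /damp -/t normrM normfV (gtr0_norm p) ler_pdivrMr// yE normrM (gtr0_norm M0).
  by rewrite mulrC ler_wpM2l ?(ltW M0)// t2; nra.
have -> : y - damp M y = y * (t ^+ 2 / (1 + t ^+ 2)).
  by rewrite /damp -/t; field; rewrite gt_eqF.
rewrite (_ : y ^+ 2 / M = `|y| * `|t|); last first.
  rewrite -normrM ger0_norm; first by rewrite /t mulrA expr2.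
  by rewrite /t mulrA -expr2 divr_ge0 ?sqr_ge0 ?(ltW M0).
rewrite normrM ler_wpM2l// ger0_norm; last by rewrite divr_ge0 ?sqr_ge0// ltW.
by rewrite ler_pdivrMr// t2; nra.
Qed.

Lemma continuous_damp_sqr n : continuous (damp_sqr n).
Proof.
move=> y; rewrite /damp_sqr.
have c2 : x ^+ 2 @[x --> y] --> y ^+ 2 by exact: exprn_continuous.
apply: cvgM => //; apply: cvgV.
  by rewrite gt_eqF// ltr_pwDl// divr_ge0// ?sqr_ge0.
by apply: cvgD; [exact: cvg_cst|apply: cvgM => //; exact: cvg_cst].
Qed.

Lemma continuous_damp M : continuous (damp M).
Proof.
move=> y; rewrite /damp.
have c2 : (x / M) ^+ 2 @[x --> y] --> (y / M) ^+ 2.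
  by rewrite /= !expr2; apply: cvgM; apply: cvgM;
    [exact: cvg_id|exact: cvg_cst|exact: cvg_id|exact: cvg_cst].
apply: cvgM; first exact: cvg_id.
apply: cvgV; first by rewrite gt_eqF// ltr_pwDl// ?sqr_ge0.
by apply: cvgD => //; exact: cvg_cst.
Qed.

Lemma EFin_Rintegral (f : T -> R) : m.-integrable setT (EFin \o f) ->
  ((\int[m]_x f x)%R%:E = \int[m]_x (f x)%:E)%E.
Proof. by move=> fi; rewrite /Rintegral fineK//; exact: integrable_fin_num. Qed.

(** [damp_sqr n y] increases to y^2 with n, so monotone convergence passes the bound to the
    square. *)
Lemma integral_sqr_le_damp (f : T -> R) K : measurable_fun setT f ->
  (forall n, \int[m]_x (W x * damp_sqr n (f x)) <= K)%R ->
  (\int[m]_x (W x * f x ^+ 2)%:E <= K%:E)%E.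
Proof.
move=> mf hK.
have mn n : measurable_fun setT (fun x => damp_sqr n (f x)).
  apply: (measurableT_comp _ mf).
  by apply: continuous_measurable_fun; exact: continuous_damp_sqr.
have /cvge_to_le : (\int[m]_x (W x * damp_sqr n (f x))%:E @[n --> \oo] -->
    \int[m]_x (W x * f x ^+ 2)%:E)%E.
  have -> : (\int[m]_x (W x * f x ^+ 2)%:E = \int[m]_x limn
    (fun n => (W x * damp_sqr n (f x))%:E))%E.
    apply: eq_integral => x _; apply/esym/cvg_lim => //.
    apply: cvg_EFin; first exact: nearW.
    rewrite /comp/=; apply: cvgMl_tmp.
    rewrite -[X in _ --> X]divr1 -[X in _ / X]addr0 -[X in 1 + X](mulr0 (f x ^+ 2)).
    apply: cvgMl_tmp; apply: cvgV; first by rewrite mulr0 addr0 oner_eq0.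
    by apply: cvgD; [exact: cvg_cst|apply: cvgMl_tmp; exact: cvg_harmonic].
  apply: cvg_monotone_convergence => //.
  - by move=> n; apply/measurable_EFinP; exact: measurable_funM.
  - by move=> n x _; rewrite lee_fin mulr_ge0//; have [] := damp_sqr_bounds n (f x).
  - move=> x _ n p np; rewrite lee_fin ler_wpM2l// /damp_sqr ler_wpM2l ?sqr_ge0//.
    have y2 := sqr_ge0 (f x).
    rewrite lef_pV2 ?posrE ?ltr_pwDl ?divr_ge0// lerD2l ler_wpM2l//.
    by rewrite lef_pV2 ?posrE// ler_nat ltnS.
apply; apply: nearW => n.
rewrite -EFin_Rintegral ?lee_fin//.
by apply: (@integrable_weight_bounded _ n.+1%:R) => // x; have [? ?] := damp_sqr_bounds n (f x);
  rewrite ger0_norm.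
Qed.

(** Truncation at level M costs at most y^2 / M pointwise; integrability comes from |y| <= 1 + y^2
    and the finite total weight. *)
Lemma integral_damp_close (f : T -> R) K M : 0 < M -> measurable_fun setT f ->
  (\int[m]_x (W x * f x ^+ 2)%:E <= K%:E)%E ->
  m.-integrable setT (EFin \o (fun x => W x * f x)) /\
  `|(\int[m]_x (W x * f x))%R - (\int[m]_x (W x * damp M (f x)))%R| <= K / M.
Proof.
move=> M0 mf fK.
have W2 x : 0 <= W x * f x ^+ 2 by rewrite mulr_ge0// ?sqr_ge0.
have m2 : measurable_fun setT (fun x => W x * f x ^+ 2).
  by apply: measurable_funM => //; exact: measurable_funX.
have i2 : m.-integrable setT (EFin \o (fun x => W x * f x ^+ 2)).
  apply/integrableP; split; first exact/measurable_EFinP.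
  under eq_integral do rewrite /= ger0_norm//.
  by apply: (le_lt_trans fK); rewrite ltry.
have iD : m.-integrable setT (EFin \o (fun x => W x * damp M (f x))).
  apply: (@integrable_weight_bounded _ M); last by move=> x; have [] := damp_bounds (f x) M0.
  apply: (measurableT_comp _ mf).
  by apply: continuous_measurable_fun; exact: continuous_damp.
have i1 : m.-integrable setT (EFin \o (fun x => W x * f x)).
  apply: (fun mf => integrable_bound measurableT mf (integrableD_EFin measurableT W_int i2)).
    exact: measurable_funM.
  move=> x _; rewrite normrM (ger0_norm (W_ge0 x)) -[X in X + _]mulr1 -mulrDr ler_wpM2l//.
  by rewrite ler_norml; apply/andP; split; nra.
split => //; rewrite -RintegralB//.
have iB := integrableB_EFin measurableT i1 iD.
apply: (le_trans (le_normr_Rintegral _ iB)) => //.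
apply: (@le_trans _ _ (\int[m]_x (M^-1 * (W x * f x ^+ 2)))%R).
  apply: le_Rintegral => //; first exact: integrable_norm.
    exact: integrableZ_EFin.
  move=> x _; rewrite -mulrBr normrM (ger0_norm (W_ge0 x)) mulrCA ler_wpM2l//.
  by rewrite mulrC; have [] := damp_bounds (f x) M0.
rewrite RintegralZl// mulrC ler_wpM2r ?invr_ge0 ?(ltW M0)//.
by rewrite -lee_fin EFin_Rintegral.
Qed.

(* The second moment bound makes the error of truncating f uniformly small. *)
Lemma weak_cvg (U : Type) (A : set_system U) {PA : ProperFilter A}
    (f : U -> T -> R) (f0 : T -> R) (K : R) :
  (\forall u \near A, measurable_fun setT (f u)) -> measurable_fun setT f0 ->
  (forall h : R -> R, continuous h -> (exists M, forall y, `|h y| <= M) ->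
    (\int[m]_x (W x * h (f u x)))%R @[u --> A] --> (\int[m]_x (W x * h (f0 x)))%R) ->
  (\forall u \near A, (\int[m]_x (W x * f u x ^+ 2)%:E <= K%:E)%E) ->
  [/\ (\int[m]_x (W x * f0 x ^+ 2)%:E <= K%:E)%E,
      m.-integrable setT (EFin \o (fun x => W x * f0 x)) &
      (\int[m]_x (W x * f u x))%R @[u --> A] --> (\int[m]_x (W x * f0 x))%R].
Proof.
move=> mf mf0 wc fK.
have W2 (h : T -> R) x : 0 <= W x * h x ^+ 2 by rewrite mulr_ge0// ?sqr_ge0.
have K0 : 0 <= K.
  have [u hu] := filter_ex fK; rewrite -lee_fin; apply: le_trans hu.
  by apply: integral_ge0 => x _; rewrite lee_fin.
(* A Fatou property: each [damp_sqr n] is an admissible test function lying below the square, so the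
   bound K passes to the limit. *)
have f0K : (\int[m]_x (W x * f0 x ^+ 2)%:E <= K%:E)%E.
  apply: integral_sqr_le_damp => // n.
  have /cvgr_to_le : (\int[m]_x (W x * damp_sqr n (f u x)))%R @[u --> A] -->
      (\int[m]_x (W x * damp_sqr n (f0 x)))%R.
    apply: wc; first exact: continuous_damp_sqr.
    by exists n.+1%:R => y; have [? ?] := damp_sqr_bounds n y; rewrite ger0_norm.
  apply; near=> u.
  have mu : measurable_fun setT (f u) by near: u.
  have fuK : (\int[m]_x (W x * f u x ^+ 2)%:E <= K%:E)%E by near: u.
  have i2 : m.-integrable setT (EFin \o (fun x => W x * f u x ^+ 2)).
    apply/integrableP; split.
      by apply/measurable_EFinP/measurable_funM => //; exact: measurable_funX.
    under eq_integral do rewrite /= ger0_norm//.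
    by apply: (le_lt_trans fuK); rewrite ltry.
  rewrite -lee_fin; apply: le_trans fuK; rewrite -EFin_Rintegral// lee_fin.
  apply: le_Rintegral => //.
    apply: (@integrable_weight_bounded _ n.+1%:R).
      by apply: (measurableT_comp _ mu); apply: continuous_measurable_fun; exact:
        continuous_damp_sqr.
    by move=> x; have [? ?] := damp_sqr_bounds n (f u x); rewrite ger0_norm.
  move=> x _; rewrite ler_wpM2l// /damp_sqr ler_piMr ?sqr_ge0// invf_le1.
    by rewrite lerDl divr_ge0// ?sqr_ge0.
  by rewrite ltr_pwDl// divr_ge0// ?sqr_ge0.
split => //; first by have [] := integral_damp_close ltr01 mf0 f0K.
apply/cvgrPdist_lt => e e0.
(* The two truncation errors, for f and for f0, add up to 2 K / M < e; what is left of e is given to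
   weak convergence. *)
pose M := 4 * K / e + 1.
have M0 : 0 < M by rewrite ltr_wpDl// !mulr_ge0// invr_ge0 ltW.
have KM : K / M < e / 2.
  rewrite ltr_pdivrMr// /M mulrDr mulr1.
  have -> : e / 2 * (4 * K / e) = 2 * K by field; rewrite gt_eqF.
  by have := divr_gt0 e0 (ltr0Sn R 1); lra.
have eps0 : 0 < e - 2 * (K / M) by lra.
have /cvgrPdist_lt/(_ _ eps0) wcM : (\int[m]_x (W x * damp M (f u x)))%R @[u --> A] -->
    (\int[m]_x (W x * damp M (f0 x)))%R.
  apply: wc; first exact: continuous_damp.
  by exists M => y; have [] := damp_bounds y M0.
have [_ h0] := integral_damp_close M0 mf0 f0K.
near=> u.
have mu : measurable_fun setT (f u) by near: u.
have fuK : (\int[m]_x (W x * f u x ^+ 2)%:E <= K%:E)%E by near: u.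
have [_ hu] := integral_damp_close M0 mu fuK.
have hM : `|(\int[m]_x (W x * damp M (f0 x)))%R - (\int[m]_x (W x * damp M (f u x)))%R|
   < e - 2 * (K / M) by near: u.
move: h0 hu hM; rewrite !ler_norml !ltr_norml => /andP[? ?] /andP[? ?] /andP[? ?].
by apply/andP; split; lra.
Unshelve. all: end_near. Qed.

End weak_convergence.

(** * Gaussian exponential moments *)

Section density.
Import HBNNSimple.
Context (R : realType) d (T : measurableType d).
Variables (m nu : {measure set T -> \bar R}) (p : T -> R).
Hypothesis p_meas : measurable_fun setT p.
Hypothesis p_ge0 : forall x, 0 <= p x.
Hypothesis nuE : forall A, measurable A -> (nu A = \int[m]_(x in A) (p x)%:E)%E.
Local Open Scope ereal_scope.

Let integral_density_nnsfun (f : {nnsfun T >-> R}) :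
  \int[nu]_x (f x)%:E = \int[m]_x ((f x)%:E * (p x)%:E).
Proof.
have mp : measurable_fun setT (EFin \o p) by exact/measurable_EFinP.
have mi r : measurable_fun setT (fun x => (r * \1_(f @^-1` [set r]) x)%:E).
  by apply/measurable_EFinP; apply: measurable_funM.
under [LHS]eq_integral do rewrite fimfunE -fsumEFin//.
rewrite ge0_integral_fsum//; last by move=> r x _; exact: nnfun_muleindic_ge0.
under [RHS]eq_integral => x _.
  rewrite fimfunE -fsumEFin// ge0_mule_fsuml; last by move=> r; exact: nnfun_muleindic_ge0.
  over.
rewrite /= ge0_integral_fsum//; last 2 first.
- by move=> r; apply: emeasurable_funM.
- by move=> r x _; rewrite mule_ge0 ?lee_fin//; exact: nnfun_muleindic_ge0.
apply: eq_fsbigr => r _.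
rewrite integralZl_indic_nnsfun// (@integral_indic _ _ _ nu setT)// setIT nuE//.
have [r0|r0] := leP 0%R r; last first.
  by rewrite preimage_nnfun0// integral_set0 mule0; apply/esym/integral0_eq => x _;
    rewrite indicE in_set0 mulr0 mul0e.
under [RHS]eq_integral do rewrite EFinM -muleA.
rewrite ge0_integralZl//; last 2 first.
- by apply: emeasurable_funM => //; exact/measurable_EFinP.
- by move=> x _; rewrite mule_ge0 ?lee_fin.
rewrite integral_mkcond; congr (_ * _); apply: eq_integral => x _.
by rewrite patchE indicE; case: ifPn => _; rewrite ?mul1e ?mul0e.
Qed.

(** Extends the density formula from sets to nonnegative functions, through simple functions and
    monotone convergence. *)
Lemma integral_density (f : T -> \bar R) : measurable_fun setT f ->
  (forall x, 0 <= f x) -> \int[nu]_x f x = \int[m]_x (f x * (p x)%:E).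
Proof.
move=> mf f0; have mp : measurable_fun setT (EFin \o p) by exact/measurable_EFinP.
pose g := nnsfun_approx measurableT mf.
have cg x : (g n x)%:E @[n --> \oo] --> f x by exact: cvg_nnsfun_approx.
have ndg x : {homo (fun n => (g n x)%:E) : a b / (a <= b)%N >-> a <= b}.
  by move=> a b ab; rewrite lee_fin; exact/lefP/nd_nnsfun_approx.
have lhs : \int[nu]_x f x = limn (fun n => \int[nu]_x (g n x)%:E).
  rewrite -monotone_convergence//=; last 2 first.
  - by move=> n; exact/measurable_EFinP.
  - by move=> n x _; rewrite lee_fin.
  by apply: eq_integral => x _; apply/esym/cvg_lim.
have rhs : \int[m]_x (f x * (p x)%:E) = limn (fun n => \int[m]_x ((g n x)%:E * (p x)%:E)).
  rewrite -monotone_convergence//=; last 3 first.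
  - by move=> n; apply: emeasurable_funM => //; exact/measurable_EFinP.
  - by move=> n x _; rewrite mule_ge0 ?lee_fin.
  - by move=> x _ a b ab; rewrite lee_wpmul2r ?lee_fin//; exact: ndg.
  apply: eq_integral => x _; apply/esym/cvg_lim => //.
  by apply: cvgeZr => //; exact: cg.
rewrite lhs rhs; congr (limn _); apply/funext => n.
exact: integral_density_nnsfun.
Qed.
End density.

Section gaussian_mgf.
Context (R : realType) dO (Omega : measurableType dO) (P : probability Omega R).

(** Completing the square: an exponential tilt by t shifts the mean by t s^2. *)
Lemma normal_pdf_tilt (m s t x : R) : s != 0 ->
  expR (t * x) * normal_pdf m s x =
  expR (t * m + t ^+ 2 * s ^+ 2 / 2) * normal_pdf (m + t * s ^+ 2) s x.
Proof.
move=> s0; rewrite !normal_pdfE// /normal_fun/=.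
rewrite mulrCA [RHS]mulrCA -!expRD; congr (_ * expR _).
by rewrite -mulr_natr; field.
Qed.

Lemma gaussian_mgf_law (Y : Omega -> R) : measurable_fun setT Y -> gaussian_rv P Y ->
  exists m s : R, forall t, (\int[P]_w (expR (t * Y w))%:E =
    (expR (t * m + t ^+ 2 * s ^+ 2 / 2))%:E)%E.
Proof.
(* Bundling Y as a measurable function gives it a distribution, against which the Gaussian
   hypothesis on measurable sets can be integrated. *)
move=> mY; have [Z <-] : exists Z : {mfun Omega >-> measurableTypeR R}, Z = Y :> (Omega -> R).
  by exists (@mfun_Sub _ _ Omega (measurableTypeR R) Y (mem_set mY)).
move=> [m [s h]]; exists m, s => t.
have me : measurable_fun [set: R] (fun x : R => (expR (t * x))%:E).
  apply/measurable_EFinP; apply: measurableT_comp => //.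
transitivity (\int[distribution P Z]_x (expR (t * x))%:E)%E.
  by rewrite ge0_integral_distribution// => x; rewrite lee_fin expR_ge0.
have [s0|s0] := eqVneq s 0.
  transitivity (\int[\d_(m : measurableTypeR R)]_x (expR (t * x))%:E)%E.
    apply: (@eq_measure_integral _ (measurableTypeR R) R setT (\d_(m : measurableTypeR R))
      (distribution P Z)).
    by move=> A mA _; have := h A mA; rewrite s0 eqxx.
  by rewrite integral_dirac// diracT mul1e s0 expr0n/= mulr0 mul0r addr0.
transitivity (\int[normal_prob m s]_x (expR (t * x))%:E)%E.
  apply: (@eq_measure_integral _ (measurableTypeR R) R setT (normal_prob m s) (distribution P Z)).
  by move=> A mA _; have := h A mA; rewrite (negbTE s0).
rewrite (@integral_density _ _ _ lebesgue_measure (normal_prob m s) (normal_pdf m s))//;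
  last 2 first.
- exact: measurable_normal_pdf.
- by move=> x; exact: normal_pdf_ge0.
under eq_integral do rewrite -EFinM normal_pdf_tilt// EFinM.
rewrite ge0_integralZl ?lee_fin ?expR_ge0//; last 2 first.
- by apply/measurable_EFinP; exact: measurable_normal_pdf.
- by move=> x _; rewrite lee_fin normal_pdf_ge0.
by rewrite integral_normal_pdf mule1.
Qed.
End gaussian_mgf.

Section gaussian_moments.
Context (R : realType) dO (Omega : measurableType dO) (P : probability Omega R).

Lemma expR_norm_le (x : R) : expR `|x| <= expR x + expR (- x).
Proof.
have [x0|x0] := leP 0 x; first by rewrite ger0_norm// lerDl expR_ge0.
by rewrite ltr0_norm// lerDr expR_ge0.
Qed.

Lemma integrable_expR (Y : Omega -> R) r : measurable_fun setT Y ->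
  (\int[P]_w (expR (Y w))%:E = r%:E)%E -> P.-integrable setT (EFin \o (expR \o Y)).
Proof.
move=> mY h; apply/integrableP; split.
  by apply/measurable_EFinP; exact: measurableT_comp.
under eq_integral do rewrite /= ger0_norm ?expR_ge0//.
by rewrite h ltry.
Qed.

Lemma gaussian_exp_integrable (Y : Omega -> R) (c : R) : measurable_fun setT Y ->
  gaussian_rv P Y -> 0 <= c ->
  P.-integrable setT (EFin \o (fun w => expR (c * `|Y w|))).
Proof.
move=> mY gY c0; have [m [s h]] := gaussian_mgf_law mY gY.
have i t : P.-integrable setT (EFin \o (fun w => expR (t * Y w))).
  have := @integrable_expR (fun w => t * Y w) _ _ (h t); apply.
  exact: measurable_funM.
apply: (fun mf => integrable_bound measurableT mf (integrableD_EFin measurableT (i c) (i (- c)))).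
  apply: measurableT_comp => //; apply: measurable_funM => //.
  exact: measurableT_comp.
move=> w _; rewrite ger0_norm ?expR_ge0// mulNr -{1}(ger0_norm c0) -normrM.
exact: expR_norm_le.
Qed.

Lemma gaussian_pow_integrable (Y : Omega -> R) n : measurable_fun setT Y ->
  gaussian_rv P Y -> P.-integrable setT (EFin \o (fun w => Y w ^+ n)).
Proof.
move=> mY gY; have [C [C0 h]] := @pow_le_exp R n 1 ltr01.
apply: (fun mf => integrable_bound measurableT mf
  (integrableZ_EFin measurableT C (gaussian_exp_integrable mY gY ler01))).
  exact: measurable_funX.
by move=> w _; rewrite normrX; exact: h.
Qed.

(** [gaussian_rv] only asserts that parameters exist. Differentiating the moment generating function
    twice at 0 identifies them with the mean and the variance. *)
Lemma gaussian_mgf (Y : Omega -> R) : measurable_fun setT Y -> gaussian_rv P Y ->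
  let e := (\int[P]_w Y w)%R in let v := (\int[P]_w (Y w ^+ 2))%R in
  forall t, (\int[P]_w (expR (t * Y w))%:E =
    (expR (t * e + t ^+ 2 * (v - e ^+ 2) / 2))%:E)%E.
Proof.
move=> mY gY e v; have [m [s h]] := gaussian_mgf_law mY gY.
pose A n (t : R) := (\int[P]_w (1 * (Y w ^+ n * expR (t * Y w))))%R.
have dA n (t : R) : is_derive t 1 (A n) (A n.+1 t).
  have c0 : 0 < `|t| + 1 by rewrite ltr_wpDl.
  apply: (@is_derive_exp_family _ _ _ P (cst 1) Y (`|t| + 1)) => //; last by rewrite ltrDl.
  have := gaussian_exp_integrable mY gY (ltW c0).
  by apply: eq_integrable => // w _; rewrite /= mul1r.
pose E (t : R) := expR (t * m + t ^+ 2 * s ^+ 2 / 2).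
have A0 : A 0%N = E.
  apply/funext => t; rewrite /A /E; under eq_Rintegral do rewrite expr0 !mul1r.
  by rewrite /Rintegral h.
have dE (t : R) : is_derive t 1 E ((m + t * s ^+ 2) * E t).
  have dq : is_derive t 1 (fun t : R => t * m + t ^+ 2 * s ^+ 2 / 2) (m + t * s ^+ 2).
    rewrite (_ : (fun _ => _) = (m \*: id) + ((s ^+ 2 / 2) \*: (id ^+ 2))); last first.
      apply/funext => x; transitivity (m * x + s ^+ 2 / 2 * x ^+ 2); first by ring.
      by rewrite !fctE.
    by apply: is_derive_eq; rewrite /GRing.scale/=; field.
  have := @is_derive1_comp R expR _ t _ _ (is_derive_expR _) dq.
  by rewrite mulrC.
have A1 : A 1%N = fun t => (m + t * s ^+ 2) * E t.
  apply/funext => t; have [_ <-] := dA 0%N t; have [_ <-] := dE t.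
  by rewrite A0.
have E0 : E 0 = 1 by rewrite /E mul0r expr0n/= !mul0r addr0 expR0.
have em : e = m.
  have : A 1%N 0 = m by rewrite A1 E0 mul0r addr0 mulr1.
  by rewrite /A /e; under eq_Rintegral do rewrite mul0r expR0 mulr1 mul1r expr1.
have vm : v = m ^+ 2 + s ^+ 2.
  have : A 2%N 0 = m ^+ 2 + s ^+ 2.
    have [_ <-] := dA 1%N 0; rewrite A1.
    have d1 : is_derive (0:R) 1 (fun t : R => m + t * s ^+ 2) (s ^+ 2).
      rewrite (_ : (fun _ => _) = cst m + ((s ^+ 2) \*: id)); last first.
        by apply/funext => x; rewrite mulrC.
      by apply: is_derive_eq; rewrite /GRing.scale/= add0r mulr1.
    have [_ ->] := is_deriveM d1 (dE 0).
    by rewrite /GRing.scale/= E0 !mul0r !addr0; ring.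
  by rewrite /A /v; under eq_Rintegral do rewrite mul0r expR0 mulr1 mul1r.
by move=> t; rewrite h em vm; congr ((expR _)%:E); field.
Qed.
End gaussian_moments.

(** * Covariance and exponential moments of a Gaussian process *)

Section gaussian_process.
Context (R : realType) dO (Omega : measurableType dO) (P : probability Omega R).
Context (T : Type) (X : T -> Omega -> R) (g : T -> T -> R).
Hypothesis X_meas : forall x, measurable_fun setT (X x).
Hypothesis X_gauss : centered_gaussian_process P X g.

Lemma process_gaussian x : gaussian_rv P (X x).
Proof.
have [h _ _] := X_gauss; have := h 1%N (fun=> x) (fun=> 1).
by under eq_fun do rewrite big_ord_recl big_ord0 addr0 mul1r.
Qed.

Lemma process_mean x : (\int[P]_w X x w)%R = 0.
Proof. by have [_ h _] := X_gauss; have := h x; rewrite /Rintegral unlock => ->. Qed.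

Lemma process_prod_integrable x y : P.-integrable setT (EFin \o (fun w => X x w * X y w)).
Proof.
have i2 z := gaussian_pow_integrable 2 (X_meas z) (process_gaussian z).
apply: (fun mf => integrable_bound measurableT mf (integrableD_EFin measurableT (i2 x) (i2 y))).
  exact: measurable_funM.
by move=> w _; rewrite ler_norml; apply/andP; split; nra.
Qed.

Lemma process_covariance x y : (\int[P]_w (X x w * X y w))%R = g x y.
Proof.
have [_ h0 h] := X_gauss; have := h x y.
rewrite covariance.unlock !h0 unlock/= => E.
rewrite /Rintegral -[RHS]/(fine (g x y)%:E) -E; congr fine.
by apply: eq_integral => w _; rewrite !fctE/= !subr0.
Qed.

Lemma process_covC x y : g x y = g y x.
Proof. by rewrite -!process_covariance; apply: eq_Rintegral => w _; rewrite mulrC. Qed.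

Lemma process_variance x : fine 'V_P[X x]%E = g x x.
Proof. by have [_ _ h] := X_gauss; rewrite /variance h. Qed.

Lemma process_var_ge0 x : 0 <= g x x.
Proof. by rewrite -process_covariance; apply: Rintegral_ge0 => w _; rewrite -expr2 sqr_ge0. Qed.

(** The second moments of X x + X y and X x - X y are nonnegative. *)
Lemma process_cov_le x y C : g x x <= C -> g y y <= C -> `|g x y| <= C.
Proof.
move=> gx gy; have i := process_prod_integrable.
have hp : 0 <= g x x + g y y + 2 * g x y.
  rewrite -!process_covariance -RintegralZl// -!RintegralD//; last first.
  - exact: integrableZ_EFin.
  - exact: integrableD_EFin.
  by apply: Rintegral_ge0 => w _; have := sqr_ge0 (X x w + X y w); nra.
have hm : 0 <= g x x + g y y - 2 * g x y.
  rewrite -!process_covariance -RintegralZl// -RintegralD// -RintegralB//; last first.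
  - exact: integrableZ_EFin.
  - exact: integrableD_EFin.
  by apply: Rintegral_ge0 => w _; have := sqr_ge0 (X x w - X y w); nra.
by rewrite ler_norml; apply/andP; split; lra.
Qed.

Lemma process_sum_mgf n (x : 'I_n -> T) (a : 'I_n -> R) :
  (\int[P]_w (expR (\sum_(i < n) a i * X (x i) w))%:E =
   (expR (2^-1 * \sum_(i < n) \sum_(j < n) a i * a j * g (x i) (x j)))%:E)%E.
Proof.
pose Y w := \sum_(i < n) a i * X (x i) w.
have mY : measurable_fun setT Y.
  by apply: measurable_sum => i; exact: measurable_funM.
have gY : gaussian_rv P Y by have [h _ _] := X_gauss; exact: h.
have i1 z : P.-integrable setT (EFin \o X z).
  have := gaussian_pow_integrable 1 (X_meas z) (process_gaussian z).
  by apply: eq_integrable => // w _; rewrite /= expr1.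
have eY : (\int[P]_w Y w)%R = 0.
  rewrite Rintegral_sum// => [|i]; last exact: integrableZ_EFin.
  by rewrite big1// => i _; rewrite RintegralZl// process_mean mulr0.
have vY : (\int[P]_w (Y w ^+ 2))%R = \sum_(i < n) \sum_(j < n) a i * a j * g (x i) (x j).
  transitivity (\int[P]_w (\sum_(i < n) \sum_(j < n) a i * a j * (X (x i) w * X (x j) w)))%R.
    apply: eq_Rintegral => w _; rewrite expr2 /Y mulr_suml; apply: eq_bigr => i _.
    by rewrite mulr_sumr; apply: eq_bigr => j _; ring.
  have i2 i j : P.-integrable setT (EFin \o (fun w => a i * a j * (X (x i) w * X (x j) w))).
    by apply: integrableZ_EFin => //; exact: process_prod_integrable.
  rewrite Rintegral_sum// => [|i]; last exact: integrable_sumr.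
  apply: eq_bigr => i _; rewrite Rintegral_sum//; apply: eq_bigr => j _.
  by rewrite RintegralZl ?process_covariance//; exact: process_prod_integrable.
have := gaussian_mgf mY gY 1; rewrite eY vY.
under eq_integral do rewrite mul1r.
by move=> ->; congr ((expR _)%:E); field.
Qed.

Lemma sum_sym_triangle n (G : 'I_n -> 'I_n -> R) : (forall i j, G i j = G j i) ->
  \sum_(i < n) \sum_(j < n) G i j =
  \sum_(i < n) G i i + 2 * \sum_(i < n) \sum_(j < n | (i < j)%N) G i j.
Proof.
move=> Gs.
have E i : \sum_(j < n) G i j = G i i + (\sum_(j < n | (i < j)%N) G i j + \sum_(j < n | (j < i)%N)
  G i j).
  rewrite (bigD1 i)//=; congr (_ + _).
  rewrite (bigID (fun j : 'I_n => (i < j)%N))/=; congr (_ + _); apply: eq_bigl => j.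
    by rewrite -val_eqE/= neq_ltn andbC; case: ltngtP.
  by rewrite -val_eqE/= neq_ltn andbC; case: ltngtP.
under eq_bigr do rewrite E.
rewrite big_split/=; congr (_ + _); rewrite big_split/= mulr_natl mulr2n; congr (_ + _).
rewrite (exchange_big_dep predT)//=; apply: eq_bigr => i _.
by apply: eq_bigr => j _; rewrite Gs.
Qed.

(** The normalization by half the variance cancels the diagonal of the quadratic form exactly, and
    symmetry leaves each pair i < j once. *)
Lemma process_chaos_mgf n (x : 'I_n -> T) mu : 0 <= mu ->
  (\int[P]_w (expR (\sum_(i < n) (Num.sqrt mu * X (x i) w - mu / 2 * g (x i) (x i))))%:E =
   (expR (mu * \sum_(i < n) \sum_(j < n | (i < j)%N) g (x i) (x j)))%:E)%E.
Proof.
move=> mu0.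
pose V := \sum_(i < n) mu / 2 * g (x i) (x i).
under eq_integral => w _ do rewrite sumrB -/V expRD EFinM muleC.
rewrite ge0_integralZl ?lee_fin ?expR_ge0//; last first.
  apply/measurable_EFinP; apply: measurableT_comp => //.
  by apply: measurable_sum => i; exact: measurable_funM.
rewrite process_sum_mgf -EFinM -expRD; congr ((expR _)%:E).
rewrite (@sum_sym_triangle _ (fun i j => Num.sqrt mu * Num.sqrt mu * g (x i) (x j))); last first.
  by move=> i j; rewrite process_covC.
rewrite -expr2 sqr_sqrtr// mulrDr addrA /V mulr_sumr -sumrN -big_split/= big1 ?add0r; last first.
  by move=> i _; field.
rewrite mulrA mulVf ?mul1r// !mulr_sumr; apply: eq_bigr => i _; by rewrite mulr_sumr.
Qed.
End gaussian_process.

(** * Exponentials of finite sums and local iterated derivatives *)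

Section misc_analysis.
Context (R : realType).

(** The index i carries a largest term. The last clause expresses that i is one of the summed
    indices, without requiring decidable equality on [I]. *)
Lemma sum_le_size_max (I : Type) (r : seq I) (Q : pred I) (y : I -> R) :
  (forall i, 0 <= y i) ->
  \sum_(i <- r | Q i) y i = 0 \/
  exists2 i, \sum_(i <- r | Q i) y i <= (size r)%:R * y i &
    forall z : I -> R, (forall i, 0 <= z i) -> z i <= \sum_(i <- r | Q i) z i.
Proof.
move=> y0; elim: r => [|a r IH]; first by left; rewrite big_nil.
case: (boolP (Q a)) => Qa; last first.
  case: IH => [IH|[i h1 h2]]; first by left; rewrite big_cons (negbTE Qa).
  right; exists i; last by move=> z z0; rewrite big_cons (negbTE Qa); exact: h2.
  rewrite big_cons (negbTE Qa); apply: (le_trans h1).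
  by rewrite ler_wpM2r// ler_nat leqnSn.
right; case: IH => [IH|[i h1 h2]].
  exists a; first by rewrite big_cons Qa IH addr0 ler_peMl// ler1n.
  by move=> z z0; rewrite big_cons Qa lerDl sumr_ge0.
have [ai|ia] := leP (y a) (y i).
  exists i; last by move=> z z0; rewrite big_cons Qa (le_trans (h2 z z0))// lerDr.
  by rewrite big_cons Qa /= -nat1r mulrDl mul1r lerD.
exists a; last by move=> z z0; rewrite big_cons Qa lerDl sumr_ge0.
rewrite big_cons Qa /= -nat1r mulrDl mul1r lerD2l (le_trans h1)// ler_wpM2l//.
exact: ltW.
Qed.

(** The sum is at most N times its largest term, whose exponential is among those on the right; the
    summand 1 covers an empty sum. *)
Lemma expR_sum_le (I : Type) (r : seq I) (Q : pred I) (y : I -> R) N :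
  (forall i, 0 <= y i) -> (size r <= N)%N ->
  expR (\sum_(i <- r | Q i) y i) <= 1 + \sum_(i <- r | Q i) expR (N%:R * y i).
Proof.
move=> y0 rN; have e0 (i : I) : 0 <= expR (N%:R * y i) by rewrite expR_ge0.
case: (@sum_le_size_max _ r Q y y0) => [->|[i h1 h2]].
  by rewrite expR0 lerDl sumr_ge0.
apply: (@le_trans _ _ (expR (N%:R * y i))).
  by rewrite ler_expR (le_trans h1)// ler_wpM2r// ler_nat.
by rewrite (le_trans (h2 _ e0))// lerDr.
Qed.

Lemma derive1n_eq (A : nat -> R -> R) (F : R -> R) (c : R) :
  (forall n (mu : R), `|mu| < c -> is_derive mu 1 (A n) (A n.+1 mu)) ->
  (forall mu, `|mu| < c -> F mu = A 0%N mu) ->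
  forall n mu, `|mu| < c -> derive1n n F mu = A n mu.
Proof.
move=> dA FA; elim=> [|n IH] mu muc; first exact: FA.
have : is_derive mu 1 (derive1n n F) (A n.+1 mu).
  apply: (near_eq_is_derive _ (dA n mu muc)).
  exists (c - `|mu|); first by rewrite /= subr_gt0.
  move=> nu /= dnu; rewrite IH//.
  rewrite -[nu](subrK mu) (le_lt_trans (ler_normD _ _))// addrC.
  by rewrite distrC -ltrBrDl.
by move=> [_ <-]; rewrite derive1nS derive1E.
Qed.
End misc_analysis.

(** * Measurability of integrals depending on a parameter *)

Section parametric.
Context (R : realType) d1 d2 (S : measurableType d1) (T : measurableType d2).
Variable m : {sigma_finite_measure set T -> \bar R}.

Lemma measurable_integral_param (F : S * T -> R) : measurable_fun setT F ->
  measurable_fun setT (fun s => \int[m]_t (F (s, t))%:E)%E.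
Proof.
move=> mF; have mE : measurable_fun setT (EFin \o F) by exact/measurable_EFinP.
under eq_fun do rewrite integralE.
apply: emeasurable_funB.
- have H := (@measurable_fun_fubini_tonelli_F _ _ _ _ _ m _ (measurable_funepos mE)
    (funepos_ge0 _)).
  by apply: eq_measurable_fun H => s _; apply: eq_integral => t _; rewrite !unlock.
- have H := (@measurable_fun_fubini_tonelli_F _ _ _ _ _ m _ (measurable_funeneg mE)
    (funeneg_ge0 _)).
  by apply: eq_measurable_fun H => s _; apply: eq_integral => t _; rewrite !unlock.
Qed.

Lemma measurable_Rintegral_param (F : S * T -> R) : measurable_fun setT F ->
  measurable_fun setT (fun s => \int[m]_t (F (s, t)))%R.
Proof.
move=> mF; rewrite /Rintegral.
by apply: measurableT_comp => //; exact: measurable_integral_param.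
Qed.
End parametric.

(** * Moments of the kernel sum *)

Section weights.
Context (R : realType) d (T : measurableType d) (m : {sigma_finite_measure set T -> \bar R}).
Variables (D : set T) (phi : T -> R).
Hypothesis D_meas : measurable D.
Hypothesis phi_meas : measurable_fun D phi.
Hypothesis phi_gt0 : forall x, D x -> 0 < phi x.
Hypothesis phi_int : m.-integrable D (EFin \o phi).

(** Extension by zero turns integrals over D and over D^l into weighted integrals over the whole
    space and its powers. *)
Definition density_on : T -> R := phi \_ D.
Definition kernel_on (k : T -> T -> R) : T * T -> R := (fun p => k p.1 p.2) \_ (D `*` D).
Definition weight l (t : l.-tuple T) : R := \prod_(i < l) density_on (tnth t i).
Definition pair_sum (k : T -> T -> R) l (t : l.-tuple T) : R :=
  \sum_(i < l) \sum_(j < l | (i < j)%N) kernel_on k (tnth t i, tnth t j).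

Let mass : R := (\int[m]_(x in D) phi x)%R.

Lemma density_on_in x : D x -> density_on x = phi x.
Proof. by move=> Dx; rewrite /density_on patchE mem_set. Qed.

Lemma density_on_out x : ~ D x -> density_on x = 0.
Proof. by move=> Dx; rewrite /density_on patchE memNset. Qed.

Lemma density_on_ge0 x : 0 <= density_on x.
Proof.
have [Dx|Dx] := pselect (D x); last by rewrite density_on_out.
by rewrite density_on_in// ltW// phi_gt0.
Qed.

Lemma density_on_meas : measurable_fun setT density_on.
Proof. exact/(measurable_restrictT _ D_meas). Qed.

Lemma kernel_on_in k x y : D x -> D y -> kernel_on k (x, y) = k x y.
Proof. by move=> Dx Dy; rewrite /kernel_on patchE mem_set. Qed.

Lemma kernel_on_meas k : measurable_fun (D `*` D) (fun p => k p.1 p.2) ->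
  measurable_fun setT (kernel_on k).
Proof. by move=> mk; apply/(measurable_restrictT _ (measurableX D_meas D_meas)). Qed.

Lemma integral_density_on : (\int[m]_x (density_on x)%:E = mass%:E)%E.
Proof.
rewrite /mass /Rintegral fineK; last exact: integrable_fin_num.
rewrite [RHS]integral_mkcond; apply: eq_integral => x _.
by rewrite /density_on !patchE; case: ifPn.
Qed.

Lemma mass_ge0 : 0 <= mass.
Proof. by apply: Rintegral_ge0 => x Dx; rewrite ltW// phi_gt0. Qed.

Lemma weight_ge0 l (t : l.-tuple T) : 0 <= weight t.
Proof. by apply: prodr_ge0 => i _; exact: density_on_ge0. Qed.

Lemma weight_meas l : measurable_fun setT (@weight l).
Proof. exact: measurable_prod_tnth density_on_meas. Qed.

Lemma weight_neq0 l (t : l.-tuple T) : weight t != 0 -> forall i, D (tnth t i).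
Proof.
move=> + i; apply: contraNP => Di.
by rewrite /weight (bigD1 i)//= density_on_out// mul0r.
Qed.

Lemma pair_sum_meas k l : measurable_fun (D `*` D) (fun p => k p.1 p.2) ->
  measurable_fun setT (@pair_sum k l).
Proof.
move=> mk; apply: measurable_sum => i.
have E (t : l.-tuple T) : \sum_(j < l | (i < j)%N) kernel_on k (tnth t i, tnth t j) =
   \sum_(j < l) (if (i < j)%N then kernel_on k (tnth t i, tnth t j) else 0).
  by rewrite big_mkcond.
under eq_fun do rewrite E.
apply: measurable_sum => j; case: (i < j)%N => //.
apply: measurableT_comp; first exact: kernel_on_meas.
by apply: measurable_fun_pair; exact: measurable_tnth.
Qed.

Lemma integral_weight l : (\int[pow_measure m l]_t (weight t)%:E = (mass ^+ l)%:E)%E.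
Proof.
rewrite (integral_pow_prod _ density_on_meas density_on_ge0) integral_density_on.
by rewrite EFin_expe.
Qed.

Lemma weight_integrable l : (pow_measure m l).-integrable setT (EFin \o @weight l).
Proof.
apply/integrableP; split; first by apply/measurable_EFinP; exact: weight_meas.
under eq_integral do rewrite /= ger0_norm ?weight_ge0//.
by rewrite integral_weight ltry.
Qed.

Lemma pow_setE l (f : l.-tuple T -> R) :
  (\int[pow_measure m l]_(t in [set t | forall i, D (tnth t i)])
     ((\prod_(i < l) phi (tnth t i)) * f t))%R =
  (\int[pow_measure m l]_t (weight t * f t))%R.
Proof.
rewrite Rintegral_mkcond; apply: eq_Rintegral => t _; rewrite patchE.
case: ifPn => [|]; rewrite ?inE ?notin_setE => h.
  by congr (_ * _); apply: eq_bigr => i _; rewrite density_on_in.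
case: (eqVneq (weight t) 0) => [->|/weight_neq0//]; by rewrite mul0r.
Qed.

(** The kernel and its restriction to D differ only at tuples whose weight is zero. *)
Lemma weight_pair_sum (k : T -> T -> R) l (t : l.-tuple T) (h : R -> R) :
  weight t * h (\sum_(i < l) \sum_(j < l | (i < j)%N) k (tnth t i) (tnth t j)) =
  weight t * h (pair_sum k t).
Proof.
case: (eqVneq (weight t) 0) => [->|/weight_neq0 Dt]; first by rewrite !mul0r.
congr (_ * h _); apply: eq_bigr => i _; apply: eq_bigr => j _.
by rewrite kernel_on_in.
Qed.

(** An upper bound for the number of pairs i < j. In [exp_bound] the first term comes from the 1 of
    [expR_sum_le], and each pair contributes K times the mass of its l - 2 free coordinates. *)
Definition pair_count l := (l * l)%N.
Definition exp_bound K l : R := mass ^+ l + (pair_count l)%:R * (mass ^+ (l - 2) * K).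

(* The pairs are decoupled by exp (sum of N terms) <= 1 + sum of exp (N * term). *)
Lemma weight_exp_bound (k : T -> T -> R) l (c K : R) :
  measurable_fun (D `*` D) (fun p => k p.1 p.2) ->
  0 < c ->
  (\int[m]_(x in D) \int[m]_(y in D) (phi x * phi y * expR (c * `|k x y|))%:E <= K%:E)%E ->
  (\int[pow_measure m l]_t (weight t * expR (c / (pair_count l).+1%:R * `|pair_sum k t|))%:E
    <= (exp_bound K l)%:E)%E.
Proof.
move=> mk c0 kK; set N := (pair_count l).+1.
have mass0 := mass_ge0.
have K0 : 0 <= K.
  rewrite -lee_fin; apply: le_trans kK; apply: integral_ge0 => x Dx.
  apply: integral_ge0 => y Dy; rewrite lee_fin !mulr_ge0 ?expR_ge0// ltW// phi_gt0//.
pose h (p : T * T) : \bar R := (expR (c * `|kernel_on k p|))%:E.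
have mkk := kernel_on_meas mk.
have mh : measurable_fun setT h.
  apply/measurable_EFinP; apply: measurableT_comp => //; apply: measurable_funM => //.
  exact: measurableT_comp.
have h0 p : (0 <= h p)%E by rewrite lee_fin expR_ge0.
have mwh (i j : 'I_l) : measurable_fun setT
    (fun t : l.-tuple T => ((weight t)%:E * h (tnth t i, tnth t j))%E).
  apply: emeasurable_funM; first by apply/measurable_EFinP; exact: weight_meas.
  by apply: measurableT_comp => //; apply: measurable_fun_pair; exact: measurable_tnth.
have wh0 (i j : 'I_l) (t : l.-tuple T) : (0 <= (weight t)%:E * h (tnth t i, tnth t j))%E.
  by rewrite mule_ge0// lee_fin weight_ge0.
have hK : (\int[m]_x ((density_on x)%:E * \int[m]_y ((density_on y)%:E * h (x, y))) <= K%:E)%E.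
  apply: le_trans kK; rewrite [leRHS]integral_mkcond le_eqVlt; apply/predU1P; left.
  apply: eq_integral => x _; rewrite patchE; case: ifPn; rewrite ?inE ?notin_setE => Dx;
    last first.
    by rewrite density_on_out// mul0e.
  rewrite -ge0_integralZl//; last 3 first.
  - apply: emeasurable_funM; first by apply/measurable_EFinP; exact: density_on_meas.
    by apply: measurableT_comp => //; exact: measurable_pair1.
  - by move=> y _; rewrite mule_ge0// lee_fin density_on_ge0.
  - by rewrite lee_fin density_on_ge0.
  rewrite [RHS]integral_mkcond; apply: eq_integral => y _; rewrite patchE.
  case: ifPn; rewrite ?inE ?notin_setE => Dy;
    last by rewrite [density_on y]density_on_out// mul0e mule0.
  by rewrite !density_on_in// /h kernel_on_in// -!EFinM mulrA.
have pairK (i j : 'I_l) : (i < j)%N ->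
    (\int[pow_measure m l]_t ((weight t)%:E * h (tnth t i, tnth t j)) <=
      (mass ^+ (l - 2) * K)%:E)%E.
  (* For l < 2 there is no pair i < j, so the subtraction l - 2 is genuine where it is used. *)
  case: l i j {N mwh wh0} => [[]//|[|l]] i j ij.
    by move: i j ij => [[|//] ?] [[|//] ?].
  rewrite (integral_pow_marginal2 _ density_on_meas density_on_ge0 ij mh h0).
  rewrite integral_density_on -EFin_expe subSS subSS subn0 EFinM.
  by rewrite lee_wpmul2l ?lee_fin ?exprn_ge0.
apply: (@le_trans _ _ (\int[pow_measure m l]_t ((weight t)%:E +
    \sum_(i < l) \sum_(j < l) (if (i < j)%N then (weight t)%:E * h (tnth t i, tnth t j) else
      0)))%E).
  apply: ge0_le_integral => //.
  - by move=> t _; rewrite lee_fin mulr_ge0 ?weight_ge0 ?expR_ge0.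
  - apply/measurable_EFinP; apply: measurable_funM; first exact: weight_meas.
    apply: measurableT_comp => //; apply: measurable_funM => //; apply: measurableT_comp => //.
    exact: pair_sum_meas.
  - apply: emeasurable_funD; first by apply/measurable_EFinP; exact: weight_meas.
    by apply: emeasurable_sum => i; apply: emeasurable_sum => j; case: (i < j)%N.
  move=> t _.
  have E : (\sum_(i < l) \sum_(j < l) (if (i < j)%N then (weight t)%:E * h (tnth t i, tnth t j)
    else 0) =
     (weight t * \sum_(p : 'I_l * 'I_l | (p.1 < p.2)%N) expR
       (c * `|kernel_on k (tnth t p.1, tnth t p.2)|))%:E)%E.
    rewrite mulr_sumr -sumEFin -(pair_big_dep predT (fun i j : 'I_l => (i < j)%N)
      (fun i j => (weight t * expR (c * `|kernel_on k (tnth t i, tnth t j)|))%:E))/=.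
    by apply: eq_bigr => i _; rewrite [RHS]big_mkcond; apply: eq_bigr => j _; case: ifPn.
  rewrite E -EFinD -[X in X + _]mulr1 -mulrDr lee_fin ler_wpM2l ?weight_ge0//.
  (* Decoupling multiplies each term by N, so the rate c / N returns to the rate c assumed for a
     single pair. *)
  pose y (p : 'I_l * 'I_l) := c / N%:R * `|kernel_on k (tnth t p.1, tnth t p.2)|.
  have y0 p : 0 <= y p by rewrite mulr_ge0// divr_ge0// ltW.
  apply: (@le_trans _ _ (expR (\sum_(p : 'I_l * 'I_l | (p.1 < p.2)%N) y p))).
    rewrite ler_expR -mulr_sumr ler_wpM2l ?divr_ge0 ?(ltW c0)//.
    rewrite /pair_sum pair_big_dep/=; apply: (le_trans (ler_norm_sum _ _ _)).
    by rewrite le_eqVlt; apply/predU1P; left; apply: eq_bigl => p.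
  apply: (le_trans (@expR_sum_le R _ _ _ y N y0 _)).
    by rewrite /index_enum -enumT -cardT card_prod card_ord /N leqnSn.
  rewrite lerD2l ler_sum// => p _; rewrite ler_expR /y mulrA mulrCA divff ?mulr1//.
  by rewrite pnatr_eq0.
rewrite ge0_integralD//; last 4 first.
- by move=> t _; rewrite lee_fin weight_ge0.
- by apply/measurable_EFinP; exact: weight_meas.
- by move=> t _; apply: sume_ge0 => i _; apply: sume_ge0 => j _; case: ifPn.
- by apply: emeasurable_sum => i; apply: emeasurable_sum => j; case: (i < j)%N.
rewrite integral_weight /exp_bound EFinD leeD2l//.
rewrite ge0_integral_sum//; last 2 first.
- by move=> i; apply: emeasurable_sum => j; case: (i < j)%N.
- by move=> i t _; apply: sume_ge0 => j _; case: ifPn.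
apply: (@le_trans _ _ (\sum_(i < l) \sum_(j < l) (mass ^+ (l - 2) * K)%:E)%E).
  apply: lee_sum => i _; rewrite ge0_integral_sum//; last 2 first.
  - by move=> j; case: (i < j)%N.
  - by move=> j t _; case: ifPn.
  apply: lee_sum => j _; have [ij|ij] := boolP (i < j)%N; first exact: pairK.
  by rewrite integral0 lee_fin mulr_ge0// exprn_ge0.
under eq_bigr do rewrite sumEFin sumr_const card_ord.
by rewrite sumEFin sumr_const card_ord -mulrnA mulr_natl.
Qed.

Lemma weight_exp_integrable (k : T -> T -> R) l (c K : R) :
  measurable_fun (D `*` D) (fun p => k p.1 p.2) ->
  0 < c ->
  (\int[m]_(x in D) \int[m]_(y in D) (phi x * phi y * expR (c * `|k x y|))%:E <= K%:E)%E ->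
  (pow_measure m l).-integrable setT (EFin \o
    (fun t => weight t * expR (c / (pair_count l).+1%:R * `|pair_sum k t|))).
Proof.
move=> mk c0 kK; apply/integrableP; split.
  apply/measurable_EFinP; apply: measurable_funM; first exact: weight_meas.
  apply: measurableT_comp => //; apply: measurable_funM => //; apply: measurableT_comp => //.
  exact: pair_sum_meas.
under eq_integral do rewrite /= ger0_norm ?mulr_ge0 ?weight_ge0 ?expR_ge0//.
by apply: (le_lt_trans (weight_exp_bound l mk c0 kK)); rewrite ltry.
Qed.

End weights.

Lemma cvg_sum_seq (R : realType) (U : Type) (A : set_system U) {FA : Filter A} (I : Type)
    (r : seq I) (Q : pred I) (f : U -> I -> R) (l : I -> R) :
  (forall i, Q i -> f u i @[u --> A] --> l i) ->
  \sum_(i <- r | Q i) f u i @[u --> A] --> \sum_(i <- r | Q i) l i.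
Proof.
move=> h; elim: r => [|a r IH].
  by rewrite big_nil; under eq_fun do rewrite big_nil; exact: cvg_cst.
case: (boolP (Q a)) => Qa.
  rewrite big_cons Qa; under eq_fun do rewrite big_cons Qa.
  by apply: cvgD => //; exact: h.
by rewrite big_cons (negbTE Qa); under eq_fun do rewrite big_cons (negbTE Qa).
Qed.

(** * Derivatives and kernel limits of the formal moments *)

Section moment_family.
Context (R : realType) d (T : measurableType d) (m : {sigma_finite_measure set T -> \bar R}).
Variables (D : set T) (phi : T -> R).
Hypothesis D_meas : measurable D.
Hypothesis phi_meas : measurable_fun D phi.
Hypothesis phi_gt0 : forall x, D x -> 0 < phi x.
Hypothesis phi_int : m.-integrable D (EFin \o phi).

Local Notation weight := (weight D phi).
Local Notation pair_sum := (pair_sum D).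

Definition moment_deriv (k : T -> T -> R) l n (mu : R) : R :=
  (\int[pow_measure m l]_t (weight t * (pair_sum k t ^+ n * expR (mu * pair_sum k t))))%R.

Lemma is_derive_moment_deriv (k : T -> T -> R) l (c : R) :
  measurable_fun (D `*` D) (fun p => k p.1 p.2) -> 0 < c ->
  (pow_measure m l).-integrable setT (EFin \o
    (fun t => weight t * expR (c * `|pair_sum k t|))) ->
  forall n (mu : R), `|mu| < c ->
    is_derive mu 1 (moment_deriv k l n) (moment_deriv k l n.+1 mu).
Proof.
move=> mk c0 ki n mu muc.
apply: (@is_derive_exp_family _ _ _ (pow_measure m l) (@weight l) (@pair_sum k l) c) => //.
- exact: weight_meas.
- by move=> t; exact: weight_ge0.
- exact: pair_sum_meas.
Qed.

Section limit.
Variables (k : R -> T -> T -> R) (k0 : T -> T -> R).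
Hypothesis k_meas : forall eps, 0 < eps -> measurable_fun (D `*` D) (fun p => k eps p.1 p.2).
Hypothesis k0_meas : measurable_fun (D `*` D) (fun p => k0 p.1 p.2).
Hypothesis k_cvg : {ae (m \x m)%E, forall p, D p.1 -> D p.2 ->
  k eps p.1 p.2 @[eps --> 0^'+] --> k0 p.1 p.2}.

(** By the two-coordinate marginal formula, the weighted integral of the indicator of a null set of
    pairs is zero, so the product of weight and indicator vanishes almost everywhere. *)
Lemma ae_weight_pair l (N : set (T * T)) (i j : 'I_l) : (i < j)%N -> measurable N ->
  ((m \x m) N = 0)%E ->
  {ae pow_measure m l, forall t, weight t != 0 -> ~ N (tnth t i, tnth t j)}.
Proof.
move=> ij mN N0.
pose h (p : T * T) : \bar R := (\1_N p)%:E.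
have mh : measurable_fun setT h by apply/measurable_EFinP; exact: measurable_indic.
have h0 p : (0 <= h p)%E by rewrite lee_fin.
have mrho : measurable_fun setT (density_on D phi) by exact: density_on_meas.
have rho0 x : 0 <= density_on D phi x by exact: density_on_ge0.
have mg : measurable_fun setT (fun p : T * T =>
    ((density_on D phi p.1)%:E * ((density_on D phi p.2)%:E * h p))%E).
  apply: emeasurable_funM; last apply: emeasurable_funM => //.
    by apply/measurable_EFinP; exact: measurableT_comp mrho measurable_fst.
  by apply/measurable_EFinP; exact: measurableT_comp mrho measurable_snd.
have g0 (p : T * T) : (0 <= (density_on D phi p.1)%:E * ((density_on D phi p.2)%:E * h p))%E.
  by rewrite !mule_ge0// lee_fin.
have I0 : (\int[m]_x ((density_on D phi x)%:E *
    \int[m]_y ((density_on D phi y)%:E * h (x, y))) = 0)%E.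
  transitivity (\int[m \x m]_p ((density_on D phi p.1)%:E * ((density_on D phi p.2)%:E * h p)))%E.
    rewrite (fubini_tonelli1 _ mg g0); apply: eq_integral => x _.
    rewrite /fubini_F/= ge0_integralZl ?lee_fin//; last first.
      by move=> y _; rewrite mule_ge0// lee_fin.
    apply: emeasurable_funM; first exact/measurable_EFinP.
    by apply: measurableT_comp => //; exact: measurable_pair1.
  rewrite (ge0_negligible_integral mN measurableT mg) ?N0//.
  apply: integral0_eq => p [_ Np]; rewrite /h indicE memNset// !mule0//.
have W0 : (\int[pow_measure m l]_t `|(weight t)%:E * h (tnth t i, tnth t j)| = 0)%E.
  under eq_integral do rewrite gee0_abs ?mule_ge0 ?lee_fin ?weight_ge0//.
  case: l i j ij => [[]//|[|l]] i j ij; first by move: i j ij => [[|//] ?] [[|//] ?].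
  by rewrite (integral_pow_marginal2 _ mrho rho0 ij mh h0) I0 mule0.
have : ae_eq (pow_measure m l) setT (fun t => (weight t)%:E * h (tnth t i, tnth t j))%E (cst 0%E).
  apply/ae_eq_integral_abs => //; apply: emeasurable_funM.
    by apply/measurable_EFinP; exact: weight_meas.
  by apply: measurableT_comp => //; apply: measurable_fun_pair; exact: measurable_tnth.
apply: filterS => t /= /(_ I) /eqP; rewrite mule_eq0 => /orP[/eqP[->]|]; first by rewrite eqxx.
rewrite /h indicE => /eqP[+ _] Nt; rewrite mem_set//= => /eqP; by rewrite oner_eq0.
Qed.

Lemma ae_pair_sum_cvg l : {ae pow_measure m l, forall t, weight t != 0 ->
  pair_sum (k eps) t @[eps --> 0^'+] --> pair_sum k0 t}.
Proof.
have [N [mN N0 kN]] := k_cvg.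
have H (i : 'I_l) : {ae pow_measure m l, forall t, forall j : 'I_l, (i < j)%N ->
    weight t != 0 -> ~ N (tnth t i, tnth t j)}.
  apply: filter_forall => j; have [ij|ij] := boolP (i < j)%N; last exact: aeW.
  by apply: filterS (ae_weight_pair ij mN N0) => t ht _.
have {}H : {ae pow_measure m l, forall t, forall i j : 'I_l, (i < j)%N ->
    weight t != 0 -> ~ N (tnth t i, tnth t j)} by exact: filter_forall.
apply: filterS H => t ht Wt.
have Dt := weight_neq0 Wt.
apply: (@cvg_sum_seq R R (0^'+) _ _ _ _ (fun eps (i : 'I_l) =>
  \sum_(j < l | (i < j)%N) kernel_on D (k eps) (tnth t i, tnth t j))) => i _.
apply: (@cvg_sum_seq R R (0^'+) _ _ _ _ (fun eps (j : 'I_l) =>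
  kernel_on D (k eps) (tnth t i, tnth t j))) => j ij.
have := ht i j ij Wt => Nij.
have kij : k eps (tnth t i) (tnth t j) @[eps --> 0^'+] --> k0 (tnth t i) (tnth t j).
  apply: contrapT => nk; apply: Nij; apply: kN => /= /(_ (Dt i) (Dt j)).
  exact: nk.
by rewrite kernel_on_in//; under eq_fun do rewrite kernel_on_in//.
Qed.

(** [weak_cvg] with respect to the weighted power measure: bounded test functions converge by
    dominated convergence, and the assumed growth of f^2 turns the exponential bound into a second
    moment bound. *)
Lemma pair_sum_limit l (f : R -> R) (C B c : R) : continuous f ->
  (forall x, f x ^+ 2 <= C * expR (c * `|x|)) -> 0 <= C ->
  (\forall eps \near 0^'+, (\int[pow_measure m l]_t
     (weight t * expR (c * `|pair_sum (k eps) t|))%:E <= B%:E)%E) ->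
  (pow_measure m l).-integrable setT (EFin \o (fun t => weight t * f (pair_sum k0 t))) /\
  (\int[pow_measure m l]_t (weight t * f (pair_sum (k eps) t)))%R @[eps --> 0^'+] -->
    (\int[pow_measure m l]_t (weight t * f (pair_sum k0 t)))%R.
Proof.
move=> cf fC C0 hB.
have mW : measurable_fun setT (@weight l) by exact: weight_meas.
have W0 t : 0 <= @weight l t by exact: weight_ge0.
have mf : measurable_fun setT f by exact: continuous_measurable_fun.
have mk eps : 0 < eps -> measurable_fun setT (@pair_sum (k eps) l).
  by move=> e0; apply: pair_sum_meas => //; exact: k_meas.
have mk0 : measurable_fun setT (@pair_sum k0 l) by exact: pair_sum_meas.
have iW := weight_integrable D_meas phi_meas phi_gt0 phi_int l.
have := @weak_cvg R _ _ (pow_measure m l) (@weight l) W0 iW R (0^'+) _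
  (fun eps t => f (pair_sum (k eps) t)) (fun t => f (pair_sum k0 t)) (C * B) _ _ _ _.
case => //.
- near=> eps; apply: measurableT_comp => //; apply: mk; exact: (near (nbhs_right_gt 0) eps).
- exact: measurableT_comp.
(* Dominated convergence is about sequences, so the limit at 0+ is tested along sequences. *)
- move=> h ch [M hM]; apply/cvg_at_rightP => u [u0 cu].
  have mh : measurable_fun setT h by exact: continuous_measurable_fun.
  have mn n : measurable_fun setT (fun t : l.-tuple T =>
    (weight t * h (f (pair_sum (k (u n)) t)))%:E).
    apply/measurable_EFinP; apply: measurable_funM => //.
    by do 2 (apply: measurableT_comp => //); exact: mk.
  have ml : measurable_fun setT (fun t : l.-tuple T => (weight t * h (f (pair_sum k0 t)))%:E).
    apply/measurable_EFinP; apply: measurable_funM => //.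
    by do 2 (apply: measurableT_comp => //).
  have [|||il _ lim] := @dominated_convergence _ _ _ (pow_measure m l) setT measurableT
    _ _ (EFin \o (fun t : l.-tuple T => M * weight t)) mn ml.
  + apply: filterS (ae_pair_sum_cvg l) => t ht _.
    case: (eqVneq (weight t) 0) => [->|/ht kt].
      by rewrite mul0r; under eq_fun do rewrite mul0r; exact: cvg_cst.
    apply: cvg_EFin; first exact: nearW.
    rewrite /comp/=; apply: cvgMl_tmp.
    have kut : pair_sum (k (u n)) t @[n --> \oo] --> pair_sum k0 t.
      by move/cvg_at_rightP : kt; apply.
    apply: (@cvg_comp _ _ _ (fun n => f (pair_sum (k (u n)) t)) h _ (nbhs (f (pair_sum k0 t))));
      last exact: ch.
    by apply: (@cvg_comp _ _ _ (fun n => pair_sum (k (u n)) t) f _ (nbhs (pair_sum k0 t)));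
      last exact: cf.
  + exact: integrableZ_EFin.
  + apply: aeW => t n _; rewrite lee_fin normrM (ger0_norm (W0 t)) mulrC ler_wpM2r//.
  + rewrite /= in lim; rewrite /Rintegral.
    apply: fine_cvg; rewrite fineK; first exact: lim.
    exact: integrable_fin_num.
- near=> eps.
  have e0 : 0 < eps by exact: (near (nbhs_right_gt 0) eps).
  apply: (@le_trans _ _ (\int[pow_measure m l]_t
    (C%:E * (weight t * expR (c * `|pair_sum (k eps) t|))%:E))%E).
    apply: ge0_le_integral => //.
    + by move=> t _; rewrite lee_fin mulr_ge0// sqr_ge0.
    + apply/measurable_EFinP; apply: measurable_funM => //; apply: measurable_funX.
      by apply: measurableT_comp => //; exact: mk.
    + apply: measurable_funeM; apply/measurable_EFinP; apply: measurable_funM => //.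
      apply: measurableT_comp => //; apply: measurable_funM => //.
      by apply: measurableT_comp => //; exact: mk.
    + by move=> t _; rewrite -EFinM lee_fin (mulrCA C) ler_wpM2l.
  rewrite ge0_integralZl ?lee_fin//; last 2 first.
  + apply/measurable_EFinP; apply: measurable_funM => //.
    apply: measurableT_comp => //; apply: measurable_funM => //.
    by apply: measurableT_comp => //; exact: mk.
  + by move=> t _; rewrite lee_fin mulr_ge0// expR_ge0.
  rewrite EFinM lee_wpmul2l ?lee_fin//.
  exact: (near hB eps).
Unshelve. all: end_near. Qed.
End limit.
End moment_family.

(** * Moments of the chaos *)

Section chaos_moments.
Context (R : realType) (d : nat).
Local Notation T := (euclid R d).
Local Notation m := (lebesgue_euclid R d).
Context (D : set T) (phi : T -> R).
Context dO (Omega : measurableType dO) (P : probability Omega R).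
Context (X : T -> Omega -> R) (g : T -> T -> R) (C : R).
Hypothesis D_meas : measurable D.
Hypothesis phi_meas : measurable_fun D phi.
Hypothesis phi_gt0 : forall x, D x -> 0 < phi x.
Hypothesis phi_int : m.-integrable D (EFin \o phi).
Hypothesis X_joint : measurable_fun [set: T * Omega] (fun p => X p.1 p.2).
Hypothesis X_gauss : centered_gaussian_process P X g.
Hypothesis gC : forall x, D x -> g x x <= C.

Local Notation rho := (density_on D phi).
Let mass := phibar D phi.

Lemma X_meas x : measurable_fun setT (X x).
Proof. exact: (measurableT_comp X_joint (measurable_pair1 x)). Qed.

(** The covariance is an integral over Omega of a jointly measurable product, so it inherits
    measurability from [X]. *)
Lemma g_meas : measurable_fun setT (fun p : T * T => g p.1 p.2).
Proof.
under eq_fun do rewrite -(process_covariance X_gauss).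
apply: (@measurable_Rintegral_param _ _ _ _ _ P
  (fun q : (T * T) * Omega => X q.1.1 q.2 * X q.1.2 q.2)).
apply: measurable_funM.
  apply: (@measurableT_comp _ _ _ _ _ _ _ _ (fun q : (T * T) * Omega => (q.1.1, q.2)) X_joint).
  apply: measurable_fun_pair => //.
  exact: measurableT_comp measurable_fst measurable_fst.
apply: (@measurableT_comp _ _ _ _ _ _ _ _ (fun q : (T * T) * Omega => (q.1.2, q.2)) X_joint).
apply: measurable_fun_pair => //.
exact: measurableT_comp measurable_snd measurable_fst.
Qed.

Lemma var_meas : measurable_fun setT (fun x => g x x).
Proof.
apply: (@measurableT_comp _ _ _ _ _ _ _ _ (fun x => (x, x)) g_meas).
exact: measurable_fun_pair.
Qed.

Lemma g_meas_on : measurable_fun (D `*` D) (fun p => g p.1 p.2).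
Proof. exact: measurable_funTS g_meas. Qed.

Lemma g_bound x y : D x -> D y -> `|g x y| <= C.
Proof. by move=> Dx Dy; apply: (process_cov_le X_meas X_gauss); exact: gC. Qed.

(** For a fixed regularization the kernel is bounded on D, so every exponential rate is available,
    in contrast with the limit. *)
Lemma g_exp_int (c : R) : 0 < c ->
  (\int[m]_(x in D) \int[m]_(y in D) (phi x * phi y * expR (c * `|g x y|))%:E <=
   (mass * mass * expR (c * C))%:E)%E.
Proof.
move=> c0; have phi0 x : D x -> 0 <= phi x by move=> Dx; rewrite ltW// phi_gt0.
have mgx x : measurable_fun D (fun y => phi x * phi y * expR (c * `|g x y|)).
  apply: measurable_funM; first by apply: measurable_funM.
  apply: measurableT_comp => //; apply: measurable_funM => //; apply: measurableT_comp => //.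
  apply: measurable_funTS; apply: (@measurableT_comp _ _ _ _ _ _ _ _ (fun y => (x, y)) g_meas).
  exact: measurable_pair1.
have phiE : (\int[m]_(y in D) (phi y)%:E = mass%:E)%E.
  by rewrite /mass /phibar /Rintegral fineK//; exact: integrable_fin_num.
have inner x : D x -> (\int[m]_(y in D) (phi x * phi y * expR (c * `|g x y|))%:E <=
    (phi x * (mass * expR (c * C)))%:E)%E.
  move=> Dx.
  apply: (@le_trans _ _ (\int[m]_(y in D) ((phi x * expR (c * C))%:E * (phi y)%:E))%E).
    apply: ge0_le_integral => //.
    - by move=> y Dy; rewrite lee_fin !mulr_ge0 ?expR_ge0 ?phi0.
    - exact/measurable_EFinP.
    - by apply: measurable_funeM; exact/measurable_EFinP.
    - move=> y Dy; rewrite -EFinM lee_fin mulrAC ler_wpM2r ?phi0//.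
      by rewrite ler_wpM2l ?phi0// ler_expR ler_wpM2l ?(ltW c0)// g_bound.
  rewrite (integralZl D_meas phi_int) phiE -EFinM lee_fin.
  by rewrite -mulrA [expR _ * _]mulrC.
apply: (@le_trans _ _ (\int[m]_(x in D) ((mass * expR (c * C))%:E * (phi x)%:E))%E).
  apply: ge0_le_integral => //.
  - by move=> x Dx; apply: integral_ge0 => y Dy; rewrite lee_fin !mulr_ge0 ?expR_ge0 ?phi0.
  - have mrho : measurable_fun setT rho by exact: density_on_meas.
    have mF : measurable_fun setT (fun p : T * T => rho p.1 * rho p.2 * expR (c * `|g p.1 p.2|)).
      apply: measurable_funM; first apply: measurable_funM.
      - exact: measurableT_comp mrho measurable_fst.
      - exact: measurableT_comp mrho measurable_snd.
      - apply: measurableT_comp => //; apply: measurable_funM => //.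
        exact: measurableT_comp g_meas.
    have := measurable_funS measurableT (subsetT D) (@measurable_integral_param _ _ _ _ _ m _ mF).
    apply: eq_measurable_fun => x; rewrite inE => Dx /=.
    rewrite [RHS]integral_mkcond; apply: eq_integral => y _; rewrite patchE.
    case: ifPn; rewrite ?inE ?notin_setE => Dy; first by rewrite !density_on_in.
    by rewrite [rho y]density_on_out// mulr0 mul0r.
  - by apply: measurable_funeM; exact/measurable_EFinP.
  - by move=> x Dx; apply: (le_trans (inner x Dx)); rewrite -EFinM mulrC.
by rewrite (integralZl D_meas phi_int) phiE -EFinM lee_fin mulrAC.
Qed.
Lemma g_weight_exp_integrable l (c : R) : 0 <= c ->
  (pow_measure m l).-integrable setT (EFin \o
    (fun t : l.-tuple T => weight D phi t * expR (c * `|pair_sum D g t|))).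
Proof.
move=> c0.
(* The factor compensates the loss of rate in [weight_exp_integrable]; c + 1 keeps it positive when
   c = 0. *)
have c'0 : 0 < (c + 1) * (pair_count l).+1%:R by rewrite mulr_gt0// ltr_wpDl.
have := weight_exp_integrable D_meas phi_meas phi_gt0 phi_int l g_meas_on c'0 (g_exp_int c'0).
apply: le_integrable => //.
- apply/measurable_EFinP; apply: measurable_funM; first exact: weight_meas.
  apply: measurableT_comp => //; apply: measurable_funM => //; apply: measurableT_comp => //.
  by apply: pair_sum_meas => //; exact: g_meas_on.
- move=> t _ /=; rewrite lee_fin !normrM !(ger0_norm (expR_ge0 _)) ler_wpM2l//.
  by rewrite ler_expR mulfK ?pnatr_eq0// ler_wpM2r// lerDl.
Qed.

Lemma moment_deriv_integrable l n (mu : R) :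
  (pow_measure m l).-integrable setT (EFin \o
    (fun t : l.-tuple T => weight D phi t * (pair_sum D g t ^+ n * expR (mu * pair_sum D g t)))).
Proof.
have c0 : 0 < `|mu| + 1 by rewrite ltr_wpDl.
apply: (@exp_family_integrable _ _ _ (pow_measure m l) _ _ (`|mu| + 1)); last by rewrite ltrDl.
- exact: weight_meas.
- by move=> t; exact: weight_ge0.
- by apply: pair_sum_meas => //; exact: g_meas_on.
- by apply: g_weight_exp_integrable; exact: ltW.
Qed.

(* Sealed: comparing its values at X and at - X by conversion would unfold the
   integrals. *)
Fact chaos_int_key : {f : (T -> Omega -> R) -> (T -> T -> R) -> R -> Omega -> \bar R |
  f = fun Y k mu w =>
    (\int[m]_x (rho x * expR (Num.sqrt mu * Y x w - mu / 2 * k x x))%:E)%E}.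
Proof. by eexists. Qed.

Definition chaos_int := sval chaos_int_key X g.

Lemma chaos_intE mu w : chaos_int mu w =
  (\int[m]_x (rho x * expR (Num.sqrt mu * X x w - mu / 2 * g x x))%:E)%E.
Proof. by rewrite /chaos_int (svalP chaos_int_key). Qed.

Lemma chaosE mu w : chaos D phi P X mu w = fine (chaos_int mu w).
Proof.
rewrite chaos_intE /chaos /Rintegral; congr fine; rewrite integral_mkcond; apply: eq_integral =>
  x _.
rewrite patchE; case: ifPn; rewrite ?inE ?notin_setE => Dx.
  by rewrite density_on_in// (process_variance X_gauss).
by rewrite density_on_out// mul0r.
Qed.

Lemma chaos_int_ge0 mu w : (0 <= chaos_int mu w)%E.
Proof.
by rewrite chaos_intE integral_ge0// => x _; rewrite lee_fin mulr_ge0 ?expR_ge0// density_on_ge0.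
Qed.

Lemma chaos_ge0 mu w : 0 <= chaos D phi P X mu w.
Proof. by rewrite chaosE fine_ge0// chaos_int_ge0. Qed.

Let mker mu : measurable_fun setT (fun p : T * Omega =>
  rho p.1 * expR (Num.sqrt mu * X p.1 p.2 - mu / 2 * g p.1 p.1)).
Proof.
apply: measurable_funM.
  by apply: (@measurableT_comp _ _ _ _ _ _ rho _ fst) => //; exact: density_on_meas.
apply: measurableT_comp => //; apply: measurable_funB; apply: measurable_funM => //.
exact: (@measurableT_comp _ _ _ _ _ _ _ _ fst var_meas measurable_fst).
Qed.

Lemma chaos_int_meas mu : measurable_fun setT (chaos_int mu).
Proof.
apply: (eq_measurable_fun (fun w =>
  (\int[m]_x (rho x * expR (Num.sqrt mu * X x w - mu / 2 * g x x))%:E)%E)).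
  by move=> w _; rewrite chaos_intE.
apply: (@measurable_integral_param _ _ _ _ _ m (fun q : Omega * T =>
  rho q.2 * expR (Num.sqrt mu * X q.2 q.1 - mu / 2 * g q.2 q.2))).
exact: (@measurableT_comp _ _ _ _ _ _ _ _ (fun q : Omega * T => (q.2, q.1)) (mker mu)
  (measurable_fun_pair measurable_snd measurable_fst)).
Qed.

Lemma chaos_meas mu : measurable_fun setT (chaos D phi P X mu).
Proof.
rewrite (_ : chaos D phi P X mu = fine \o chaos_int mu); last first.
  by apply/funext => w; exact: chaosE.
by apply: measurableT_comp => //; exact: chaos_int_meas.
Qed.

(* Tonelli on the product of Omega with the l-fold power of the space, then the
   Gaussian moment generating function. *)
Lemma chaos_int_moment l mu : 0 <= mu ->
  (\int[P]_w (chaos_int mu w ^+ l) = (moment_deriv m D phi g l 0 mu)%:E)%E.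
Proof.
move=> mu0.
pose q x w := rho x * expR (Num.sqrt mu * X x w - mu / 2 * g x x).
have q0 x w : 0 <= q x w by rewrite mulr_ge0 ?expR_ge0// density_on_ge0.
have mq w : measurable_fun setT (fun x => q x w).
  exact: (@measurableT_comp _ _ _ _ _ _ _ _ (fun x => (x, w)) (mker mu) (measurable_pair2 w)).
have mprod : measurable_fun setT (fun z : Omega * l.-tuple T =>
    (\prod_(i < l) q (tnth z.2 i) z.1)%:E).
  apply/measurable_EFinP; apply: (@measurable_prod _ _ _ _ _ _
    (fun i (z : Omega * l.-tuple T) => q (tnth z.2 i) z.1)) => i _.
  apply: (@measurableT_comp _ _ _ _ _ _ _ _ (fun z : Omega * l.-tuple T => (tnth z.2 i, z.1))
    (mker mu)).
  apply: measurable_fun_pair => //.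
  by apply: (@measurableT_comp _ _ _ _ _ _ (fun t : l.-tuple T => tnth t i) _ snd) => //; exact:
    measurable_tnth.
transitivity (\int[P]_w \int[pow_measure m l]_t (\prod_(i < l) q (tnth t i) w)%:E)%E.
  apply: eq_integral => w _.
  by rewrite chaos_intE (integral_pow_prod _ (mq w) (fun x => q0 x w)).
rewrite (@fubini_tonelli _ _ _ _ _ P (pow_measure m l) _ mprod); last first.
  by move=> z; rewrite lee_fin prodr_ge0.
rewrite /moment_deriv EFin_Rintegral; last exact: moment_deriv_integrable.
apply: eq_integral => t _ /=.
under eq_integral => w _.
  rewrite /q big_split/= -/(weight D phi t) -expR_sum EFinM; over.
rewrite ge0_integralZl ?lee_fin ?weight_ge0//; last first.
  apply/measurable_EFinP; apply: measurableT_comp => //; apply: measurable_sum => i.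
  apply: measurable_funB => //; apply: measurable_funM => //; exact: X_meas.
rewrite (process_chaos_mgf X_meas X_gauss)// -EFinM expr0 mul1r; congr (_%:E).
by rewrite (weight_pair_sum _ _ _ _ (fun r => expR (mu * r))).
Qed.

Lemma chaos_int_fin mu : 0 <= mu -> {ae P, forall w, chaos_int mu w \is a fin_num}.
Proof.
move=> mu0.
have ic : P.-integrable setT (chaos_int mu).
  apply/integrableP; split; first exact: chaos_int_meas.
  under eq_integral do rewrite gee0_abs ?chaos_int_ge0//.
  by have := chaos_int_moment 1 mu0; rewrite /= => ->; rewrite ltry.
by have := integrable_ae measurableT ic; apply: filterS => w /(_ I).
Qed.

Lemma chaos_moment l mu : 0 <= mu ->
  P.-integrable setT (EFin \o (fun w => chaos D phi P X mu w ^+ l)) /\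
  (\int[P]_w (chaos D phi P X mu w ^+ l))%R = moment_deriv m D phi g l 0 mu.
Proof.
move=> mu0.
(* [chaos] is [fine] of [chaos_int], which sends an infinite value to 0; this alters it on a null
   set only. *)
have E : (\int[P]_w (chaos D phi P X mu w ^+ l)%:E = (moment_deriv m D phi g l 0 mu)%:E)%E.
  rewrite -chaos_int_moment//; apply: ae_eq_integral => //.
  - by apply/measurable_EFinP; apply: measurable_funX; exact: chaos_meas.
  - elim: l => [|l IH]; first exact: measurable_cst.
    by under eq_fun do rewrite expeS; apply: emeasurable_funM => //; exact: chaos_int_meas.
  - by apply: filterS (chaos_int_fin mu0) => w fw _; rewrite /= EFin_expe chaosE fineK.
split; last by rewrite /Rintegral E.
apply/integrableP; split.
  by apply/measurable_EFinP; apply: measurable_funX; exact: chaos_meas.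
under eq_integral do rewrite /= ger0_norm ?exprn_ge0 ?chaos_ge0//.
by rewrite E ltry.
Qed.
End chaos_moments.

(** * Smoothness in the square root of the intermittency *)

Section dominated_smooth.
Context (R : realType) dO (Omega : measurableType dO) (P : probability Omega R).
Context (G : set Omega) (V : Omega -> R).
Hypothesis G_meas : measurable G.
Hypothesis V_ge0 : forall w, 0 <= V w.
Hypothesis V_int : forall p, P.-integrable G (EFin \o (fun w => (1 + V w) ^+ p)).
Implicit Types f h : R -> Omega -> R.

(** Random functions of s with n derivatives, each dominated on [G] by a polynomial in the single
    variable [V]. As all powers of 1 + V are integrable, the class is stable under sums, products
    and composition with F, and one may differentiate under the expectation. *)
Fixpoint dominated_smooth n f : Prop :=
  [/\ forall s, -1 < s < 1 -> measurable_fun setT (f s),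
      exists C p, 0 <= C /\ forall s w, -1 < s < 1 -> G w ->
        `|f s w| <= C * (1 + V w) ^+ p &
      if n is n'.+1 then exists f', dominated_smooth n' f' /\
        forall (s : R) w, -1 < s < 1 -> G w -> is_derive s 1 (f ^~ w) (f' s w)
      else True].

Lemma dominated_smooth0 n f : dominated_smooth n f -> dominated_smooth 0 f.
Proof. by case: n => [|n] [h1 h2 _]; split. Qed.

Lemma dominated_smoothW n f : dominated_smooth n.+1 f -> dominated_smooth n f.
Proof.
elim: n f => [|n IH] f; first exact: dominated_smooth0.
by move=> [h1 h2 [f' [df' h3]]]; split => //; exists f'; split => //; exact: IH.
Qed.

Let V1 w : 1 <= 1 + V w. Proof. by rewrite lerDl. Qed.

Let V1_ge0 w : 0 <= 1 + V w. Proof. by rewrite addr_ge0. Qed.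

Lemma dominated_smoothD n f h : dominated_smooth n f -> dominated_smooth n h ->
  dominated_smooth n (fun s w => f s w + h s w).
Proof.
have dom f1 h1 : dominated_smooth 0 f1 -> dominated_smooth 0 h1 ->
    dominated_smooth 0 (fun s w => f1 s w + h1 s w).
  move=> [mf [C [p [C0 fC]]] _] [mh [C' [p' [C'0 hC]]] _]; split => //.
    by move=> s s1; apply: measurable_funD; [exact: mf|exact: mh].
  exists (C + C'), (p + p')%N; split; first exact: addr_ge0.
  move=> s w s1 Gw; apply: (le_trans (ler_normD _ _)); rewrite mulrDl; apply: lerD.
    apply: (le_trans (fC s w s1 Gw)); rewrite ler_wpM2l//.
    by apply: ler_weXn2l => //; rewrite leq_addr.
  apply: (le_trans (hC s w s1 Gw)); rewrite ler_wpM2l//.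
  by apply: ler_weXn2l => //; rewrite leq_addl.
elim: n f h => [|n IH] f h; first exact: dom.
move=> sf sh; have [] := dom _ _ (dominated_smooth0 sf) (dominated_smooth0 sh).
move=> mfh bfh _; case: sf => _ _ [f' [df' hf']]; case: sh => _ _ [h' [dh' hh']].
split => //; exists (fun s w => f' s w + h' s w); split; first exact: IH.
move=> s w s1 Gw; apply: is_deriveD; [exact: hf'|exact: hh'].
Qed.

Lemma dominated_smoothM n f h : dominated_smooth n f -> dominated_smooth n h ->
  dominated_smooth n (fun s w => f s w * h s w).
Proof.
have dom f1 h1 : dominated_smooth 0 f1 -> dominated_smooth 0 h1 ->
    dominated_smooth 0 (fun s w => f1 s w * h1 s w).
  move=> [mf [C [p [C0 fC]]] _] [mh [C' [p' [C'0 hC]]] _]; split => //.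
    by move=> s s1; apply: measurable_funM; [exact: mf|exact: mh].
  exists (C * C'), (p + p')%N; split; first exact: mulr_ge0.
  move=> s w s1 Gw; rewrite normrM exprD mulrACA.
  by apply: ler_pM => //; [exact: fC|exact: hC].
elim: n f h => [|n IH] f h; first exact: dom.
move=> sf sh; have [] := dom _ _ (dominated_smooth0 sf) (dominated_smooth0 sh).
move=> mfh bfh _; have sfW := dominated_smoothW sf; have shW := dominated_smoothW sh.
case: sf => _ _ [f' [df' hf']]; case: sh => _ _ [h' [dh' hh']].
split => //; exists (fun s w => f s w * h' s w + h s w * f' s w); split.
  by apply: dominated_smoothD; exact: IH.
by move=> s w s1 Gw; apply: is_deriveM; [exact: hf'|exact: hh'].
Qed.

(** The factor - s is the derivative of - s^2 / 2 in the normalization of the chaos. *)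
Lemma dominated_smoothN_id n : dominated_smooth n (fun s _ => - s).
Proof.
have b1 : exists C p, 0 <= C /\ forall s w, -1 < s < 1 -> G w -> `|- s| <= C * (1 + V w) ^+ p.
  exists 1, 0%N; split => // s w s1 _; rewrite expr0 mulr1 normrN ler_norml.
  by case/andP: s1 => s1 s2; rewrite !ltW.
have c1 k : dominated_smooth k (fun _ _ => -1).
  have b c : exists C p, 0 <= C /\ forall s w, -1 < s < 1 -> G w -> `|c : R|
    <= C * (1 + V w) ^+ p.
    by exists `|c|, 0%N; split => // s w _ _; rewrite expr0 mulr1.
  elim: k => [|k _]; split => //.
  exists (fun _ _ => 0); split; last by move=> s w _ _; exact: is_derive_cst.
  elim: k => [|k IHk]; split => //.
  by exists (fun _ _ => 0); split => // s w _ _; exact: is_derive_cst.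
case: n => [|n]; split => //.
exists (fun _ _ => -1); split; first exact: c1.
by move=> s w _ _; apply: is_derive_eq.
Qed.

Lemma dominated_smooth_comp n (F : R -> R) (Y : R -> Omega -> R) :
  smooth_poly_growth F -> dominated_smooth n Y ->
  (forall s w, -1 < s < 1 -> G w -> 0 <= Y s w) ->
  dominated_smooth n (fun s w => F (Y s w)).
Proof.
move=> + + Y0.
have dom F1 : smooth_poly_growth F1 -> dominated_smooth 0 Y ->
    dominated_smooth 0 (fun s w => F1 (Y s w)).
  move=> sF [mY [C [p [C0 YC]]] _]; split => //.
    by move=> s s1; apply: (measurableT_comp (smooth_measurable 0 sF)); exact: mY.
  have [K [q FK]] := sF.2 0%N.
  (* From 1 + Y <= (1 + C) (1 + V)^p, which uses that (1 + V)^p >= 1. *)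
  exists (`|K| * (1 + C) ^+ q), (p * q)%N; split.
    by rewrite mulr_ge0// exprn_ge0// addr_ge0.
  move=> s w s1 Gw; apply: (le_trans (FK _ (Y0 s w s1 Gw))).
  apply: (@le_trans _ _ (`|K| * (1 + Y s w) ^+ q)).
    by rewrite ler_wpM2r ?ler_norm// exprn_ge0// addr_ge0// Y0.
  rewrite -mulrA ler_wpM2l// exprM -exprMn.
  have Y0' := Y0 s w s1 Gw.
  apply: lerXn2r; rewrite ?nnegrE ?mulr_ge0 ?exprn_ge0 ?addr_ge0//.
  have := YC s w s1 Gw; rewrite ger0_norm//.
  by have := exprn_ege1 p (V1 w); nra.
elim: n F => [|n IH] F sF sY; first exact: dom.
have [mf bf _] := dom F sF (dominated_smooth0 sY).
have sYW := dominated_smoothW sY.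
case: sY => mY bY [Y' [dY' hY']]; split => //.
exists (fun s w => derive1 F (Y s w) * Y' s w); split.
  apply: dominated_smoothM => //; apply: IH => //; exact: smooth_poly_growth_derive.
move=> s w s1 Gw; have dF := smooth_is_derive sF 0 (Y s w).
exact: (is_derive1_comp dF (hY' s w s1 Gw)).
Qed.

Definition expect_on f s : R := (\int[P]_(w in G) f s w)%R.

Lemma dominated_smooth_integrable f s : dominated_smooth 0 f -> -1 < s < 1 ->
  P.-integrable G (EFin \o f s).
Proof.
move=> [mf [C [p [C0 fC]]] _] s1.
apply: (fun m => integrable_bound G_meas m (integrableZ_EFin G_meas C (V_int p))).
  exact/measurable_funTS/mf.
by move=> w Gw; exact: fC.
Qed.

Lemma is_derive_expect_on n f f' : dominated_smooth n.+1 f -> dominated_smooth n f' ->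
  (forall (s : R) w, -1 < s < 1 -> G w -> is_derive s 1 (f ^~ w) (f' s w)) ->
  forall s : R, -1 < s < 1 -> is_derive s 1 (expect_on f) (expect_on f' s).
Proof.
move=> sf sf' dff s s1; have sf0 := dominated_smooth0 sf.
case: (dominated_smooth0 sf') => _ [C [p [C0 fC]]] _.
apply: (@is_derive_under_integral _ _ _ P G f f' (fun w => C * (1 + V w) ^+ p) s (-1) 1) => //.
- by move=> x x1; exact: dominated_smooth_integrable.
- exact: integrableZ_EFin.
Qed.

Lemma derive1n_eq_itv (F H : R -> R) : (forall s, -1 < s < 1 -> F s = H s) ->
  forall k s, -1 < s < 1 -> derive1n k F s = derive1n k H s.
Proof.
move=> FH; elim=> [|k IH] s s1; first exact: FH.
rewrite !derive1nS !derive1E; apply: near_eq_derive.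
have : \forall x \near s, x \in `]-1, 1[ by apply: near_in_itvoo; rewrite in_itv.
by apply: filterS => x; rewrite in_itv; exact: IH.
Qed.

(** Induction replaces f by f'. The derivative of the expectation agrees with the expectation of f'
    only on ]-1, 1[, hence the comparison of iterated derivatives on that interval. *)
Lemma is_derive_expect_on_n n f : dominated_smooth n f ->
  forall k (s : R), (k < n)%N -> -1 < s < 1 ->
  is_derive s 1 (derive1n k (expect_on f)) (derive1n k.+1 (expect_on f) s).
Proof.
elim: n f => [//|n IH] f sf.
have [_ _ [f' [sf' dff]]] := sf.
have dE := is_derive_expect_on sf sf' dff.
have E s : -1 < s < 1 -> derive1 (expect_on f) s = expect_on f' s.
  by move=> s1; rewrite derive1E; have [_ ->] := dE s s1.
move=> [s _ s1|k s kn s1]; first by rewrite derive1n1 E//; exact: dE.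
have shift j : derive1n j.+1 (expect_on f) = derive1n j (derive1 (expect_on f)).
  by rewrite /derive1n iterSr.
rewrite !shift (derive1n_eq_itv E k.+1 s1).
apply: (near_eq_is_derive _ (IH f' sf' k s kn s1)).
have : \forall x \near s, x \in `]-1, 1[ by apply: near_in_itvoo; rewrite in_itv.
by apply: filterS => x; rewrite in_itv => x1; apply/esym/derive1n_eq_itv.
Qed.

End dominated_smooth.

Section chaos_smooth.
Context (R : realType) (d : nat).
Local Notation T := (euclid R d).
Local Notation m := (lebesgue_euclid R d).
Context (D : set T) (phi : T -> R).
Context dO (Omega : measurableType dO) (P : probability Omega R).
Context (X : T -> Omega -> R) (g : T -> T -> R) (C : R).
Hypothesis D_meas : measurable D.
Hypothesis phi_meas : measurable_fun D phi.
Hypothesis phi_gt0 : forall x, D x -> 0 < phi x.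
Hypothesis phi_int : m.-integrable D (EFin \o phi).
Hypothesis X_joint : measurable_fun [set: T * Omega] (fun p => X p.1 p.2).
Hypothesis X_gauss : centered_gaussian_process P X g.
Hypothesis gC : forall x, D x -> g x x <= C.

Local Notation rho := (density_on D phi).

Let Xm x w := - X x w.

Let mX x : measurable_fun setT (X x) := X_meas X_joint x.

Let Xm_joint : measurable_fun [set: T * Omega] (fun p => Xm p.1 p.2).
Proof. exact: (measurableT_comp (@oppr_measurable _ _) X_joint). Qed.

(** The opposite field has the same covariance, so the moment results for [X] apply to it and
    control exp(- 2 X) as well. *)
Let Xm_gauss : centered_gaussian_process P Xm g.
Proof.
have [h1 h2 h3] := X_gauss.
have i1 x : P.-integrable setT (EFin \o X x).
  have := gaussian_pow_integrable 1 (mX x) (process_gaussian X_gauss x).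
  by apply: eq_integrable => // w _; rewrite /= expr1.
have E0 x : ('E_P[Xm x] = 0)%E.
  rewrite unlock -EFin_Rintegral; last first.
    have := integrableZ_EFin measurableT (-1) (i1 x).
    by apply: eq_integrable => // w _; rewrite /= mulN1r.
  congr (_%:E); transitivity (\int[P]_w (-1 * X x w))%R.
    by apply: eq_Rintegral => w _; rewrite mulN1r.
  by rewrite RintegralZl// (process_mean X_gauss) mulr0.
split => //.
- move=> n x a; have [mm [s hs]] := h1 n x (fun i => - a i); exists mm, s.
  suff -> : (fun w => \sum_(i < n) a i * Xm (x i) w) =
            (fun w => \sum_(i < n) - a i * X (x i) w) by exact: hs.
  by apply/funext => w; apply: eq_bigr => i _; rewrite mulNr mulrN.
- move=> x y; rewrite -(h3 x y) !covariance.unlock !h2 !E0 unlock/=.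
  by apply: eq_integral => w _; rewrite !fctE/= !subr0 /Xm mulrNN.
Qed.

(* At mu = 4 the exponent is 2 X, and e^(2|X|) <= e^(2X) + e^(-2X) dominates
   every derivative in s = sqrt mu of the chaos density, for |s| < 1. *)
Local Notation U := (chaos_int D phi X g 4).
Local Notation Um := (chaos_int D phi Xm g 4).

Definition good_set : set Omega := [set w | (U w < +oo)%E /\ (Um w < +oo)%E].

(** At mu = 4 the normalization subtracts 2 g(x, x) <= 2 |C| in the exponent; the prefactor restores
    it. *)
Definition envelope (w : Omega) : R :=
  expR (2 * `|C|) * (fine (U w) + fine (Um w)).

Let mU : measurable_fun setT U.
Proof. exact: (chaos_int_meas D_meas phi_meas X_joint X_gauss). Qed.

Let mUm : measurable_fun setT Um.
Proof. exact: (chaos_int_meas D_meas phi_meas Xm_joint Xm_gauss). Qed.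

Let U0 w : (0 <= U w)%E. Proof. exact: chaos_int_ge0. Qed.
Let Um0 w : (0 <= Um w)%E. Proof. exact: chaos_int_ge0. Qed.

Lemma good_set_meas : measurable good_set.
Proof.
rewrite (_ : good_set = ([set: Omega] `&` [set w | (U w < +oo)%E]) `&`
   ([set: Omega] `&` [set w | (Um w < +oo)%E])); last by rewrite !setTI.
by apply: measurableI; exact: emeasurable_fun_infty_o.
Qed.

Lemma good_set_ae : {ae P, forall w, good_set w}.
Proof.
have h0 : (0:R) <= 4 by [].
have h1 := chaos_int_fin D_meas phi_meas phi_gt0 phi_int X_joint X_gauss gC h0.
have h2 := chaos_int_fin D_meas phi_meas phi_gt0 phi_int Xm_joint Xm_gauss gC h0.
by apply: filterS2 h1 h2 => w; rewrite !ge0_fin_numE.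
Qed.

Lemma envelope_ge0 w : 0 <= envelope w.
Proof. by rewrite mulr_ge0 ?expR_ge0// addr_ge0// fine_ge0. Qed.

Let sqrt4 : Num.sqrt 4 = 2 :> R.
Proof. by rewrite (_ : 4 = 2 ^+ 2); [rewrite sqrtr_sqr ger0_norm|rewrite -natrX]. Qed.

Lemma envelope_int p : P.-integrable good_set (EFin \o (fun w => (1 + envelope w) ^+ p)).
Proof.
apply: (@integrableS _ _ _ P setT) => //; first exact: good_set_meas.
have h0 : (0:R) <= 4 by [].
have i1 l := (chaos_moment D_meas phi_meas phi_gt0 phi_int X_joint X_gauss gC l h0).1.
have i2 l := (chaos_moment D_meas phi_meas phi_gt0 phi_int Xm_joint Xm_gauss gC l h0).1.
have c1 w : chaos D phi P X 4 w = fine (U w) by exact: chaosE.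
have c2 w : chaos D phi P Xm 4 w = fine (Um w) by exact: chaosE.
set q := p.*2; pose K := expR (2 * `|C|) : R.
have iV : P.-integrable setT (EFin \o (fun w => 2 ^+ q * (1 + K ^+ q * (2 ^+ q *
    (chaos D phi P X 4 w ^+ q + chaos D phi P Xm 4 w ^+ q))))).
  apply: integrableZ_EFin => //; apply: integrableD_EFin => //.
    exact: finite_measure_integrable_cst.
  by do 2 (apply: integrableZ_EFin => //); exact: integrableD_EFin.
apply: (fun m => integrable_bound measurableT m iV).
  apply: measurable_funX; apply: measurable_funD => //; apply: measurable_funM => //.
  by apply: measurable_funD; apply: measurableT_comp.
move=> w _; rewrite ger0_norm ?exprn_ge0 ?addr_ge0 ?envelope_ge0//.
apply: (le_trans (pow_growth_even p (envelope_ge0 w))); rewrite -/q.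
rewrite ler_wpM2l ?exprn_ge0// lerD2l /envelope exprMn ler_wpM2l ?exprn_ge0 ?expR_ge0//.
rewrite c1 c2; set a := fine _; set b := fine _.
have a0 : 0 <= a by rewrite fine_ge0.
have b0 : 0 <= b by rewrite fine_ge0.
(* For a <= b one has (a + b)^q <= (2 b)^q <= 2^q (a^q + b^q). *)
wlog ab : a b a0 b0 / a <= b.
  move=> H; have [|/ltW] := leP a b; first exact: H.
  by rewrite addrC [X in _ <= _ * X]addrC; exact: H.
apply: (@le_trans _ _ ((2 * b) ^+ q)).
  by rewrite lerXn2r ?nnegrE ?addr_ge0 ?mulr_ge0//; lra.
by rewrite exprMn ler_wpM2l ?exprn_ge0// lerDr exprn_ge0.
Qed.

Let rho0 x : 0 <= rho x. Proof. exact: density_on_ge0. Qed.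
Let mrho : measurable_fun setT rho. Proof. exact: density_on_meas. Qed.
Let mXw w : measurable_fun setT (fun x => X x w).
Proof. exact: (measurableT_comp X_joint (measurable_pair2 w)). Qed.
Let g0 x : 0 <= g x x. Proof. exact: (process_var_ge0 X_gauss). Qed.
Let mg : measurable_fun setT (fun x => g x x).
Proof. exact: (var_meas X_joint X_gauss). Qed.

Let menv w : measurable_fun setT (fun x => rho x * expR (2 * `|X x w|)).
Proof.
apply: measurable_funM => //; apply: measurableT_comp => //; apply: measurable_funM => //.
exact: measurableT_comp.
Qed.

Lemma envelope_integrable w : good_set w ->
  m.-integrable setT (EFin \o (fun x => rho x * expR (2 * `|X x w|))) /\
  (\int[m]_x (rho x * expR (2 * `|X x w|)))%R <= envelope w.
Proof.
move=> [Uw Umw].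
have E : (\int[m]_x (rho x * expR (2 * `|X x w|))%:E <= (envelope w)%:E)%E.
  rewrite /envelope EFinM EFinD !fineK ?ge0_fin_numE//.
  pose q1 x := rho x * expR (Num.sqrt 4 * X x w - 4 / 2 * g x x).
  pose q2 x := rho x * expR (Num.sqrt 4 * Xm x w - 4 / 2 * g x x).
  have m1 : measurable_fun setT (fun x => (q1 x)%:E).
    apply/measurable_EFinP; apply: measurable_funM => //; apply: measurableT_comp => //.
    by apply: measurable_funB; apply: measurable_funM.
  have m2 : measurable_fun setT (fun x => (q2 x)%:E).
    apply/measurable_EFinP; apply: measurable_funM => //; apply: measurableT_comp => //.
    by apply: measurable_funB; apply: measurable_funM => //; exact: measurableT_comp.
  have p1 x : (0 <= (q1 x)%:E)%E by rewrite lee_fin mulr_ge0 ?expR_ge0.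
  have p2 x : (0 <= (q2 x)%:E)%E by rewrite lee_fin mulr_ge0 ?expR_ge0.
  have -> : (U w + Um w = \int[m]_x ((q1 x)%:E + (q2 x)%:E))%E.
    by rewrite !chaos_intE ge0_integralD.
  rewrite -ge0_integralZl ?lee_fin ?expR_ge0//; last 2 first.
  - exact: emeasurable_funD.
  - by move=> x _; rewrite adde_ge0.
  apply: ge0_le_integral => //.
  - by move=> x _; rewrite lee_fin mulr_ge0 ?expR_ge0.
  - exact/measurable_EFinP.
  - by apply: measurable_funeM; exact: emeasurable_funD.
  move=> x _; rewrite -EFinD -EFinM lee_fin /q1 /q2 sqrt4.
  have [Dx|Dx] := pselect (D x); last by rewrite density_on_out// !mul0r addr0 mulr0.
  rewrite -mulrDr mulrCA ler_wpM2l// mulrDr -!expRD.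
  have gx : g x x <= `|C| by rewrite (le_trans (gC Dx))// ler_norm.
  rewrite -{1}[2](ger0_norm (ler0n R 2)) -normrM (le_trans (expR_norm_le _))//.
  by apply: lerD; rewrite ler_expR /Xm; lra.
have i : m.-integrable setT (EFin \o (fun x => rho x * expR (2 * `|X x w|))).
  apply/integrableP; split; first exact/measurable_EFinP.
  under eq_integral do rewrite /= ger0_norm ?mulr_ge0 ?expR_ge0//.
  by apply: (le_lt_trans E); rewrite ltry.
by split => //; rewrite -lee_fin EFin_Rintegral.
Qed.

(** The family closed under d/ds: differentiating the exponent s X - s^2 g / 2 sends (a, b) to (a +
    1, b) minus s times (a, b + 1). *)
Definition chaos_term (a b : nat) (s : R) (w : Omega) (x : T) : R :=
  rho x * (X x w ^+ a * g x x ^+ b * expR (s * X x w - s ^+ 2 / 2 * g x x)).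

Definition chaos_deriv (a b : nat) (s : R) (w : Omega) : R :=
  (\int[m]_x chaos_term a b s w x)%R.

Let term_bound a b : exists K, 0 <= K /\ forall s w x, -1 < s < 1 ->
  `|chaos_term a b s w x| <= K * (rho x * expR (2 * `|X x w|)).
Proof.
have [K [K0 hK]] := @pow_le_exp R a 1 ltr01.
exists (K * `|C| ^+ b); split; first by rewrite mulr_ge0// exprn_ge0.
move=> s w x /andP[s1 s2]; rewrite /chaos_term.
have [Dx|Dx] := pselect (D x); last by rewrite density_on_out// !mul0r normr0 mulr0.
have gx : g x x <= `|C| by rewrite (le_trans (gC Dx))// ler_norm.
rewrite !normrM (ger0_norm (rho0 x)) (mulrCA (K * _)) ler_wpM2l//.
rewrite !normrX (ger0_norm (g0 x)) (ger0_norm (expR_ge0 _)).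
(* One factor absorbs the power |X|^a, the other bounds exp(s X) for |s| < 1. *)
have -> : expR (2 * `|X x w|) = expR (1 * `|X x w|) * expR `|X x w|.
  by rewrite -expRD; congr expR; ring.
rewrite [leRHS](_ : _ = K * expR (1 * `|X x w|) * `|C| ^+ b * expR `|X x w|); last by ring.
apply: ler_pM => //; rewrite ?mulr_ge0 ?exprn_ge0 ?expR_ge0//.
  by apply: ler_pM => //; rewrite ?exprn_ge0//; [exact: hK|rewrite lerXn2r ?nnegrE].
rewrite ler_expR; apply: (@le_trans _ _ (s * X x w)).
  by rewrite gerBl mulr_ge0// divr_ge0// sqr_ge0.
rewrite (le_trans (ler_norm _))// normrM ler_piMl// ler_norml; apply/andP; split; lra.
Qed.

Let term_meas a b s w : measurable_fun setT (chaos_term a b s w).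
Proof.
apply: measurable_funM => //; apply: measurable_funM.
  by apply: measurable_funM; apply: measurable_funX.
by apply: measurableT_comp => //; apply: measurable_funB; apply: measurable_funM.
Qed.

Let term_int a b s w : -1 < s < 1 -> good_set w ->
  m.-integrable setT (EFin \o chaos_term a b s w).
Proof.
move=> s1 Gw; have [K [K0 hK]] := term_bound a b.
apply: (fun mf => integrable_bound measurableT mf
  (integrableZ_EFin measurableT K (envelope_integrable Gw).1)).
  exact: term_meas.
by move=> x _; exact: hK.
Qed.

Let deriv_bound a b : exists K, 0 <= K /\ forall s w, -1 < s < 1 -> good_set w ->
  `|chaos_deriv a b s w| <= K * envelope w.
Proof.
have [K [K0 hK]] := term_bound a b; exists K; split => // s w s1 Gw.
have [i1 i2] := envelope_integrable Gw; have it := term_int a b s1 Gw.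
apply: (le_trans (le_normr_Rintegral _ it)) => //.
apply: (@le_trans _ _ (\int[m]_x (K * (rho x * expR (2 * `|X x w|))))%R).
  apply: le_Rintegral => //; [exact: integrable_norm|exact: integrableZ_EFin|].
  by move=> x _; exact: hK.
by rewrite RintegralZl// ler_wpM2l.
Qed.

Let deriv_meas a b s : measurable_fun setT (chaos_deriv a b s).
Proof.
apply: (@measurable_Rintegral_param _ _ _ _ _ m (fun q : Omega * T => chaos_term a b s q.1 q.2)).
have mX2 : measurable_fun setT (fun q : Omega * T => X q.2 q.1).
  exact: (@measurableT_comp _ _ _ _ _ _ _ _ (fun q : Omega * T => (q.2, q.1)) X_joint
    (measurable_fun_pair measurable_snd measurable_fst)).
have mg2 : measurable_fun setT (fun q : Omega * T => g q.2 q.2).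
  exact: (@measurableT_comp _ _ _ _ _ _ _ _ (fun q : Omega * T => q.2) mg measurable_snd).
apply: measurable_funM; first exact: (measurableT_comp mrho measurable_snd).
apply: measurable_funM; first by apply: measurable_funM; apply: measurable_funX.
by apply: measurableT_comp => //; apply: measurable_funB; apply: measurable_funM.
Qed.

Let is_derive_chaos_deriv a b (s : R) w : -1 < s < 1 -> good_set w ->
  is_derive s 1 (chaos_deriv a b ^~ w)
    (chaos_deriv a.+1 b s w + (- s) * chaos_deriv a b.+1 s w).
Proof.
move=> s1 Gw; have [K1 [K10 h1]] := term_bound a.+1 b; have [K2 [K20 h2]] := term_bound a b.+1.
have [i1 _] := envelope_integrable Gw.
have -> : chaos_deriv a.+1 b s w + (- s) * chaos_deriv a b.+1 s w =
   (\int[m]_x (chaos_term a.+1 b s w x + (- s) * chaos_term a b.+1 s w x))%R.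
  have ia := term_int a.+1 b s1 Gw; have ib := term_int a b.+1 s1 Gw.
  by rewrite RintegralD ?RintegralZl//; exact: integrableZ_EFin.
apply: (@is_derive_under_integral _ _ _ m setT (fun s x => chaos_term a b s w x)
  (fun s x => chaos_term a.+1 b s w x + (- s) * chaos_term a b.+1 s w x)
  (fun x => (K1 + K2) * (rho x * expR (2 * `|X x w|))) s (-1) 1) => //.
- by move=> x x1; exact: term_int.
- move=> u x _ _.
  pose e (u : R) := u * X x w - u ^+ 2 / 2 * g x x.
  have de : is_derive u 1 e (X x w - u * g x x).
    rewrite (_ : e = (X x w \*: id) - ((g x x / 2) \*: (id ^+ 2))); last first.
      apply/funext => y; transitivity (X x w * y - g x x / 2 * y ^+ 2).
        by rewrite /e; ring.
      by rewrite !fctE.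
    by apply: is_derive_eq; rewrite /GRing.scale/=; field.
  pose c := rho x * (X x w ^+ a * g x x ^+ b).
  have := @is_derive1_comp R expR e u _ _ (is_derive_expR _) de.
  move=> /(is_deriveZ c).
  rewrite (_ : c \*: (expR \o e) = (fun s => chaos_term a b s w x)); last first.
    apply/funext => y; transitivity (c * expR (e y)); first by rewrite !fctE.
    by rewrite /c /chaos_term [RHS]mulrA.
  move=> h; apply: is_derive_eq.
  rewrite /GRing.scale/= /chaos_term /c -/(e u) !exprS; ring.
- exact: integrableZ_EFin.
- move=> u x u1 _; apply: (le_trans (ler_normD _ _)); rewrite mulrDl lerD//; first exact: h1.
  rewrite normrM; apply: le_trans (h2 u w x u1); rewrite ler_piMl// normrN ler_norml.
  by case/andP: u1 => u1 u2; rewrite !ltW.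
Qed.

Lemma chaos_deriv_smooth n a b :
  dominated_smooth good_set envelope n (chaos_deriv a b).
Proof.
have base a' b' : dominated_smooth good_set envelope 0 (chaos_deriv a' b').
  split => //; have [K [K0 hK]] := deriv_bound a' b'; exists K, 1%N; split => // s w s1 Gw.
  by rewrite expr1 (le_trans (hK s w s1 Gw))// ler_wpM2l// lerDr.
elim: n a b => [//|n IH] a b.
have [h1 h2 _] := base a b; split => //.
exists (fun s w => chaos_deriv a.+1 b s w + (- s) * chaos_deriv a b.+1 s w); split.
  apply: (dominated_smoothD envelope_ge0) => //.
  apply: (dominated_smoothM envelope_ge0) => //.
  exact: dominated_smoothN_id.
by move=> s w s1 Gw; exact: is_derive_chaos_deriv.
Qed.

(** For s < 0 the right side is the smooth continuation of the chaos in s; this lets derivatives at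
    s = 0 be two-sided. *)
Lemma chaos_deriv00 s w : 0 <= s -> chaos D phi P X (s ^+ 2) w = chaos_deriv 0 0 s w.
Proof.
move=> s0; rewrite (chaosE D phi X_gauss) chaos_intE /chaos_deriv /Rintegral.
congr fine; apply: eq_integral => x _.
by rewrite /chaos_term !expr0 !mul1r sqrtr_sqr ger0_norm.
Qed.

Lemma chaos_deriv00_ge0 s w : 0 <= chaos_deriv 0 0 s w.
Proof. by apply: Rintegral_ge0 => x _; rewrite /chaos_term !expr0 !mul1r mulr_ge0 ?expR_ge0. Qed.

Lemma chaos_deriv00_at0 w : chaos_deriv 0 0 0 w = phibar D phi.
Proof.
rewrite /chaos_deriv /phibar [RHS]/Rintegral.
have := integral_density_on D_meas phi_int; rewrite /Rintegral /phibar => E.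
transitivity (fine (\int[m]_x (rho x)%:E)); last by rewrite E.
congr fine; apply: eq_integral => x _.
by rewrite /chaos_term !expr0 !mul1r mul0r expr0n/= !mul0r subr0 expR0 mulr1.
Qed.

(** Mean value theorem from s = 0, where the path equals [phibar]; the first derivative is dominated
    by a power of the envelope. *)
Lemma chaos_deviation : exists C1 p, 0 <= C1 /\ forall s w, 0 <= s < 1 -> good_set w ->
  `|chaos_deriv 0 0 s w - phibar D phi| <= s * (C1 * (1 + envelope w) ^+ p).
Proof.
have [_ _ [f' [df hf]]] := chaos_deriv_smooth 1 0 0.
have [_ [C1 [p [C10 hC]]] _] := df.
exists C1, p; split => // s w /andP[s0 s1] Gw.
have dz (x : R) : x \in `]0, s[ -> is_derive x 1 (chaos_deriv 0 0 ^~ w) (f' x w).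
  by rewrite in_itv/= => /andP[x0 xs]; apply: hf => //; apply/andP; split; lra.
have cz : {within `[0, s], continuous (chaos_deriv 0 0 ^~ w)}.
  apply: derivable_within_continuous => x; rewrite in_itv/= => /andP[x0 xs].
  by have [|] := hf x w _ Gw; first (apply/andP; split; lra).
have [x] := MVT_segment s0 dz cz.
rewrite in_itv/= => /andP[x0 xs]; rewrite chaos_deriv00_at0 subr0 => ->.
rewrite normrM (ger0_norm s0) mulrC ler_wpM2l//; apply: hC => //.
by apply/andP; split; lra.
Qed.

End chaos_smooth.

(** * Centered moments *)

Section centered_moments.
Context (R : realType).

(** The binomial transform from raw to centered moments; by linearity it is applied to the
    derivatives of the moments too. *)
Definition centered_coef (a : R) (k : nat) (S : nat -> R) : R :=
  \sum_(l < k.+1) 'C(k, l)%:R * (- a) ^+ (k - l) * S l.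

Lemma centered_momentE dO (Omega : measurableType dO) (P : probability Omega R)
    (Z : Omega -> R) (a : R) k :
  (forall l, (l <= k)%N -> P.-integrable setT (EFin \o (fun w => Z w ^+ l))) ->
  P.-integrable setT (EFin \o (fun w => (Z w - a) ^+ k)) /\
  (\int[P]_w ((Z w - a) ^+ k))%R = centered_coef a k (fun l => (\int[P]_w (Z w ^+ l))%R).
Proof.
move=> iZ.
have E w : (Z w - a) ^+ k = \sum_(l < k.+1) 'C(k, l)%:R * (- a) ^+ (k - l) * Z w ^+ l.
  rewrite addrC exprDn; apply: eq_bigr => l _.
  by rewrite -mulr_natl mulrA.
have iT (l : 'I_k.+1) : P.-integrable setT (EFin \o
    (fun w => 'C(k, l)%:R * (- a) ^+ (k - l) * Z w ^+ l)).
  by apply: integrableZ_EFin => //; apply: iZ; rewrite -ltnS.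
split.
  have := @integrable_sumr R _ _ P setT _ (index_enum 'I_k.+1) _ measurableT iT.
  by apply: eq_integrable => // w _ /=; rewrite E.
under eq_Rintegral do rewrite E.
rewrite Rintegral_sum//; apply: eq_bigr => l _.
by rewrite RintegralZl//; apply: iZ; rewrite -ltnS.
Qed.

Lemma centered_coef_deriv (a : R) k (A : nat -> nat -> R -> R) (H : R -> R) (e : R) :
  0 < e ->
  (forall l n (mu : R), (l <= k)%N -> `|mu| < e -> is_derive mu 1 (A l n) (A l n.+1 mu)) ->
  (forall mu, 0 <= mu < e -> H mu = centered_coef a k (fun l => A l 0%N mu)) ->
  forall n, mu_derivablen n H 0 /\
    mu_deriven n H 0 = centered_coef a k (fun l => A l n 0).
Proof.
move=> e0 dA HA n.
pose G n (mu : R) := centered_coef a k (fun l => A l n mu).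
apply: (@right_smooth_deriven _ n e H G) => //; last by rewrite lexx.
move=> j mu _ /andP[mu0 mue].
have mue' : `|mu| < e by rewrite ger0_norm.
rewrite /G /centered_coef.
have : forall (r : seq 'I_k.+1), right_deriv
   (fun mu => \sum_(l <- r) 'C(k, l)%:R * (- a) ^+ (k - l) * A l j mu) mu
   (\sum_(l <- r) 'C(k, l)%:R * (- a) ^+ (k - l) * A l j.+1 mu).
  elim=> [|l r IH].
    rewrite big_nil; under [fun _ => _]eq_fun do rewrite big_nil.
    exact: is_derive_right_deriv (is_derive_cst _ _ _).
  rewrite big_cons; under [fun _ => _]eq_fun do rewrite big_cons.
  apply: right_derivD => //; apply: right_derivZ; apply: is_derive_right_deriv.
  by apply: dA => //; rewrite -ltnS.
exact.
Qed.

End centered_moments.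

(** * Algebraic identities between the intermittency and renormalized series *)

Section series_identities.
Context (R : realType) (d : nat) (D : set (euclid R d)) (phi : euclid R d -> R).
Context (F : R -> R) (kappa : euclid R d -> euclid R d -> R) (M : nat -> R -> R).
Local Notation S l n := (derive1n n (formal_moment D phi kappa l) 0).
Local Notation a := (phibar D phi).
Local Notation dk k n := (centered_coef a k (fun l => S l n)).
Hypothesis S0 : forall n, S 0%N n = (n == 0%N)%:R.
Hypothesis S1 : forall n, S 1%N n = a * (n == 0%N)%:R.

(** The moments of order 0 and 1 are constant in mu, so the terms l = 0, 1 drop out for n > 0; this
    is why the sum in [Hcoef] starts at 2. *)
Lemma centered_coef_Hcoef n k : (0 < n)%N -> (1 < k)%N ->
  dk k n = k`!%:R * Hcoef D phi kappa n k.
Proof.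
move=> n0 k1; have n_neq0 : (n == 0%N) = false by rewrite eqn0Ngt n0.
have kf : k`!%:R != 0 :> R by rewrite pnatr_eq0 -lt0n fact_gt0.
have sg l : (l <= k)%N -> (-1) ^+ (k - l) = (-1) ^+ k * (-1) ^+ l :> R.
  by move=> lk; rewrite -{2}(subnK lk) exprD -mulrA -exprMn mulrNN mulr1 expr1n mulr1.
rewrite /centered_coef -(big_mkord predT (fun l => 'C(k, l)%:R * (- a) ^+ (k - l) * S l n)).
rewrite big_ltn// big_ltn; last by lia.
rewrite (S0 n) (S1 n) n_neq0 !mulr0 !add0r.
rewrite /Hcoef [RHS]mulrA [k`!%:R * _]mulrC divfK// mulr_sumr.
apply: eq_big_nat => l /andP[_ lk]; rewrite [(- a) ^+ _]exprNn sg//; ring.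
Qed.

Lemma centered_coef_low n k : (0 < n)%N -> (k < 2)%N -> dk k n = 0.
Proof.
move=> n0; have n_neq0 : (n == 0%N) = false by rewrite eqn0Ngt n0.
case: k => [|[|//]] _; rewrite /centered_coef !big_ord_recl big_ord0/= ?(S0 n) ?(S1 n) n_neq0.
  by rewrite !mulr0 addr0.
by rewrite !mulr0 !addr0.
Qed.

Hypothesis dk0 : forall k n, (2 * n < k)%N -> dk k n = 0.

Lemma intermittency_fpsE n :
  \sum_(k < (2 * n).+1) derive1n k F a / k`!%:R * (dk k n / n`!%:R) =
  intermittency_fps D phi F kappa n.
Proof.
case: n => [|n].
  rewrite muln0 big_ord_recl big_ord0 addr0 /centered_coef big_ord_recl big_ord0.
  by rewrite (S0 0%N) /= bin0 expr0 fact0 !divr1 !mulr1 addr0 mulr1.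
rewrite /intermittency_fps mulr_sumr.
rewrite -(big_mkord predT (fun k => derive1n k F a / k`!%:R * (dk k n.+1 / n.+1`!%:R))).
rewrite big_ltn// big_ltn; last by lia.
rewrite !centered_coef_low// !mul0r !mulr0 !add0r.
apply: eq_big_nat => k /andP[k1 _]; rewrite centered_coef_Hcoef//.
field; apply/andP; split; by rewrite pnatr_eq0 -lt0n fact_gt0.
Qed.

Hypothesis M_deriv : forall k n, mu_deriven n (M k) 0 = dk k n.

(** Terms beyond k = 2n vanish, so the partial sums are eventually constant and convergence needs no
    estimate. *)
Lemma renormalized_series n N : (0 < n)%N -> (2 * n < N)%N ->
  series (renormalized_term D phi F M n) N =
  \sum_(2 <= k < (2 * n).+1) derive1n k F a * Hcoef D phi kappa n k.
Proof.
move=> n0 nN; rewrite /series/=.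
rewrite (@big_cat_nat _ _ _ (2 * n).+1)//= [X in _ + X](_ : _ = 0) ?addr0; last first.
  rewrite big_nat_cond big1// => k /andP[/andP[nk _] _].
  by rewrite /renormalized_term M_deriv dk0// mulr0.
rewrite big_ltn// big_ltn; last by lia.
rewrite {1 2}/renormalized_term !M_deriv !centered_coef_low// !mulr0 !add0r.
apply: eq_big_nat => k /andP[k1 _]; rewrite /renormalized_term M_deriv centered_coef_Hcoef//.
by rewrite mulrA divfK// pnatr_eq0 -lt0n fact_gt0.
Qed.

Lemma renormalized_cvg n : (0 < n)%N ->
  series (renormalized_term D phi F M n) @ \oo -->
  (\sum_(2 <= k < (2 * n).+1) derive1n k F a * Hcoef D phi kappa n k).
Proof.
move=> n0; apply: cvg_near_cst; exists (2 * n).+1 => // N /= nN.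
exact: renormalized_series.
Qed.

Lemma renormalized_fpsE : renormalized_fps D phi F M = intermittency_fps D phi F kappa.
Proof.
apply/funext => -[//|n]; rewrite /renormalized_fps /intermittency_fps; congr (_ * _).
exact: cvg_lim (renormalized_cvg _).
Qed.

End series_identities.

(** * Fixed regularization *)

Section formal_moments.
Context (R : realType) (d : nat).
Local Notation T := (euclid R d).
Local Notation m := (lebesgue_euclid R d).
Context (D : set T) (phi : T -> R).
Hypothesis D_meas : measurable D.
Hypothesis phi_meas : measurable_fun D phi.
Hypothesis phi_gt0 : forall x, D x -> 0 < phi x.
Hypothesis phi_int : m.-integrable D (EFin \o phi).

Lemma formal_momentE (k : T -> T -> R) l mu :
  formal_moment D phi k l mu = moment_deriv m D phi k l 0 mu.
Proof.
rewrite /formal_moment (pow_setE m D phi (fun t : l.-tuple T =>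
  expR (mu * \sum_(i < l) \sum_(j < l | (i < j)%N) k (tnth t i) (tnth t j)))).
apply: eq_Rintegral => t _; rewrite expr0 mul1r.
by rewrite (weight_pair_sum _ _ _ _ (fun r => expR (mu * r))).
Qed.

Lemma pair_sum_low (k : T -> T -> R) l (t : l.-tuple T) : (l < 2)%N -> pair_sum D k t = 0.
Proof.
move=> l2; rewrite /pair_sum big1// => i _; rewrite big_pred0// => j.
apply/negbTE; rewrite -leqNgt; have := ltn_ord i; have := ltn_ord j; lia.
Qed.

Lemma moment_deriv_low (k : T -> T -> R) l n mu : (l < 2)%N ->
  moment_deriv m D phi k l n mu = phibar D phi ^+ l * (n == 0%N)%:R.
Proof.
move=> l2; transitivity (\int[pow_measure m l]_t (weight D phi t * (n == 0%N)%:R))%R.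
  apply: eq_Rintegral => t _; rewrite pair_sum_low// mulr0 expR0 mulr1.
  by rewrite expr0n; case: n.
have iW := weight_integrable D_meas phi_meas phi_gt0 phi_int l.
rewrite RintegralZr//; congr (_ * _).
by rewrite /Rintegral (integral_weight D_meas phi_meas phi_gt0 phi_int).
Qed.

Lemma moment_deriv_at0 (k : T -> T -> R) l : moment_deriv m D phi k l 0 0 = phibar D phi ^+ l.
Proof.
transitivity (\int[pow_measure m l]_t (weight D phi t))%R.
  by apply: eq_Rintegral => t _; rewrite mul0r expR0 expr0 !mulr1.
by rewrite /Rintegral (integral_weight D_meas phi_meas phi_gt0 phi_int).
Qed.

Lemma derive1n_formal_moment (k : T -> T -> R) l (c : R) :
  measurable_fun (D `*` D) (fun p => k p.1 p.2) -> 0 < c ->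
  (pow_measure m l).-integrable setT (EFin \o
    (fun t : l.-tuple T => weight D phi t * expR (c * `|pair_sum D k t|))) ->
  forall n, derive1n n (formal_moment D phi k l) 0 = moment_deriv m D phi k l n 0.
Proof.
move=> mk c0 ki n.
apply: (@derive1n_eq _ (moment_deriv m D phi k l) _ c).
- exact: is_derive_moment_deriv.
- by move=> mu _; exact: formal_momentE.
- by rewrite normr0.
Qed.
End formal_moments.

Lemma asymptotic_near_eq (R : realType) (G H : R -> R) a :
  (\forall mu \near 0^'+, G mu = H mu) -> asymptotic_to G a -> asymptotic_to H a.
Proof.
move=> GH hG N; have := hG N; apply: cvg_trans; apply: near_eq_cvg.
by apply: filterS GH => mu ->.
Qed.

Lemma smooth_on_derivable (R : realType) N e (H : R -> R) : 0 < e -> smooth_on N e H ->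
  mu_derivablen N H 0.
Proof.
move=> e0 [G sG HG].
by have [] := right_smooth_deriven sG HG (leqnn N) (_ : 0 <= 0 < e); rewrite ?lexx.
Qed.

Section fixed_regularization.
Context (R : realType) (d : nat).
Local Notation T := (euclid R d).
Local Notation m := (lebesgue_euclid R d).
Context (D : set T) (phi : T -> R).
Context dO (Omega : measurableType dO) (P : probability Omega R).
Context (X : T -> Omega -> R) (g : T -> T -> R) (C : R) (F : R -> R).
Hypothesis D_meas : measurable D.
Hypothesis phi_meas : measurable_fun D phi.
Hypothesis phi_gt0 : forall x, D x -> 0 < phi x.
Hypothesis phi_int : m.-integrable D (EFin \o phi).
Hypothesis X_joint : measurable_fun [set: T * Omega] (fun p => X p.1 p.2).
Hypothesis X_gauss : centered_gaussian_process P X g.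
Hypothesis gC : forall x, D x -> g x x <= C.
Hypothesis sF : smooth_poly_growth F.

Local Notation a := (phibar D phi).
Local Notation M := (centered_moment P a (chaos D phi P X)).
Local Notation S l n := (derive1n n (formal_moment D phi g l) 0).
Let EF mu := expect P (F \o chaos D phi P X mu).

Let mom l mu (mu0 : 0 <= mu) :=
  chaos_moment D_meas phi_meas phi_gt0 phi_int X_joint X_gauss gC l mu0.

Let a_ge0 : 0 <= a. Proof. by apply: Rintegral_ge0 => x Dx; rewrite ltW// phi_gt0. Qed.

Lemma chaos_centered_integrable k mu : 0 <= mu ->
  P.-integrable setT (EFin \o (fun w => (chaos D phi P X mu w - a) ^+ k)).
Proof. by move=> mu0; apply: (centered_momentE a (fun l _ => (mom l mu0).1)).1. Qed.

Lemma chaos_smooth_integrable mu : 0 <= mu ->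
  P.-integrable setT (EFin \o (F \o chaos D phi P X mu)).
Proof.
move=> mu0; apply: (@integrable_smooth _ _ _ P (chaos D phi P X) a F) => //.
- exact: (chaos_ge0 phi_gt0 X_gauss).
- exact: (chaos_meas D_meas phi_meas X_joint X_gauss).
- by move=> k; exact: chaos_centered_integrable.
Qed.

Lemma chaos_formal_deriv l n : S l n = moment_deriv m D phi g l n 0.
Proof.
apply: (derive1n_formal_moment D_meas phi_meas phi_gt0 (g_meas_on X_joint X_gauss) ltr01).
exact: (g_weight_exp_integrable D_meas phi_meas phi_gt0 phi_int X_joint X_gauss gC).
Qed.

Lemma chaos_centered_deriv k n : mu_derivablen n (M k) 0 /\
  mu_deriven n (M k) 0 = centered_coef a k (fun l => S l n).
Proof.
have M_eq mu : 0 <= mu < 1 ->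
    M k mu = centered_coef a k (fun l => moment_deriv m D phi g l 0 mu).
  move=> /andP[mu0 _]; rewrite /centered_moment expectE.
  rewrite (centered_momentE a (fun l _ => (mom l mu0).1)).2.
  by rewrite /centered_coef; apply: eq_bigr => l _; rewrite (mom l mu0).2.
have [|h1 h2] := @centered_coef_deriv _ a k (moment_deriv m D phi g) (M k) 1 ltr01 _ M_eq n.
  move=> l j mu _ mu1; apply: (is_derive_moment_deriv D_meas phi_meas phi_gt0
    (g_meas_on X_joint X_gauss) ltr01) => //.
  exact: (g_weight_exp_integrable D_meas phi_meas phi_gt0 phi_int X_joint X_gauss gC).
split => //; rewrite h2 /centered_coef; apply: eq_bigr => l _.
by rewrite chaos_formal_deriv.
Qed.

Let good := good_set D phi X g.
Let env := envelope D phi X g C.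
Let good_meas : measurable good := good_set_meas D_meas phi_meas X_joint X_gauss.
Let env_ge0 := envelope_ge0 X g C phi_gt0.
Let env_int := envelope_int D_meas phi_meas phi_gt0 phi_int X_joint X_gauss gC.

Let Rintegral_good (f : Omega -> R) : P.-integrable setT (EFin \o f) ->
  (\int[P]_w f w)%R = (\int[P]_(w in good) f w)%R.
Proof.
move=> fi; rewrite /Rintegral; congr fine.
have [N [mN N0 sN]] := good_set_ae D_meas phi_meas phi_gt0 phi_int X_joint X_gauss gC.
have h : P (~` good) = 0%E.
  apply/eqP; rewrite eq_le measure_ge0 andbT -N0 le_measure ?inE//.
  exact: measurableC.
rewrite (negligible_integral (measurableC good_meas) measurableT fi h).
by rewrite setDE setCK setTI.
Qed.

(** The k-th power of the pathwise deviation bound, integrated over the good set. *)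
Lemma chaos_centered_bound k : exists B, forall mu, 0 <= mu < 1 ->
  `|M k mu| <= Num.sqrt mu ^+ k * B.
Proof.
have [C1 [p [C10 h]]] := chaos_deviation D_meas phi_meas phi_gt0 phi_int X_joint X_gauss gC.
exists (\int[P]_(w in good) (C1 ^+ k * (1 + env w) ^+ (p * k)))%R => mu /andP[mu0 mu1].
have ik := chaos_centered_integrable k mu0.
rewrite /centered_moment expectE Rintegral_good//.
have ig := integrableS measurableT good_meas (@subsetT _ good) ik.
have s0 := sqrtr_ge0 mu.
have s1 : Num.sqrt mu < 1 by rewrite -sqrtr1 ltr_sqrt.
apply: (le_trans (le_normr_Rintegral good_meas ig)).
rewrite -RintegralZl//; last by apply: integrableZ_EFin => //; exact: env_int.
apply: le_Rintegral => //.
- exact: integrable_norm.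
- by do 2 (apply: integrableZ_EFin => //); exact: env_int.
move=> w Gw; rewrite normrX exprM -!exprMn lerXn2r ?nnegrE ?mulr_ge0 ?exprn_ge0 ?addr_ge0
  ?env_ge0//.
rewrite -{1}(sqr_sqrtr mu0) (chaos_deriv00 _ _ X_gauss)//.
by apply: h => //; rewrite s0.
Qed.

Lemma chaos_centered_coef0 k n : (2 * n < k)%N -> centered_coef a k (fun l => S l n) = 0.
Proof.
move=> nk; rewrite -(chaos_centered_deriv k n).2.
have t := asymptotic_taylor (fun j => (chaos_centered_deriv k j).1).
suff : taylor_fps (M k) n = 0.
  by rewrite /taylor_fps => /eqP; rewrite mulf_eq0 invr_eq0 pnatr_eq0 -leqn0 leqNgt fact_gt0 orbF
    => /eqP.
(* The zero polynomial is also an expansion of [M k] to order n, because the moment is o(mu^n). *)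
apply: (@asymptotic_unique_upto _ n (M k) _ (fun=> 0) (t n) _ n (leqnn n)).
have [B hB] := chaos_centered_bound k.
apply/norm_cvg0P; apply: (@squeeze_cvgr _ _ _ _ (cst 0) (fun mu => Num.sqrt mu * `|B|)).
- near=> mu; rewrite normr_ge0/=.
  have mu0 : 0 < mu by [].
  have mu1 : mu < 1 by near: mu; exact: nbhs_right_lt.
  have s0 : 0 < Num.sqrt mu by rewrite sqrtr_gt0.
  have s1 : Num.sqrt mu <= 1 by rewrite -sqrtr1 ler_sqrt// ltW.
  rewrite big1 ?subr0 => [|i _]; last by rewrite mul0r.
  rewrite normrM normfV (gtr0_norm (exprn_gt0 _ mu0)) ler_pdivrMr ?exprn_gt0//.
  apply: (le_trans (hB mu _)); first by rewrite ltW.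
  apply: (@le_trans _ _ (Num.sqrt mu ^+ k * `|B|)).
    by rewrite ler_wpM2l ?exprn_ge0 ?sqrtr_ge0// ler_norm.
  rewrite mulrAC ler_wpM2r//.
  (* As k is at least 2n + 1, a factor sqrt mu survives the division by mu^n. *)
  apply: (@le_trans _ _ (Num.sqrt mu ^+ (2 * n).+1)); first by apply: ler_wiXn2l => //; exact:
    ltW.
  by rewrite exprS exprM sqr_sqrtr// ltW.
- exact: cvg_cst.
- rewrite -[X in _ --> X](mul0r `|B|) -[X in X * _]sqrtr0.
  apply: cvgM; last exact: cvg_cst.
  by apply: cvg_at_right_filter; exact: sqrt_continuous.
Unshelve. all: end_near. Qed.

Lemma chaos_expansion : asymptotic_to EF (intermittency_fps D phi F g).
Proof.
have := @expect_asymptotic _ _ _ P (chaos D phi P X) a F (fun k => taylor_fps (M k)) a_ge0 sF.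
rewrite (_ : (fun n => _) = intermittency_fps D phi F g); last first.
  apply/funext => n; rewrite -(@intermittency_fpsE _ _ D phi F g).
  - by apply: eq_bigr => k _; rewrite /taylor_fps (chaos_centered_deriv k n).2.
  - by move=> j; rewrite chaos_formal_deriv moment_deriv_low// expr0 mul1r.
  - by move=> j; rewrite chaos_formal_deriv moment_deriv_low// expr1.
apply.
- exact: (chaos_ge0 phi_gt0 X_gauss).
- by apply: nearW => mu; exact: (chaos_meas D_meas phi_meas X_joint X_gauss).
- by move=> k; near=> mu; apply: chaos_centered_integrable.
- by move=> k; apply: asymptotic_taylor => j; exact: (chaos_centered_deriv k j).1.
- move=> k n nk; rewrite /taylor_fps (chaos_centered_deriv k n).2.
  by rewrite chaos_centered_coef0// mul0r.
Unshelve. all: end_near. Qed.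

Lemma chaos_expect_derivable n : mu_derivablen n EF 0.
Proof.
pose f s w := F (chaos_deriv D phi X g 0 0 s w).
have sf N : dominated_smooth good env N f.
  apply: (dominated_smooth_comp env_ge0) => //; last first.
    by move=> s w _ _; exact: chaos_deriv00_ge0.
  exact: (chaos_deriv_smooth D_meas phi_meas phi_gt0 X_joint X_gauss gC).
pose h k := derive1n k (expect_on P good f).
have hE mu : 0 <= mu -> EF mu = h 0%N (Num.sqrt mu).
  move=> mu0; rewrite /EF expectE Rintegral_good; last exact: chaos_smooth_integrable.
  apply: eq_Rintegral => w _ /=.
  by rewrite -{1}(sqr_sqrtr mu0) (chaos_deriv00 _ _ X_gauss)// sqrtr_ge0.
have hd k (s : R) : 0 <= s < 1 -> right_deriv (h k) s (h k.+1 s).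
  move=> /andP[s0 s1]; apply: is_derive_right_deriv.
  apply: (is_derive_expect_on_n good_meas env_int (sf k.+1)) => //.
  by apply/andP; split => //; lra.
(* The expansion obtained from the moments contains only powers of mu, which is the missing input of
   [whitney]. *)
have ha : asymptotic_to (fun mu => h 0%N (Num.sqrt mu)) (intermittency_fps D phi F g).
  apply: asymptotic_near_eq chaos_expansion.
  by near=> mu; apply: hE.
have [G sG HG] := whitney hd ha n.
apply: (smooth_on_derivable ltr01); exists G => // mu mu01; rewrite -HG// hE//.
by case/andP: mu01.
Unshelve. all: end_near. Qed.

Lemma chaos_taylor : taylor_fps EF = intermittency_fps D phi F g.
Proof.
exact: asymptotic_unique (asymptotic_taylor chaos_expect_derivable) chaos_expansion.
Qed.

Lemma fixed_regularization :
  [/\ forall mu, 0 <= mu -> P.-integrable setT (EFin \o (F \o chaos D phi P X mu)),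
      (forall n, mu_derivablen n EF 0) /\ (forall k n, mu_derivablen n (M k) 0),
      forall n, (0 < n)%N -> cvgn (series (renormalized_term D phi F M n)),
      taylor_fps EF = intermittency_fps D phi F g &
      taylor_fps EF = renormalized_fps D phi F M].
Proof.
have S0 n : S 0%N n = (n == 0%N)%:R.
  by rewrite chaos_formal_deriv moment_deriv_low// expr0 mul1r.
have S1 n : S 1%N n = a * (n == 0%N)%:R.
  by rewrite chaos_formal_deriv moment_deriv_low// expr1.
split.
- exact: chaos_smooth_integrable.
- by split => [|k n]; [exact: chaos_expect_derivable|exact: (chaos_centered_deriv k n).1].
- move=> n n0; apply/cvg_ex; eexists.
  exact: (@renormalized_cvg _ _ D phi F g M S0 S1 chaos_centered_coef0
    (fun k j => (chaos_centered_deriv k j).2)).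
- exact: chaos_taylor.
- rewrite chaos_taylor; apply/esym.
  exact: (@renormalized_fpsE _ _ D phi F g M S0 S1 chaos_centered_coef0
    (fun k j => (chaos_centered_deriv k j).2)).
Qed.

End fixed_regularization.

(** * Removal of the regularization *)

Section almost_everywhere.
Context (R : realType) dO (Omega : measurableType dO) (P : probability Omega R).
Implicit Types Y Z : Omega -> R.

Lemma integral_eq0_ae Y : (forall w, 0 <= Y w) -> P.-integrable setT (EFin \o Y) ->
  (\int[P]_w Y w)%R = 0 -> {ae P, forall w, Y w = 0}.
Proof.
move=> Y0 iY E; have mY := measurable_int _ iY.
have : ae_eq P setT (EFin \o Y) (cst 0%E).
  apply/ae_eq_integral_abs => //.
  under eq_integral do rewrite /= ger0_norm//.
  by rewrite -EFin_Rintegral// E.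
by apply: filterS => w /(_ Logic.I) [].
Qed.

Lemma ae_eq_integrable Y Z : measurable_fun setT Y -> measurable_fun setT Z ->
  {ae P, forall w, Y w = Z w} ->
  P.-integrable setT (EFin \o Y) -> P.-integrable setT (EFin \o Z).
Proof.
move=> mY mZ YZ /integrableP[_ iY]; apply/integrableP; split; first exact/measurable_EFinP.
rewrite (_ : (\int[P]_w _)%E = (\int[P]_w `|(EFin \o Y) w|)%E)//.
apply: ae_eq_integral => //; last by apply: filterS YZ => w /= ->.
  by apply: measurableT_comp => //; exact/measurable_EFinP.
by apply: measurableT_comp => //; exact/measurable_EFinP.
Qed.

Lemma ae_eq_expect Y Z : measurable_fun setT Y -> measurable_fun setT Z ->
  {ae P, forall w, Y w = Z w} -> expect P Y = expect P Z.
Proof.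
move=> mY mZ YZ; rewrite !expectE /Rintegral; congr fine; apply: ae_eq_integral => //.
- exact/measurable_EFinP.
- exact/measurable_EFinP.
- by apply: filterS YZ => w /= ->.
Qed.

End almost_everywhere.

Section regularization_limit.
Context (R : realType) (d : nat).
Local Notation T := (euclid R d).
Local Notation m := (lebesgue_euclid R d).
Context (D : set T) (phi : T -> R).
Context dO (Omega : measurableType dO) (P : probability Omega R).
Context (X : R -> T -> Omega -> R) (g : R -> T -> T -> R) (g0 : T -> T -> R).
Context (mu0 c K : R) (I : R -> Omega -> R) (F : R -> R).
Hypothesis D_meas : measurable D.
Hypothesis phi_meas : measurable_fun D phi.
Hypothesis phi_gt0 : forall x, D x -> 0 < phi x.
Hypothesis phi_int : m.-integrable D (EFin \o phi).
Hypothesis X_gauss : forall eps, 0 < eps -> centered_gaussian_process P (X eps) (g eps).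
Hypothesis X_joint : forall eps, 0 < eps ->
  measurable_fun [set: T * Omega] (fun p => X eps p.1 p.2).
Hypothesis X_regular : forall eps, 0 < eps -> exists C, forall x, D x -> g eps x x <= C.
Hypothesis g0_meas : measurable_fun (D `*` D) (fun p => g0 p.1 p.2).
Hypothesis g_cvg : {ae (m \x m)%E, forall p, D p.1 -> D p.2 ->
  g eps p.1 p.2 @[eps --> 0^'+] --> g0 p.1 p.2}.
Hypothesis c_gt0 : 0 < c.
Hypothesis g_expint : \forall eps \near 0^'+,
  (\int[m]_(x in D) \int[m]_(y in D)
     (phi x * phi y * expR (c * `|g eps x y|))%:E <= K%:E)%E.
Hypothesis mu0_gt0 : 0 < mu0.
Hypothesis I_meas : forall mu, measurable_fun setT (I mu).
Hypothesis I_limit : forall mu, 0 <= mu < mu0 ->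
  cvg_in_law P (fun eps => chaos D phi P (X eps) mu) (I mu).
Hypothesis sF : smooth_poly_growth F.

Local Notation a := (phibar D phi).
Local Notation S k l n := (derive1n n (formal_moment D phi k l) 0).
Let EF mu := expect P (F \o I mu).
Local Notation M := (centered_moment P a I).

Let a_ge0 : 0 <= a. Proof. by apply: Rintegral_ge0 => x Dx; rewrite ltW// phi_gt0. Qed.

(** The exponential rate guaranteed uniformly in eps for the pair sum over l points; it decreases
    with l. *)
Let rate l : R := c / (pair_count l).+1%:R.

Let rate_gt0 l : 0 < rate l. Proof. by rewrite divr_gt0. Qed.

Let rate_le l k : (l <= k)%N -> rate k <= rate l.
Proof.
move=> lk; rewrite ler_wpM2l ?(ltW c_gt0)// lef_pV2 ?posrE// ler_nat ltnS.
by rewrite /pair_count leq_mul.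
Qed.

Let gm eps : 0 < eps -> measurable_fun (D `*` D) (fun p => g eps p.1 p.2).
Proof. by move=> e0; exact: (g_meas_on (X_joint e0) (X_gauss e0)). Qed.

Let near_weight_exp l : \forall eps \near 0^'+, (\int[pow_measure m l]_t
  (weight D phi t * expR (rate l * `|pair_sum D (g eps) t|))%:E <=
  (exp_bound m D phi K l)%:E)%E.
Proof.
near=> eps; apply: weight_exp_bound => //; first exact: gm.
by near: eps; exact: g_expint.
Unshelve. all: end_near. Qed.

(** Half of the rate is lost because passing to the limit requires a bound on the square of the
    integrand. *)
Lemma limit_exp_integrable l : (pow_measure m l).-integrable setT (EFin \o
  (fun t : l.-tuple T => weight D phi t * expR (rate l / 2 * `|pair_sum D g0 t|))).
Proof.
have [] := @pair_sum_limit R _ _ m D phi D_meas phi_meas phi_gt0 phi_int g g0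
  gm g0_meas g_cvg l (fun x => expR (rate l / 2 * `|x|)) 1 (exp_bound m D phi K l) (rate l) => //.
- move=> x; apply: continuous_comp; last exact: continuous_expR.
  by apply: cvgM; [exact: cvg_cst|exact: norm_continuous].
- by move=> x; rewrite mul1r -expRM_natl ler_expR; lra.
Qed.

Lemma moment_deriv_cvg l n (mu : R) : `|mu| < rate l / 2 ->
  moment_deriv m D phi (g eps) l n mu @[eps --> 0^'+] --> moment_deriv m D phi g0 l n mu.
Proof.
move=> mur.
(* The squared integrand grows like x^(2n) exp(2 |mu| |x|); the remaining rate absorbs the power. *)
have e0 : 0 < rate l - 2 * `|mu| by lra.
have [C [C0 hC]] := pow_le_exp (2 * n) e0.
have [] := @pair_sum_limit R _ _ m D phi D_meas phi_meas phi_gt0 phi_int g g0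
  gm g0_meas g_cvg l (fun x => x ^+ n * expR (mu * x)) C (exp_bound m D phi K l) (rate l) => //.
- move=> x; apply: cvgM; first exact: exprn_continuous.
  apply: continuous_comp; last exact: continuous_expR.
  by apply: cvgM; [exact: cvg_cst|exact: cvg_id].
- move=> x; rewrite exprMn -exprM mulnC -expRM_natl.
  rewrite -(ger0_norm (exprn_even_ge0 _ _)) ?mul2n ?odd_double// -mul2n normrX.
  apply: (le_trans (ler_wpM2r (expR_ge0 _) (hC _ (normr_ge0 x)))).
  rewrite -mulrA -expRD ler_wpM2l// ler_expR.
  have : mu * x <= `|mu| * `|x| by rewrite -normrM ler_norm.
  lra.
Qed.

Lemma limit_formal_deriv l n : S g0 l n = moment_deriv m D phi g0 l n 0.
Proof.
have r0 : 0 < rate l / 2 by rewrite divr_gt0.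
exact: (derive1n_formal_moment D_meas phi_meas phi_gt0 g0_meas r0 (limit_exp_integrable l)).
Qed.

Let regular_formal_deriv eps l n : 0 < eps -> S (g eps) l n = moment_deriv m D phi (g eps) l n 0.
Proof.
move=> e0; have [C hC] := X_regular e0.
exact: (chaos_formal_deriv D_meas phi_meas phi_gt0 phi_int (X_joint e0) (X_gauss e0) hC).
Qed.

Lemma formal_deriv_cvg l n : S (g eps) l n @[eps --> 0^'+] --> S g0 l n.
Proof.
rewrite limit_formal_deriv.
have := @moment_deriv_cvg l n 0; rewrite normr0 divr_gt0// => /(_ isT).
apply: cvg_trans; apply: near_eq_cvg; near=> eps.
by rewrite regular_formal_deriv.
Unshelve. all: end_near. Qed.

Lemma intermittency_cvg n : intermittency_fps D phi F (g eps) n @[eps --> 0^'+] -->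
  intermittency_fps D phi F g0 n.
Proof.
case: n => [|n]; first exact: cvg_cst.
apply: cvgM; first exact: cvg_cst.
apply: cvg_sum_seq => k _; apply: cvgM; first exact: cvg_cst.
apply: cvgM; first exact: cvg_cst.
apply: cvg_sum_seq => l _; apply: cvgM; first exact: cvg_cst.
exact: formal_deriv_cvg.
Qed.

(** No pathwise deviation bound is at hand for the limit kernel; the coefficient vanishes as a limit
    of zeros. *)
Lemma limit_centered_coef0 k n : (2 * n < k)%N -> centered_coef a k (fun l => S g0 l n) = 0.
Proof.
move=> nk.
have h : centered_coef a k (fun l => S (g eps) l n) @[eps --> 0^'+] -->
    centered_coef a k (fun l => S g0 l n).
  apply: cvg_sum_seq => l _; apply: cvgM; first exact: cvg_cst.
  exact: formal_deriv_cvg.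
apply: (cvg_unique _ h) => //; apply: cvg_near_cst; near=> eps.
have e0 : 0 < eps by [].
have [C hC] := X_regular e0.
exact: (chaos_centered_coef0 D_meas phi_meas phi_gt0 phi_int (X_joint e0) (X_gauss e0) hC).
Unshelve. all: end_near. Qed.

Lemma limit_ge0 mu : 0 <= mu < mu0 -> {ae P, forall w, 0 <= I mu w}.
Proof.
(* h is bounded, continuous, nonnegative, and vanishes exactly on [0, +oo[. *)
move=> mu01; pose h (x : R) := (`|x| - x) / (1 + (`|x| - x)).
have p x : 0 <= `|x| - x :> R by rewrite subr_ge0 ler_norm.
have q x : 0 < 1 + (`|x| - x) :> R by rewrite ltr_pwDl.
have h0 x : 0 <= h x by rewrite divr_ge0// ltW.
have h1 x : `|h x| <= 1.
  by rewrite ger0_norm// ler_pdivrMr// mul1r lerDr.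
have ch : continuous h.
  have cp : continuous (fun x : R => `|x| - x).
    by move=> x; apply: cvgB; [exact: norm_continuous|exact: cvg_id].
  move=> x; apply: cvgM; first exact: cp.
  apply: cvgV; first by rewrite gt_eqF.
  by apply: cvgD; [exact: cvg_cst|exact: cp].
have mh : measurable_fun setT (h \o I mu).
  by apply: measurableT_comp => //; exact: continuous_measurable_fun.
have E : expect P (h \o I mu) = 0.
  apply: (cvg_unique _ (I_limit mu01 ch (ex_intro _ 1 h1))) => //.
  apply: cvg_near_cst; near=> eps.
  have e0 : 0 < eps by [].
  rewrite expectE /Rintegral; under eq_integral => w _.
    have -> : (h \o chaos D phi P (X eps) mu) w = 0.
      by rewrite /h/= ger0_norm ?subrr ?mul0r// (chaos_ge0 phi_gt0 (X_gauss e0)).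
    over.
  by rewrite integral0.
have ih : P.-integrable setT (EFin \o (h \o I mu)).
  apply: (@integrable_bound _ _ _ _ _ _ (cst 1)) => //.
    exact: finite_measure_integrable_cst.
  by move=> w _; exact: h1.
rewrite expectE in E.
apply: filterS (integral_eq0_ae (fun w => h0 (I mu w)) ih E) => w /eqP.
rewrite /h/= mulf_eq0 invr_eq0 (gt_eqF (q _)) orbF subr_eq0 => /eqP <-; exact: normr_ge0.
Unshelve. all: end_near. Qed.

(** Convergence of the k-th moment uses its second moment, of order 2k, hence the rate at 2k; the
    half is the one required by [moment_deriv_cvg], and [mu0] bounds the range of convergence in
    law. *)
Let moment_range k : R := Num.min mu0 (rate (2 * k) / 2).

Let moment_range_gt0 k : 0 < moment_range k.
Proof. by rewrite lt_min mu0_gt0 divr_gt0. Qed.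

(** The regularized moments have two limits: one by convergence in law with bounded second moments,
    the other by convergence of the kernels. Equating them gives the formula. *)
Lemma limit_moment l mu : 0 <= mu < moment_range l ->
  P.-integrable setT (EFin \o (fun w => I mu w ^+ l)) /\
  (\int[P]_w (I mu w ^+ l))%R = moment_deriv m D phi g0 l 0 mu.
Proof.
rewrite lt_min => /andP[mu_ge0 /andP[mu_mu0 mu_rate]].
have r2 := rate_gt0 (2 * l).
have rl : rate (2 * l) <= rate l by apply: rate_le; lia.
have [] := @weak_cvg _ _ _ P (cst 1) _ _ R 0^'+ _ (fun eps w => chaos D phi P (X eps) mu w ^+ l)
  (fun w => I mu w ^+ l) (exp_bound m D phi K (2 * l)).
- by move=> w; exact: ler01.
- exact: finite_measure_integrable_cst.
- near=> eps; have e0 : 0 < eps by [].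
  apply: measurable_funX.
  exact: (chaos_meas D_meas phi_meas (X_joint e0) (X_gauss e0)).
- exact: measurable_funX.
- move=> h ch [B hB].
  have cg : continuous (fun x : R => h (x ^+ l)).
    by move=> x; apply: continuous_comp; [exact: exprn_continuous|exact: ch].
  have eR (f : Omega -> R) : (\int[P]_w (cst 1 w * f w))%R = expect P f.
    by rewrite expectE; apply: eq_Rintegral => w _; rewrite mul1r.
  rewrite eR; under eq_fun do rewrite eR.
  by apply: (I_limit _ cg (ex_intro _ B (fun x => hB (x ^+ l)))); rewrite mu_ge0.
- near=> eps; have e0 : 0 < eps by [].
  have [C hC] := X_regular e0.
  have [i E] := chaos_moment D_meas phi_meas phi_gt0 phi_int (X_joint e0) (X_gauss e0) hC (2 * l)
    mu_ge0.
  under eq_integral do rewrite mul1r -exprM mulnC.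
  rewrite -EFin_Rintegral// E /moment_deriv EFin_Rintegral; last first.
    exact: (moment_deriv_integrable D_meas phi_meas phi_gt0 phi_int (X_joint e0) (X_gauss e0) hC).
  apply: (@le_trans _ _ (\int[pow_measure m (2 * l)]_t
    (weight D phi t * expR (rate (2 * l) * `|pair_sum D (g eps) t|))%:E)%E); last first.
    by near: eps; exact: near_weight_exp.
  have mps : measurable_fun setT (fun t : (2 * l).-tuple T => pair_sum D (g eps) t).
    by apply: pair_sum_meas => //; exact: gm.
  have mW : measurable_fun setT (fun t : (2 * l).-tuple T => weight D phi t).
    exact: weight_meas.
  apply: ge0_le_integral => //.
  + by move=> t _; rewrite lee_fin expr0 mul1r mulr_ge0 ?expR_ge0 ?weight_ge0.
  + apply/measurable_EFinP; apply: measurable_funM => //; apply: measurable_funM.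
      exact: measurable_funX.
    by apply: measurableT_comp => //; exact: measurable_funM.
  + apply/measurable_EFinP; apply: measurable_funM => //; apply: measurableT_comp => //.
    by apply: measurable_funM => //; exact: measurableT_comp.
  move=> t _; rewrite lee_fin expr0 mul1r ler_wpM2l ?weight_ge0// ler_expR.
  apply: (@le_trans _ _ (mu * `|pair_sum D (g eps) t|)).
    by rewrite ler_wpM2l// ler_norm.
  by rewrite ler_wpM2r//; lra.
move=> _ i cv; split.
  by apply: eq_integrable i => // w _ /=; rewrite mul1r.
have E1 : (\int[P]_w (1 * I mu w ^+ l))%R = (\int[P]_w (I mu w ^+ l))%R.
  by apply: eq_Rintegral => w _; rewrite mul1r.
rewrite -E1; apply: (cvg_unique _ cv) => //.
have := @moment_deriv_cvg l 0 mu; rewrite ger0_norm// (_ : mu < rate l / 2); last by lra.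
move=> /(_ isT); apply: cvg_trans; apply: near_eq_cvg; near=> eps.
have e0 : 0 < eps by [].
have [C hC] := X_regular e0.
rewrite -(chaos_moment D_meas phi_meas phi_gt0 phi_int (X_joint e0) (X_gauss e0) hC l mu_ge0).2.
by apply: eq_Rintegral => w _; rewrite mul1r.
Unshelve. all: end_near. Qed.

Let moment_range_le l k : (l <= k)%N -> moment_range k <= moment_range l.
Proof.
move=> lk; rewrite le_min ge_min lexx/= ge_min ler_pM2r// rate_le ?orbT//.
by rewrite leq_mul.
Qed.

Lemma limit_centered k mu : 0 <= mu < moment_range k ->
  P.-integrable setT (EFin \o (fun w => (I mu w - a) ^+ k)) /\
  M k mu = centered_coef a k (fun l => moment_deriv m D phi g0 l 0 mu).
Proof.
move=> /andP[mu_ge0 mu_lt].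
have hl l : (l <= k)%N -> 0 <= mu < moment_range l.
  by move=> lk; rewrite mu_ge0 (lt_le_trans mu_lt)// moment_range_le.
have [i E] := centered_momentE a (fun l lk => (limit_moment (hl l lk)).1).
split=> //; rewrite /centered_moment expectE E.
by apply: eq_bigr => l _; rewrite (limit_moment (hl l _)).2// -ltnS.
Qed.

Lemma limit_centered_deriv k n : mu_derivablen n (M k) 0 /\
  mu_deriven n (M k) 0 = centered_coef a k (fun l => S g0 l n).
Proof.
have [|h1 h2] := @centered_coef_deriv _ a k (moment_deriv m D phi g0) (M k) (moment_range k)
  (moment_range_gt0 k) _ (fun mu h => (limit_centered h).2) n.
  move=> l j mu lk; rewrite lt_min => /andP[_ mu1].
  have r0 : 0 < rate l / 2 by rewrite divr_gt0.
  apply: (is_derive_moment_deriv D_meas phi_meas phi_gt0 g0_meas r0 (limit_exp_integrable l)).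
  apply: (lt_le_trans mu1); rewrite ler_pM2r// rate_le//; lia.
by split => //; rewrite h2; apply: eq_bigr => l _; rewrite limit_formal_deriv.
Qed.

Let mF : measurable_fun setT F.
Proof. exact: (smooth_measurable 0 sF). Qed.

Let norm_meas mu : measurable_fun setT (fun w => `|I mu w|).
Proof. exact: measurableT_comp. Qed.

Let norm_ae mu : 0 <= mu < mu0 -> {ae P, forall w, I mu w = `|I mu w|}.
Proof. by move=> h; apply: filterS (limit_ge0 h) => w w0; rewrite ger0_norm. Qed.

(** [expect_asymptotic] wants a variable that is nonnegative everywhere, while [I mu] is so almost
    surely; its absolute value has the same moments. *)
Let centered_norm k mu : 0 <= mu < moment_range k ->
  P.-integrable setT (EFin \o (fun w => (`|I mu w| - a) ^+ k)) /\
  M k mu = centered_moment P a (fun mu w => `|I mu w|) k mu.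
Proof.
move=> h; have h0 : 0 <= mu < mu0.
  by case/andP: h => ->; rewrite lt_min => /andP[->].
have ae : {ae P, forall w, (I mu w - a) ^+ k = (`|I mu w| - a) ^+ k}.
  by apply: filterS (norm_ae h0) => w <-.
have m1 : measurable_fun setT (fun w => (I mu w - a) ^+ k).
  by apply: measurable_funX; exact: measurable_funB.
have m2 : measurable_fun setT (fun w => (`|I mu w| - a) ^+ k).
  by apply: measurable_funX; exact: measurable_funB.
by split; [exact: ae_eq_integrable ae (limit_centered h).1|exact: ae_eq_expect].
Qed.

Let near_range k (Q : R -> Prop) : (forall mu, 0 <= mu < moment_range k -> Q mu) ->
  \forall mu \near 0^'+, Q mu.
Proof.
move=> h; near=> mu; apply: h; apply/andP; split; first by [].
by near: mu; apply: nbhs_right_lt; exact: moment_range_gt0.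
Unshelve. all: end_near. Qed.

Let F_norm mu : 0 <= mu < mu0 -> {ae P, forall w, F `|I mu w| = F (I mu w)}.
Proof. by move=> h; apply: filterS (norm_ae h) => w <-. Qed.

(** The growth of F fixes an order 2q, and that moment is known to be finite on [moment_range] at
    2q. *)
Lemma limit_smooth_integrable : \forall mu \near 0^'+, P.-integrable setT (EFin \o (F \o I mu)).
Proof.
have [C [q [C0 h]]] := taylor_even_bound 0 sF a_ge0.
apply: (@near_range q.*2) => mu hmu.
have h0 : 0 <= mu < mu0.
  by case/andP: hmu => ->; rewrite lt_min => /andP[->].
have mFI : measurable_fun setT (fun w => F `|I mu w|).
  exact: (measurableT_comp mF (norm_meas mu)).
apply: (ae_eq_integrable mFI (measurableT_comp mF (I_meas mu)) (F_norm h0)).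
apply: (@integrable_bound _ _ _ _ _ _ (fun w =>
  C * ((`|I mu w| - a) ^+ 0 + (`|I mu w| - a) ^+ q.*2))) => //.
  apply: integrableZ_EFin => //; apply: integrableD_EFin => //.
    by rewrite (_ : (fun w => _ ^+ 0) = cst 1)//; exact: finite_measure_integrable_cst.
  exact: (centered_norm hmu).1.
by move=> w _; have := h _ (normr_ge0 (I mu w)); rewrite /taylor_sum big_ord0 subr0.
Qed.

Let S0 n : S g0 0%N n = (n == 0%N)%:R.
Proof. by rewrite limit_formal_deriv moment_deriv_low// expr0 mul1r. Qed.

Let S1 n : S g0 1%N n = a * (n == 0%N)%:R.
Proof. by rewrite limit_formal_deriv moment_deriv_low// expr1. Qed.

Lemma limit_expansion : asymptotic_to EF (intermittency_fps D phi F g0).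
Proof.
have -> : intermittency_fps D phi F g0 = fun n =>
    \sum_(k < (2 * n).+1) derive1n k F a / k`!%:R * taylor_fps (M k) n.
  apply/funext => n; rewrite -(intermittency_fpsE F S0 S1).
  by apply: eq_bigr => k _; rewrite /taylor_fps (limit_centered_deriv k n).2.
have := @expect_asymptotic _ _ _ P (fun mu w => `|I mu w|) a F (fun k => taylor_fps (M k)) a_ge0
  sF.
move=> H; apply: asymptotic_near_eq (H _ _ _ _ _).
- apply: (@near_range 0) => mu /andP[mu_ge0]; rewrite lt_min => /andP[mu1 _].
  apply: ae_eq_expect; [exact: (measurableT_comp mF (norm_meas mu))|exact:
    (measurableT_comp mF (I_meas mu))|].
  by apply: F_norm; rewrite mu_ge0.
- by [].
- by apply: nearW => mu; exact: norm_meas.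
- by move=> k; apply: (@near_range k) => mu /centered_norm[].
- move=> k; apply: asymptotic_near_eq; last first.
    by apply: asymptotic_taylor => j; exact: (limit_centered_deriv k j).1.
  by apply: (@near_range k) => mu /centered_norm[].
- move=> k n nk; rewrite /taylor_fps (limit_centered_deriv k n).2.
  by rewrite limit_centered_coef0// mul0r.
Qed.

(** At mu = 0 the second moment about [phibar] is a^2 - 2 a^2 + a^2 = 0, so [I 0] equals [phibar]
    almost surely. *)
Lemma limit_at0 : EF 0 = F a.
Proof.
have h : (0:R) <= 0 < moment_range 2 by apply/andP; split.
have [i E] := limit_centered h.
have {}E : (\int[P]_w ((I 0 w - a) ^+ 2))%R = 0.
  rewrite -expectE; apply: (etrans E); rewrite /centered_coef.
  rewrite !big_ord_recl big_ord0 !(moment_deriv_at0 D_meas phi_meas phi_gt0 phi_int)/=.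
  rewrite /bump/= bin0 bin1 binn !addn0 !subn0/= !subnn expr0 !expr1; ring.
have ae : {ae P, forall w, F (I 0 w) = cst (F a) w}.
  apply: filterS (integral_eq0_ae _ i E) => [w|w]; last exact: sqr_ge0.
  by move/eqP; rewrite sqrf_eq0 subr_eq0 => /eqP ->.
rewrite /EF (ae_eq_expect (measurableT_comp mF (I_meas 0)) _ ae)//.
by rewrite /expect expectation_cst.
Qed.

(** Order 0 is separate: [mu_derivablen 0] carries no continuity at 0, so the value there is taken
    from [limit_at0] and not from the expansion at 0+. *)
Lemma limit_taylor n : mu_derivablen n EF 0 ->
  taylor_fps EF n = intermittency_fps D phi F g0 n.
Proof.
case: n => [_|n dn]; first by rewrite /taylor_fps/= limit_at0 fact0 divr1.
exact: (asymptotic_unique_upto (peano dn) (limit_expansion n.+1)).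
Qed.

Lemma regularization_limit :
  [/\ \forall mu \near 0^'+, P.-integrable setT (EFin \o (F \o I mu)),
      forall k n, mu_derivablen n (M k) 0,
      forall n, (0 < n)%N -> cvgn (series (renormalized_term D phi F M n)),
      asymptotic_to EF (intermittency_fps D phi F g0) /\
      (forall n, mu_derivablen n EF 0 -> taylor_fps EF n = intermittency_fps D phi F g0 n) &
      intermittency_fps D phi F g0 = renormalized_fps D phi F M].
Proof.
split.
- exact: limit_smooth_integrable.
- by move=> k n; exact: (limit_centered_deriv k n).1.
- move=> n n0; apply/cvg_ex; eexists.
  exact: (@renormalized_cvg _ _ D phi F g0 M S0 S1 limit_centered_coef0
    (fun k j => (limit_centered_deriv k j).2)).
- by split; [exact: limit_expansion|exact: limit_taylor].
- apply/esym.
  exact: (@renormalized_fpsE _ _ D phi F g0 M S0 S1 limit_centered_coef0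
    (fun k j => (limit_centered_deriv k j).2)).
Qed.

End regularization_limit.

Theorem corollary2 (R : realType) (d : nat)
  (D : set (euclid R d)) (phi : euclid R d -> R)
  (dO : measure_display) (Omega : measurableType dO) (P : probability Omega R)
  (X : R -> euclid R d -> {RV P >-> R})
  (g : R -> euclid R d -> euclid R d -> R) (g0 : euclid R d -> euclid R d -> R)
  (mu0 : R) (I : R -> {RV P >-> R}) (F : R -> R)
  (D_compact : euclid_compact D) (D_meas : measurable D)
  (phi_meas : measurable_fun D phi) (phi_gt0 : forall x, D x -> 0 < phi x)
  (phi_int : (lebesgue_euclid R d).-integrable D (EFin \o phi))
  (X_gauss : forall eps, 0 < eps ->
     centered_gaussian_process P (X eps) (g eps))
  (X_meas : forall eps, 0 < eps ->
     measurable_fun [set: euclid R d * Omega] (fun p => X eps p.1 p.2))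
  (X_regular : forall eps, 0 < eps ->
     exists C, forall x, D x -> g eps x x <= C)
  (g0_meas : measurable_fun (D `*` D) (fun p => g0 p.1 p.2))
  (g_cvg : {ae (lebesgue_euclid R d \x lebesgue_euclid R d)%E,
     forall p, D p.1 -> D p.2 -> g eps p.1 p.2 @[eps --> 0^'+] --> g0 p.1 p.2})
  (g_expint : exists c K : R, 0 < c /\ \forall eps \near 0^'+,
     (\int[lebesgue_euclid R d]_(x in D) \int[lebesgue_euclid R d]_(y in D)
        (phi x * phi y * expR (c * `|g eps x y|))%:E <= K%:E)%E)
  (mu0_gt0 : 0 < mu0)
  (I_limit : forall mu, 0 <= mu < mu0 ->
     cvg_in_law P (fun eps => chaos D phi P (X eps) mu) (I mu))
  (F_smooth : smooth_poly_growth F) :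
  [/\ (forall eps, 0 < eps ->
       let EF := fun mu => expect P (F \o chaos D phi P (X eps) mu) in
       let m := centered_moment P (phibar D phi) (chaos D phi P (X eps)) in
       [/\ forall mu, 0 <= mu -> P.-integrable setT
             (EFin \o (F \o chaos D phi P (X eps) mu)),
           (forall n, mu_derivablen n EF 0) /\
           (forall k n, mu_derivablen n (m k) 0),
           forall n, (0 < n)%N -> cvgn (series (renormalized_term D phi F m n)),
           taylor_fps EF = intermittency_fps D phi F (g eps) &
           taylor_fps EF = renormalized_fps D phi F m]),
      (forall n, intermittency_fps D phi F (g eps) n @[eps --> 0^'+] -->
                 intermittency_fps D phi F g0 n) &
      (let EF := fun mu => expect P (F \o I mu) in
       let m := centered_moment P (phibar D phi) I in
       [/\ \forall mu \near 0^'+,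
             P.-integrable setT (EFin \o (F \o I mu)),
           forall k n, mu_derivablen n (m k) 0,
           forall n, (0 < n)%N -> cvgn (series (renormalized_term D phi F m n)),
           asymptotic_to EF (intermittency_fps D phi F g0) /\
           (forall n, mu_derivablen n EF 0 ->
              taylor_fps EF n = intermittency_fps D phi F g0 n) &
           intermittency_fps D phi F g0 = renormalized_fps D phi F m])].
Proof.
have [c [K [c0 hK]]] := g_expint.
split.
- move=> eps eps0; have [C hC] := X_regular eps eps0.
  exact: (fixed_regularization D_meas phi_meas phi_gt0 phi_int (X_meas eps eps0)
    (X_gauss eps eps0) hC F_smooth).
- move=> n; exact: (intermittency_cvg D_meas phi_meas phi_gt0 phi_int X_gauss X_meas
    X_regular g0_meas g_cvg c0 hK).
- have I_meas mu : measurable_fun setT (I mu) by exact: measurable_funPT.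
  have [h1 h2 h3 h4 h5] := regularization_limit D_meas phi_meas phi_gt0 phi_int X_gauss X_meas
    X_regular g0_meas g_cvg c0 hK mu0_gt0 I_meas I_limit F_smooth.
  by move=> EF m; split.
Qed.
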